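(* Fix $T\in(0,\infty)$. Let $\lambda:[0,T]\to(0,\infty)$ be a weight function that is uniformly bounded away from zero, i.e. $\|\tfrac1\lambda\|_{[0,T]}:=\sup_{t\in[0,T]}\tfrac1{|\lambda_t|}<\infty$. Let $\theta:[0,T]\to\mathbb R$ be absolutely continuous with $\theta_0=0$ and $E_T(\theta):=\frac12\int_0^T|\frac{\mathrm d}{\mathrm dt}\theta_t|^2\,\mathrm dt<\infty$. Let $\mathfrak h_t$ be the solution to the single-curve radial Loewner equation in the covering coordinate $$\partial_t\mathfrak h_t(u)=\lambda_t\cot\Big(\frac{\mathfrak h_t(u)-\theta_t}{2}\Big),\qquad\mathfrak h_0(u)=u,$$ and let $\mathfrak f_t:=\mathfrak h_t^{-1}$ be its inverse map. (1) Then for all $t\in[0,T]$, $$|\mathfrak f_t'(\theta_t+\mathrm iy)|\le\exp\Big(\tfrac12\,\|\tfrac1\lambda\|_{[0,T]}\,E_T(\theta)\Big),\qquad\text{for all }y>0.$$ (2) Moreover, $\theta$ generates a simple radial chord $\gamma_{[0,T]}$ in $\mathbb D$ with the $\lambda$-parameterization.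
   Context: A weight function is a c\`adl\`ag (right-continuous with left limits), locally integrable function with values in $(0,\infty)$. The radial Loewner chain with weight $\lambda$ and driving function $w_t=e^{\mathrm i\theta_t}$ is the solution of $\partial_t\mathfrak g_t(z)=\lambda_t\,\mathfrak g_t(z)\frac{w_t+\mathfrak g_t(z)}{w_t-\mathfrak g_t(z)}$, $\mathfrak g_0(z)=z$, $z\in\overline{\mathbb D}$. With $K^{\mathfrak g}_t$ the set of points $z\in\overline{\mathbb D}$ swallowed (i.e. $\mathfrak g_s(z)$ has hit $w_s$ in the sense that $\inf|\mathfrak g_s(z)-w_s|=0$) by time $t$, the map $\mathfrak g_t:\mathbb D\smallsetminus K^{\mathfrak g}_t\to\mathbb D$ is conformal with $\mathfrak g_t(0)=0$, $\mathfrak g_t'(0)>0$. The map $\mathfrak h_t$ is the lift of $\mathfrak g_t$ through $u\mapsto e^{\mathrm iu}$ given by $\mathfrak g_t(e^{\mathrm iu})=\exp(\mathrm i\mathfrak h_t(u))$; it maps $\{u\in\mathbb H:e^{\mathrm iu}\in\mathbb D\smallsetminus K^{\mathfrak g}_t\}$ conformally onto the upper half-plane $\mathbb H$, so $\mathfrak f_t$ is defined on $\mathbb H$. ''$\theta$ generates a radial chord $\gamma_{[0,T]}$ in $\mathbb D$ with the $\lambda$-parameterization'' means that there is a continuous map $t\mapsto\gamma_t$ from $[0,T]$ to $\overline{\mathbb D}$ with $\gamma_0=e^{\mathrm i\theta_0}\in\partial\mathbb D$ such that, for every $t\in[0,T]$, the image $\gamma_{[0,t]}$ generates $K^{\mathfrak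 g}_t$, i.e. $\mathbb D\smallsetminus K^{\mathfrak g}_t$ is the connected component of $\mathbb D\smallsetminus\gamma_{[0,t]}$ containing $0$. The chord is simple if $\gamma$ is injective and $\gamma_{(0,T]}\subset\mathbb D$. *)

(* Defs.v *)
From HB Require Import structures.
From mathcomp Require Import all_boot all_order all_algebra.
From mathcomp Require Import all_classical all_reals all_analysis.
From mathcomp Require Import complex.

Set Implicit Arguments.
Unset Strict Implicit.
Unset Printing Implicit Defensive.

Import Order.TTheory GRing.Theory Num.Theory.
Import numFieldNormedType.Exports.

Local Open Scope classical_set_scope.
Local Open Scope ring_scope.
Local Open Scope complex_scope.

(* R[i] packed as a numClosedFieldType, so that it carries the topology and
   the normed module structure over itself that MathComp-Analysis gives to
   every numClosedFieldType; [derivable _ z 1] and [derive1] on functions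
   cplx R -> cplx R are then complex differentiability and the complex
   derivative. The order on cplx R is z <= z' iff Im z = Im z' and
   Re z <= Re z', and `|z| is the modulus as an element of cplx R. *)
Definition cplx (R : realType) : numClosedFieldType := R[i].

Definition cexp (R : realType) (z : cplx R) : cplx R :=
  (expR (complex.Re z))%:C * (cos (complex.Im z) +i* sin (complex.Im z)).

Definition ccos (R : realType) (z : cplx R) : cplx R :=
  (cexp ('i * z) + cexp (- ('i * z))) / 2.

Definition csin (R : realType) (z : cplx R) : cplx R :=
  (cexp ('i * z) - cexp (- ('i * z))) / (2 * 'i).

Definition ccot (R : realType) (z : cplx R) : cplx R := ccos z / csin z.

Definition cintegral (R : realType) (t : R) (f : R -> cplx R) : cplx R :=
  (\int[lebesgue_measure]_(s in `[0, t]) complex.Re (f s)) +i*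
  (\int[lebesgue_measure]_(s in `[0, t]) complex.Im (f s)).

Definition unit_disc (R : realType) : set (cplx R) := [set z | `|z| < 1].

Definition upper_half_plane (R : realType) : set (cplx R) :=
  [set u | 0 < complex.Im u].

(* Functions of time are total functions on R of which only the restriction to
   [0, T] matters. *)

Definition cadlag (R : realType) (T : R) (lam : R -> R) : Prop :=
  (forall t : R, 0 <= t < T -> lam x @[x --> t^'+] --> lam t) /\
  (forall t : R, 0 < t <= T -> cvg (lam x @[x --> t^'-])).

(* On the compact interval [0, T], locally integrable means integrable. *)
Definition weight_function (R : realType) (T : R) (lam : R -> R) : Prop :=
  [/\ forall t, 0 <= t <= T -> 0 < lam t,
      cadlag T lam &
      lebesgue_measure.-integrable `[0, T] (EFin \o lam)].

Definition inv_weight_values (R : realType) (T : R) (lam : R -> R) : set R :=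
  [set `|lam t|^-1 | t in `[0, T]].

Definition inv_weight_norm (R : realType) (T : R) (lam : R -> R) : R :=
  sup (inv_weight_values T lam).

Definition absolutely_continuous (R : realType) (T : R) (f : R -> R) : Prop :=
  forall e : R, 0 < e -> exists2 d : R, 0 < d &
    forall (n : nat) (a b : 'I_n -> R),
      (forall i, [/\ 0 <= a i, a i <= b i & b i <= T]) ->
      trivIset setT (fun i => `]a i, b i[%classic) ->
      \sum_(i < n) (b i - a i) < d ->
      \sum_(i < n) `|f (b i) - f (a i)| < e.

(* For theta absolutely continuous on [0, T], [derive1 theta] is the classical
   derivative at almost every point of [0, T]; its values elsewhere do not
   affect the integral. *)
Definition energy (R : realType) (T : R) (theta : R -> R) : \bar R :=
  ((2^-1)%:E *
   \int[lebesgue_measure]_(t in `[0%R, T]) (`|derive1 theta t| ^+ 2)%:E)%E.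

Definition driving (R : realType) (theta : R -> R) (t : R) : cplx R :=
  cexp ('i * (theta t)%:C).

(* x is the trajectory of z under
     d/dt x_t = lam_t * x_t * (w_t + x_t) / (w_t - x_t),  x_0 = z,
   on the time interval J (which contains 0), w being the driving function.
   As lam may jump, the equation is meant in integrated form; at t = 0 it
   reads x 0 = z. Since 1 / 0 = 0 in MathComp, staying away from the
   singularity has to be required explicitly. *)
Definition radial_trajectory (R : realType) (lam theta : R -> R) (J : set R)
    (z : cplx R) (x : R -> cplx R) : Prop :=
  [/\ {within J, continuous x},
      forall t, J t -> x t != driving theta t &
      forall t, J t ->
        x t = z + cintegral t (fun s =>
          (lam s)%:C * x s *
          ((driving theta s + x s) / (driving theta s - x s)))].

(* The points of the closed disc swallowed by time t: those whose trajectory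
   comes arbitrarily close to the driving function on a time interval
   [0, sigma[ with sigma <= t. The point w_0 is swallowed at time 0; the
   equation is singular there from the start. *)
Definition radial_hull (R : realType) (lam theta : R -> R) (t : R) :
    set (cplx R) :=
  [set z | `|z| <= 1 /\
    (z = driving theta 0 \/
     exists (sigma : R) (x : R -> cplx R),
       [/\ 0 < sigma <= t,
           radial_trajectory lam theta `[0, sigma[ z x &
           inf [set complex.Re `|x s - driving theta s|
               | s in `[0, sigma[] = 0])].

(* Same conventions as for [radial_trajectory], for
     d/dt x_t = lam_t * cot ((x_t - theta_t) / 2),  x_0 = u. *)
Definition covering_trajectory (R : realType) (lam theta : R -> R) (J : set R)
    (u : cplx R) (x : R -> cplx R) : Prop :=
  [/\ {within J, continuous x},
      forall t, J t -> csin ((x t - (theta t)%:C) / 2) != 0 &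
      forall t, J t ->
        x t = u + cintegral t (fun s =>
          (lam s)%:C * ccot ((x s - (theta s)%:C) / 2))].

Definition covering_domain (R : realType) (lam theta : R -> R) (t : R) :
    set (cplx R) :=
  [set u | upper_half_plane u /\
           (unit_disc (R:=R) `\` radial_hull lam theta t) (cexp ('i * u))].

Definition covering_flow (R : realType) (T : R) (lam theta : R -> R)
    (h : R -> cplx R -> cplx R) : Prop :=
  forall t u, 0 <= t <= T -> covering_domain lam theta t u ->
    covering_trajectory lam theta `[0, t] u (h ^~ u).

(* The inverse of h_t : covering_domain lam theta t -> upper_half_plane; the
   value outside the image of h_t is irrelevant. *)
Definition inverse_flow (R : realType) (lam theta : R -> R)
    (h : R -> cplx R -> cplx R) (t : R) : cplx R -> cplx R :=
  'pinv_(fun=> 0) (covering_domain lam theta t) (h t).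

Definition generates_radial_chord (R : realType) (T : R) (lam theta : R -> R)
    (gamma : R -> cplx R) : Prop :=
  [/\ {within `[0, T], continuous gamma},
      forall t, 0 <= t <= T -> `|gamma t| <= 1,
      gamma 0 = driving theta 0 &
      forall t, 0 <= t <= T ->
        unit_disc (R:=R) `\` radial_hull lam theta t =
        connected_component (unit_disc (R:=R) `\` (gamma @` `[0, t])) 0].

Definition simple_chord (R : realType) (T : R) (gamma : R -> cplx R) : Prop :=
  set_inj `[0, T] gamma /\ gamma @` `]0, T] `<=` unit_disc (R:=R).

(* Main.v *)
(* Let L be the clock int_0^t lam, let P = U + i V = (w + x) / (w - x), so that a trajectory x in
   the disc satisfies dx = x P dL, and let N = |x|^2 and E = |w - x|^2.  Cauchy-Schwarz gives a
   function n with (d theta)^2 <= dL dn and n T - n 0 <= 2 |1/lam| E_T(theta); a functional with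
   increments rho dL + v dtheta where v^2 <= kappa rho then decreases by at most kappa / 4 times
   the increment of n (complete the square).  No time change is made: all derivatives are taken
   with respect to L and theta jointly.

   (1) The flow line through exp(i z) at time t is found by Picard iteration for its logarithm,
   and log |f_t'| = int_0^t (1 + V^2 - U^2) / 2 dL along it.  Adding ln E - ln (1 - N) turns the
   integrand into V^2 dL - V dtheta, which costs at most (n t - n 0) / 4, and ln E - ln (1 - N) is
   larger at time 0 than at time t, where x lies on the ray through w.

   (2) The angle functional ln E + ln N / 2 - 2 ln (1 - N) has increments
   (1 + 2 V^2) dL - V dtheta, hence is almost increasing, and a trajectory on which it is large is
   repelled from w.  So it stays bounded on swallowed trajectories, which makes |w_r - x_r| small
   when r is close to the swallowing time.  For two trajectories the sum of ln |x - x'|^2 and of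
   the mean of the angle functionals is again almost increasing; therefore exactly one point
   gamma_t is swallowed at time t, and gamma is continuous.  That point is the limit of the starting
   points of the flow lines through (1 - 2^-k) w_t at time t.  The unswallowed points of the disc
   are exactly the starting points of flow lines defined up to time t; the segment from 0 to the
   endpoint of such a flow line pulls back to a connected set joining 0 to the starting point. *)

Require Import Defs.
From HB Require Import structures.
From mathcomp Require Import all_boot all_order all_algebra.
From mathcomp Require Import all_classical all_reals all_analysis.
From mathcomp Require Import complex.
From mathcomp Require Import measurable_realfun ring lra.

Set Implicit Arguments.
Unset Strict Implicit.
Unset Printing Implicit Defensive.

Import Order.TTheory GRing.Theory Num.Theory.
Import numFieldNormedType.Exports.

Local Open Scope classical_set_scope.
Local Open Scope ring_scope.
Local Open Scope complex_scope.

(** * Absolutely continuous functions *)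

Section absolutely_continuous_functions.
Context (R : realType).
Implicit Types (f : R -> R) (a b T : R) (s : seq R).

(** The weight may jump, and then trajectories have no time derivative; along the clock they have
    one at every interior time, because their velocity is continuous and [lam] enters only through
    dL. The driving function has no derivative along the clock in general, but (d theta)^2 <= dL dn
    with n continuous makes its squared increments o(dL). Hence the product and chain rules hold to
    first order at every time, without an Ito correction. Forward in time the equation is singular
    at w, whereas backward in time |x| decreases: a flow line with endpoint z stays in the disc of
    radius |z|, where the velocity is Lipschitz. So flow lines are built backward from their
    endpoints, and statements about given trajectories follow by uniqueness. The price is
    uniformity: as the endpoints tend to w_t the Lipschitz constants blow up. What survives are the
    bounds from the angle functional, which do not depend on the endpoint; they give the convergence
    of the starting points and also a definite distance from the circle at every time before t. *)

Definition steps a s : seq (R * R) := zip (a :: s) s.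

Lemma sum_steps_length a s : \sum_(p <- steps a s) (p.2 - p.1) = last a s - a.
Proof.
rewrite /steps; elim: s a => [|x s IH] a /=; first by rewrite big_nil subrr.
by rewrite big_cons /= IH; ring.
Qed.

Lemma sum_steps_variation f a b s : itv_partition a b s ->
  \sum_(p <- steps a s) `|f p.2 - f p.1| = variation a b f s.
Proof.
move=> abs; rewrite variation_zip// /steps; move: abs => _.
elim: s a => [|x s IH] a /=; first by rewrite !big_nil.
by rewrite !big_cons /= IH.
Qed.

Lemma steps_within a s : path <%R a s ->
  all (fun p : R * R => (a <= p.1) && (p.1 <= p.2) && (p.2 <= last a s)) (steps a s).
Proof.
rewrite /steps; elim: s a => [//|x s IH] a /= /andP[ax xs].
have := IH _ xs => xsub.
have xl : x <= last x s.
  move: xs {xsub IH}; elim: s x {ax} => [//|y s IH] x /= /andP[xy ys].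
  exact: le_trans (ltW xy) (IH _ ys).
rewrite lexx (ltW ax) xl /=.
apply: sub_all xsub => p /andP[/andP[xp ->] ->]; rewrite !andbT.
exact: le_trans (ltW ax) xp.
Qed.

Definition apart (p q : R * R) := (p.2 <= q.1) || (q.2 <= p.1).

Lemma steps_apart a s : path <%R a s -> pairwise apart (steps a s).
Proof.
rewrite /steps; elim: s a => [//|x s IH] a /= /andP[ax xs].
rewrite IH// andbT; apply: sub_all (steps_within xs) => p /andP[/andP[xp _] _].
by rewrite /apart /= xp.
Qed.

(** Partitions are lists of varying length, and those of several intervals are later concatenated,
    whereas the definition indexes families by ordinals. Closed intervals that are [apart] may share
    an endpoint, but their interiors are disjoint, as the definition asks. *)
Lemma absolutely_continuous_seq T f : absolutely_continuous T f ->
  forall e, 0 < e -> exists2 d : R, 0 < d & forall s : seq (R * R),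
    all (fun p : R * R => (0 <= p.1) && (p.1 <= p.2) && (p.2 <= T)) s ->
    pairwise apart s ->
    \sum_(p <- s) (p.2 - p.1) < d ->
    \sum_(p <- s) `|f p.2 - f p.1| < e.
Proof.
move=> acf e e0; have [d d0 H] := acf e e0; exists d => // s s0T sap sd.
have := H (size s) (fun i => (nth (0, 0) s i).1) (fun i => (nth (0, 0) s i).2).
rewrite (big_nth (0, 0)) big_mkord in sd *; rewrite (big_nth (0, 0)) big_mkord.
apply => //.
- by move=> i; have /allP/(_ _ (mem_nth (0, 0) (ltn_ord i)))/andP[/andP[]] := s0T.
- move=> i j _ _ [x /= []]; rewrite !in_itv/= => /andP[xi1 xi2] /andP[xj1 xj2].
  apply/val_inj/eqP; apply: contraPT (sap) => ij.
  have {ij} [ij|ij] : (i < j)%N \/ (j < i)%N.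
    by move: ij; rewrite neq_ltn => /orP.
  + move=> /(pairwiseP (0, 0))/(_ i j (ltn_ord i) (ltn_ord j) ij) /orP[] h.
      by have := lt_trans xj1 (lt_le_trans xi2 h); rewrite ltxx.
    by have := lt_trans xi1 (lt_le_trans xj2 h); rewrite ltxx.
  + move=> /(pairwiseP (0, 0))/(_ j i (ltn_ord j) (ltn_ord i) ij) /orP[] h.
      by have := lt_trans xi1 (lt_le_trans xj2 h); rewrite ltxx.
    by have := lt_trans xj1 (lt_le_trans xi2 h); rewrite ltxx.
Qed.

Lemma absolutely_continuous_dist T f : absolutely_continuous T f ->
  forall e, 0 < e -> exists2 d : R, 0 < d & forall x y,
    0 <= x -> x <= y -> y <= T -> y - x < d -> `|f y - f x| < e.
Proof.
move=> /absolutely_continuous_seq H e e0; have [d d0 {}H] := H e e0.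
exists d => // x y x0 xy yT xyd; have := H [:: (x, y)].
by rewrite /= !big_seq1/= x0 xy yT; exact.
Qed.

(* On an interval shorter than the modulus for e = 1 every variation is at most 1. *)
Lemma absolutely_continuous_bounded_variation T f : 0 <= T ->
  absolutely_continuous T f -> bounded_variation 0 T f.
Proof.
move=> T0 /absolutely_continuous_seq/(_ 1 ltr01)[d d0 H].
have small x y : 0 <= x -> x <= y -> y <= T -> y - x < d ->
    bounded_variation x y f.
  move=> x0 xy yT xyd; exists 1 => _ [s [xs /eqP ys] <-].
  rewrite -sum_steps_variation; last by split=> //; apply/eqP.
  apply/ltW/H; last by rewrite sum_steps_length ys.
    apply: sub_all (steps_within xs) => p /andP[/andP[xp ->]]; rewrite ys => py.
    by rewrite (le_trans x0 xp) (le_trans py yT).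
  exact: steps_apart.
have [n nd] : exists n : nat, T < n.+1%:R * (d / 2).
  exists (Num.bound (T / (d / 2))); rewrite -ltr_pdivrMr ?divr_gt0//.
  by rewrite (lt_trans (archi_boundP _))// ?divr_ge0// ?ltr_nat// ltW ?divr_gt0.
(* Pieces of length [d / 2] are strictly shorter than the modulus; cutting at [T] keeps the last one
   in the domain. *)
have main k : bounded_variation 0 (Num.min T (k%:R * (d / 2))) f.
  elim: k => [|k IH].
    by rewrite mul0r min_r//; exact: bounded_variationxx.
  set u := Num.min T (k%:R * (d / 2)) in IH *.
  set v := Num.min T (k.+1%:R * (d / 2)).
  have u0 : 0 <= u by rewrite le_min T0 mulr_ge0// ltW ?divr_gt0.
  have uv : u <= v.
    rewrite le_min ge_min lexx/= ge_min; apply/orP; right.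
    by rewrite ler_wpM2r ?ler_nat// ltW ?divr_gt0.
  have vT : v <= T by rewrite ge_min lexx.
  apply/bounded_variationP; first exact: le_trans uv.
  rewrite (@total_variationD _ _ _ u)// fin_numD.
  apply/andP; split; first exact/bounded_variationP.
  apply/bounded_variationP => //; apply: small => //.
  rewrite /u /v -natr1 mulrDl mul1r /Num.min.
  by case: ifPn => ?; case: ifPn => ?; lra.
have := main n.+1; rewrite min_l//; exact: ltW.
Qed.

Definition tvar f (x : R) : R := fine (total_variation 0 x f).

Lemma tvarB T f x y : bounded_variation 0 T f -> 0 <= x -> x <= y -> y <= T ->
  (tvar f y - tvar f x)%:E = total_variation x y f.
Proof.
move=> bv x0 xy yT; have y0 := le_trans x0 xy.
have fx : total_variation 0 x f \is a fin_num.
  by apply/bounded_variationP => //; apply: bounded_variationl bv => //; exact: le_trans yT.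
have fy : total_variation 0 y f \is a fin_num.
  by apply/bounded_variationP => //; apply: bounded_variationl bv.
rewrite EFinB /tvar !fineK// (total_variationD f x0 xy) addeAC subee ?add0e//.
Qed.

Lemma tvar_ge T f x y : bounded_variation 0 T f -> 0 <= x -> x <= y -> y <= T ->
  `|f y - f x| <= tvar f y - tvar f x.
Proof.
by move=> bv x0 xy yT; rewrite -lee_fin (tvarB bv)//; exact: total_variation_ge.
Qed.

(** In each interval a partition is taken whose variation is within e / 2 / (n + 1) of the total
    variation. All these partitions together form one family, to which the modulus of [f] for e / 2
    applies. *)
Lemma tvar_absolutely_continuous T f : 0 <= T ->
  absolutely_continuous T f -> absolutely_continuous T (tvar f).
Proof.
move=> T0 acf e e0.
have bv := absolutely_continuous_bounded_variation T0 acf.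
have [d d0 H] := absolutely_continuous_seq acf (divr_gt0 e0 (ltr0n _ 2)).
exists d => // n a b hab tri sd.
have part i : exists s, [/\ path <%R (a i) s, last (a i) s = b i &
    `|tvar f (b i) - tvar f (a i)| <=
      \sum_(p <- steps (a i) s) `|f p.2 - f p.1| + e / 2 / n.+1%:R].
  have [ai ab bi] := hab i.
  have eta : 0 < e / 2 / n.+1%:R by rewrite !divr_gt0.
  move: (ab); rewrite le_eqVlt => /predU1P[<-|ablt].
    by exists [::]; rewrite subrr normr0 big_nil add0r ltW.
  have := tvarB bv ai ab bi => tvE.
  have tvfin : total_variation (a i) (b i) f \is a fin_num by rewrite -tvE.
  have [_ [_ [s abs <-] <-]] := ub_ereal_sup_adherent eta tvfin.
  rewrite -/(total_variation (a i) (b i) f) -tvE -EFinB lte_fin => hs.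
  have [h1 /eqP h2] := abs; exists s; split => //.
  rewrite ger0_norm; last by rewrite -lee_fin tvE total_variation_ge0.
  rewrite (sum_steps_variation _ abs).
  by rewrite -lerBlDr ltW.
have [s sP] := choice part.
have key : \sum_(i < n) \sum_(p <- steps (a i) (s i)) `|f p.2 - f p.1| < e / 2.
  (* An interval reduced to a point contributes no steps. Once such intervals are left out, two
     intervals that are not apart share the midpoint of their intersection, and [tri] identifies
     their indices. *)
  set I := [seq i <- index_enum 'I_n | a i < b i].
  have degenerate i : ~~ (a i < b i) -> steps (a i) (s i) = [::].
    move=> /negP aib; have [h1 h2 _] := sP i.
    case: (s i) h1 h2 aib => [//|x l] /= /andP[ax xl] xb.
    suff : a i < b i by [].
    rewrite -xb (lt_le_trans ax)//.
    have := steps_within xl; move: xl {xb ax}.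
    elim: l x => [//|y l IH] x /= /andP[xy yl] /andP[/andP[_ h] _].
    exact: le_trans (ltW xy) h.
  have nondeg (F : R * R -> R) :
      \sum_(i < n) \sum_(p <- steps (a i) (s i)) F p =
      \sum_(p <- flatten [seq steps (a i) (s i) | i <- I]) F p.
    rewrite big_flatten /= big_map big_filter [RHS]big_mkcond /=.
    apply: eq_bigr => i _; case: ifPn => // /degenerate ->.
    by rewrite big_nil.
  rewrite nondeg; apply: H.
  - apply/allP => p /flatten_mapP[i _ pi].
    have [h1 h2 _] := sP i; have [ai ab bi] := hab i.
    have /allP/(_ _ pi)/andP[/andP[q1 ->] q2] := steps_within h1.
    by rewrite (le_trans ai q1) andTb (le_trans q2)// h2.
  - have : uniq I by rewrite filter_uniq ?index_enum_uniq.
    have : {subset I <= [pred i | a i < b i]}.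
      by move=> i; rewrite mem_filter => /andP[].
    elim: (I) => [//|i J IH] /= IJ /andP[iJ uJ].
    rewrite pairwise_cat IH ?andbT//; last by move=> j jJ; apply: IJ; rewrite inE jJ orbT.
    have [h1 h2 _] := sP i.
    rewrite (steps_apart h1) andbT; apply/allrelP => p q pi /flatten_mapP[j jJ qj].
    have [k1 k2 _] := sP j.
    have abi : a i < b i by apply: IJ; rewrite inE eqxx.
    have abj : a j < b j by apply: IJ; rewrite inE jJ orbT.
    have /allP/(_ _ pi)/andP[/andP[p1 p2]] := steps_within h1; rewrite h2 => p3.
    have /allP/(_ _ qj)/andP[/andP[q1 q2]] := steps_within k1; rewrite k2 => q3.
    have [bal|bal] := leP (b i) (a j).
      by rewrite /apart (le_trans p3 (le_trans bal q1)).
    have [bal'|bal'] := leP (b j) (a i).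
      by rewrite /apart (le_trans q3 (le_trans bal' p1)) orbT.
    suff : i = j by move=> ij; move: iJ; rewrite ij jJ.
    apply: tri => //; exists ((Num.max (a i) (a j) + Num.min (b i) (b j)) / 2).
    rewrite /= !in_itv/= /Num.max /Num.min.
    by split; case: ifPn => ?; case: ifPn => ?; lra.
  - rewrite -nondeg; apply: le_lt_trans sd; rewrite le_eqVlt; apply/orP; left.
    apply/eqP/eq_bigr => i _; rewrite sum_steps_length.
    by have [_ -> _] := sP i.
have : \sum_(i < n) `|tvar f (b i) - tvar f (a i)| <=
    \sum_(i < n) (\sum_(p <- steps (a i) (s i)) `|f p.2 - f p.1| + e / 2 / n.+1%:R).
  by apply: ler_sum => i _; have [_ _] := sP i.
rewrite big_split/= sumr_const card_ord => /le_lt_trans; apply.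
rewrite [ltRHS](splitr e); apply: ltr_leD => //.
rewrite -(mulr_natr (e / 2 / n.+1%:R)) mulrAC ler_pdivrMr// ler_wpM2l ?ler_nat//.
by rewrite ltW ?divr_gt0.
Qed.

End absolutely_continuous_functions.

(** * Densities of absolutely continuous functions *)

Section density.
Context (R : realType).
Notation mu := (@lebesgue_measure R).
Implicit Types (F : R -> R) (T : R).

(** Composition with it extends a function on [0, T] to the line by its end values, since a
    Stieltjes measure needs a function on all of R. *)
Definition clamp T (x : R) : R := Num.max 0 (Num.min T x).

Lemma clamp_id T x : 0 <= x -> x <= T -> clamp T x = x.
Proof. by move=> x0 xT; rewrite /clamp min_r// max_r. Qed.

Lemma clamp_itv T x : 0 <= T -> 0 <= clamp T x <= T.
Proof. by move=> T0; rewrite le_max lexx/= ge_max T0/= ge_min lexx. Qed.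

Lemma le_clamp T : {homo clamp T : x y / x <= y}.
Proof.
move=> x y xy; rewrite /clamp ge_max !le_max lexx/=; apply/orP; right.
by rewrite le_min !ge_min lexx/= xy orbT.
Qed.

Lemma clampB T x y : x <= y -> clamp T y - clamp T x <= y - x.
Proof.
move=> xy; have c0 : 0 <= clamp T x by rewrite le_max lexx.
have cm : Num.min T x <= clamp T x by rewrite le_max lexx orbT.
have : Num.min T y <= Num.min T x + (y - x).
  by have [?|?] := leP T x; have [?|?] := leP T y; lra.
by rewrite lerBlDr {1}/clamp ge_max => ?; apply/andP; split; lra.
Qed.

Lemma clamp_dist T x y : `|clamp T x - clamp T y| <= `|x - y|.
Proof.
wlog xy : x y / x <= y.
  by move=> H; have [/H //|/ltW/H] := leP x y; rewrite distrC (distrC y).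
rewrite distrC (distrC x) !ger0_norm ?subr_ge0 ?le_clamp//; exact: clampB.
Qed.

(** A null set lies in an open set of Lebesgue measure below the modulus [d]. This open set is a
    disjoint union of open intervals, and absolute continuity bounds the Stieltjes mass of any
    finitely many of them by [e]. *)
Lemma stieltjes_dominated T (f : cumulative R R) F : 0 <= T ->
  absolutely_continuous T F -> (forall x, f x = F (clamp T x)) ->
  content_dominates mu (lebesgue_stieltjes_measure f).
Proof.
move=> T0 acF fE A mA A0.
set lsf := lebesgue_stieltjes_measure f.
have lsf_itv a b : a <= b -> (lsf `]a, b[%classic <= (f b - f a)%:E)%E.
  move=> ab; apply: (@le_trans _ _ (lsf `]a, b]%classic)).
    apply: le_measure; rewrite ?inE; try exact: measurable_itv.
    by apply: subset_itvl; rewrite bnd_simp.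
  rewrite /lsf /lebesgue_stieltjes_measure/= /measure_extension/= measurable_mu_extE//=; last exact: is_ocitv.
  by rewrite wlength_itv_bnd.
apply/eqP; rewrite -measure_le0; apply/lee_addgt0Pr => e e0; rewrite add0e.
have [d d0 H] := acF _ e0.
have [U [oU AU mUA]] : exists U : set R, [/\ open U, A `<=` U & (mu (U `\` A) < d%:E)%E].
  by apply: lebesgue_regularity_outer => //; rewrite A0 ltry.
have muU : (mu U < d%:E)%E.
  have mU : measurable U by exact: open_measurable.
  rewrite -(setDUK AU).
  rewrite measureU//; first by rewrite A0 add0e.
    exact: measurableD.
  by rewrite setDE setICA setICr setI0.
have mU : measurable U by exact: open_measurable.
apply: (@le_trans _ _ (lsf U)); first by apply: le_measure; rewrite ?inE.
pose I := open_disjoint_itv oU.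
have oI n : open (I n) by exact: open_disjoint_itv_open.
have mI n : measurable (I n) by exact: open_measurable.
have tI : trivIset setT I by exact: open_disjoint_itv_trivIset.
have UI : U = \bigcup_n I n by exact: open_disjoint_itv_bigcup.
have IU n : I n `<=` U by rewrite UI; exact: bigcup_sup.
(* The shapes other than ]a, b[ are excluded one by one: an open set contains no endpoint of itself,
   and an unbounded interval has infinite measure. An empty component is written as ]0, 0[. *)
have ab n : exists ab : R * R, [/\ ab.1 <= ab.2, `]ab.1, ab.2[%classic = I n & mu (I n) = (ab.2 - ab.1)%:E].
  have [I0|/set0P[x0 Ix0]] := eqVneq (I n) set0.
    by exists (0, 0); rewrite /= set_itvoo0 I0 measure0 subrr.
  have iI : is_interval (I n) by exact: open_disjoint_itv_is_interval.
  have muI : (mu (I n) < +oo)%E.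
    apply: (@le_lt_trans _ _ (mu U)); last by rewrite (lt_trans muU)// ltry.
    by apply: le_measure; rewrite ?inE; [exact: mI|exact: mU|exact: IU].
  have := RhullK (mem_set iI).
  case: (Rhull (I n)) => -[[] a|[]] [[] b|[]] II; move: (oI n) muI (Ix0); rewrite -II => oab muab xab.
  - have ltab : a < b by move: xab; rewrite /= in_itv/= => /andP[/le_lt_trans]; exact.
    exfalso; move: oab; rewrite openE => /(_ a); rewrite /= in_itv/= lexx ltab => /(_ isT).
    move=> /nbhs_ballP[/= r r0 /(_ (a - r / 2))]; rewrite /ball/= opprB addrC subrK.
    by rewrite ger0_norm ?divr_ge0 ?ltW// in_itv/= => /(_ _)/andP[|+ _]; lra.
  - have leab : a <= b by move: xab; rewrite /= in_itv/= => /andP[/le_trans]; exact.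
    exfalso; move: oab; rewrite openE => /(_ a); rewrite /= in_itv/= lexx leab => /(_ isT).
    move=> /nbhs_ballP[/= r r0 /(_ (a - r / 2))]; rewrite /ball/= opprB addrC subrK.
    by rewrite ger0_norm ?divr_ge0 ?ltW// in_itv/= => /(_ _)/andP[|+ _]; lra.
  - by move: xab; rewrite /= in_itv/= ?andbF.
  - by move: muab; rewrite lebesgue_measure_itv/= ltry ltxx.
  - exists (a, b) => /=.
    have ltab : a < b by move: xab; rewrite /= in_itv/= => /andP[/lt_trans]; exact.
    by rewrite lebesgue_measure_itv/= lte_fin ltab ltW.
  - have ltab : a < b by move: xab; rewrite /= in_itv/= => /andP[/lt_le_trans]; exact.
    exfalso; move: oab; rewrite openE => /(_ b); rewrite /= in_itv/= lexx ltab => /(_ isT).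
    move=> /nbhs_ballP[/= r r0 /(_ (b + r / 2))]; rewrite /ball/= opprD addrA subrr add0r normrN.
    by rewrite ger0_norm ?divr_ge0 ?ltW// in_itv/= => /(_ _)/andP[|_]; lra.
  - by move: xab; rewrite /= in_itv/= ?andbF.
  - by move: muab; rewrite lebesgue_measure_itv/= ltry ltxx.
  - by move: muab; rewrite lebesgue_measure_itv/= ltNyr ltxx.
  - by move: muab; rewrite lebesgue_measure_itv/= ltNyr ltxx.
  - by move: xab; rewrite /= in_itv/= ?andbF.
  - by move: muab; rewrite lebesgue_measure_itv/= ltxx.
  - by move: xab; rewrite /= in_itv/= ?andbF.
  - by move: xab; rewrite /= in_itv/= ?andbF.
  - by move: xab; rewrite /= in_itv/= ?andbF.
  - by move: xab; rewrite /= in_itv/= ?andbF.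
have [p pP] := choice ab.
rewrite {1}UI /lsf measure_bigcup//; last by move=> *; exact: mI.
apply: lime_le; first exact: is_cvg_nneseries.
near=> n.
rewrite big_mkord.
apply: (@le_trans _ _ (\sum_(i < n) (F (clamp T (p i).2) - F (clamp T (p i).1))%:E)%E).
  under eq_bigl do rewrite in_setT.
  apply: lee_sum => i _; have [h1 <- _] := pP i.
  by rewrite -!fE lsf_itv.
rewrite sumEFin lee_fin; apply/ltW.
apply: (@le_lt_trans _ _ (\sum_(i < n) `|F (clamp T (p i).2) - F (clamp T (p i).1)|)).
  by apply: ler_sum => i _; exact: ler_norm.
(* Clamping moves the intervals into [0, T], does not lengthen them and keeps their interiors
   disjoint. *)
apply: (H n (fun i => clamp T (p i).1) (fun i => clamp T (p i).2)).
- move=> i; have [h1 _ _] := pP i.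
  have /andP[-> _] := clamp_itv (p i).1 T0; have /andP[_ ->] := clamp_itv (p i).2 T0.
  by split=> //; exact: le_clamp.
- move=> i j _ _ [x /= [xi xj]]; apply/val_inj/tI => //.
  have sub k : `]clamp T (p k).1, clamp T (p k).2[%classic x -> I k x.
    have [h1 <- _] := pP k; rewrite /= !in_itv/= /clamp !gt_max !lt_max !lt_min !gt_min.
    by lra.
  by exists x; split; exact: sub.
- apply: (@le_lt_trans _ _ (\sum_(i < n) ((p i).2 - (p i).1))).
    by apply: ler_sum => i _; have [h1 _ _] := pP i; exact: clampB.
  rewrite -lte_fin -sumEFin; apply: le_lt_trans muU.
  rewrite (eq_bigr (fun i : 'I_n => mu (I i))); last by move=> i _; have [_ _ ->] := pP i.
  rewrite UI measure_bigcup//; last by move=> *; exact: mI.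
  rewrite (_ : (\sum_(i < n) mu (I i) = \sum_(0 <= i < n | i \in [set: nat]) mu (I i))%E).
    exact: nneseries_lim_ge.
  by rewrite big_mkord; apply: eq_bigl => i; rewrite in_setT.
Unshelve. all: by end_near. Qed.

End density.

Section density2.
Context (R : realType).
Notation mu := (@lebesgue_measure R).
Implicit Types (F f g : R -> R) (T : R).

Lemma absolutely_continuous_clamp T F : 0 <= T -> absolutely_continuous T F ->
  continuous (F \o clamp T).
Proof.
move=> T0 /absolutely_continuous_dist acF x; apply/cvgrPdist_lt => e e0.
have [d d0 H] := acF e e0.
near=> y.
have : `|clamp T x - clamp T y| < d.
  apply: le_lt_trans (clamp_dist _ _ _) _; near: y.
  by apply: cvgr_dist_lt => //; exact: cvg_id.
have /andP[x0 xT] := clamp_itv x T0; have /andP[y0 yT] := clamp_itv y T0.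
have [xy|/ltW xy] := leP (clamp T x) (clamp T y).
  by rewrite distrC ger0_norm ?subr_ge0// => /H; rewrite distrC; exact.
by rewrite ger0_norm ?subr_ge0// => /H; exact.
Unshelve. all: by end_near. Qed.

Lemma lebesgue_stieltjes_itvoc (f : cumulative R R) a b : a <= b ->
  lebesgue_stieltjes_measure f `]a, b]%classic = (f b - f a)%:E.
Proof.
move=> ab; rewrite /lebesgue_stieltjes_measure/= /measure_extension/=.
by rewrite measurable_mu_extE//=; [rewrite wlength_itv_bnd|exact: is_ocitv].
Qed.

(** The Stieltjes measure of the clamped function is dominated by Lebesgue measure, and the density
    is its Radon-Nikodym derivative; the measure is first restricted to a bounded set to make it
    finite. *)
Lemma absolutely_continuous_monotone_density T F : 0 <= T ->
  absolutely_continuous T F ->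
  (forall x y, 0 <= x -> x <= y -> y <= T -> F x <= F y) ->
  exists2 g, mu.-integrable setT (EFin \o g) &
    forall a b, 0 <= a -> a <= b -> b <= T ->
      F b - F a = \int[mu]_(t in `[a, b]) g t.
Proof.
move=> T0 acF ndF.
pose fc := F \o clamp T.
have ndfc : {homo fc : x y / x <= y}.
  move=> x y xy; apply: ndF; last 1 first.
  - by have /andP[] := clamp_itv y T0.
  - by have /andP[] := clamp_itv x T0.
  - exact: le_clamp.
have rcfc : right_continuous fc.
  by apply: right_continuousW; exact: absolutely_continuous_clamp.
pose fm := isCumulative.Build R _ R fc ndfc rcfc.
pose f : cumulative R R := HB.pack fc fm.
pose D : set (measurableTypeR R) := `]-1, T]%classic.
have mD : measurable D by exact: measurable_itv.
have lsfE a b ab := @lebesgue_stieltjes_itvoc f a b ab.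
have Doo : (lebesgue_stieltjes_measure f D < +oo)%E.
  by rewrite /D lsfE ?ltry//; lra.
pose nu : {finite_measure set (measurableTypeR R) -> \bar R} := mfrestr mD Doo.
have nuE A : nu A = lebesgue_stieltjes_measure f (A `&` D) by [].
have numu : nu `<< mu.
  apply/null_content_dominatesP => A mA A0.
  rewrite nuE; apply: (stieltjes_dominated T0 acF) => //.
    exact: measurableI.
  by apply/eqP; rewrite -measure_le0 -A0; apply: le_measure; rewrite ?inE//; exact: measurableI.
have [g [g0 gfin ig gE]] := radon_nikodym_sigma_finite numu.
have ig' : mu.-integrable setT (EFin \o (fine \o g)).
  by apply: eq_integrable ig => // x _; rewrite /= fineK.
exists (fine \o g) => // a b a0 ab bT.
have -> : \int[mu]_(t in `[a, b]) (fine \o g) t = \int[mu]_(t in `]a, b]) (fine \o g) t.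
  rewrite Rintegral_itv_obnd_cbnd//.
  by apply: integrableS ig'.
rewrite /Rintegral; apply: EFin_inj; rewrite fineK.
  transitivity (nu `]a, b]%classic).
    rewrite nuE (_ : _ `&` _ = `]a, b]%classic).
      rewrite lsfE// (_ : f b = F (clamp T b))// (_ : f a = F (clamp T a))// !clamp_id//.
        exact: le_trans bT.
      exact: le_trans ab.
    apply/setIidPl; apply: subset_itv; rewrite bnd_simp //.
    by rewrite (le_trans _ a0)// lerN10.
  rewrite gE//; apply: eq_integral => x _; by rewrite /= fineK.
rewrite (eq_integral g); last by move=> x _; rewrite /= fineK.
by rewrite -gE// fin_num_measure.
Qed.

Lemma Rintegral_itv_split (h : R -> R) a b c : a <= b -> b <= c ->
  mu.-integrable `[a, c] (EFin \o h) ->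
  \int[mu]_(t in `[a, c]) h t = \int[mu]_(t in `[a, b]) h t + \int[mu]_(t in `[b, c]) h t.
Proof.
move=> ab bc ih.
rewrite -[X in _ = _ + X]Rintegral_itv_obnd_cbnd; last first.
  apply: integrableS ih => //.
  by apply: subset_itvr; rewrite bnd_simp.
have -> : `[a, c]%classic = `[a, b] `|` `]b, c].
  by rewrite -itv_bndbnd_setU ?bnd_simp.
rewrite Rintegral_setU//.
- rewrite -itv_bndbnd_setU ?bnd_simp//.
- apply/disj_setPS => x /=; rewrite !in_itv/= => -[/andP[_ xb] /andP[bx _]].
  by have := le_lt_trans xb bx; rewrite ltxx.
Qed.

(** Jordan decomposition: [f] is the difference of [tvar f] and [tvar f - f], both nondecreasing and
    absolutely continuous. Lebesgue's differentiation theorem then identifies the density with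
    [derive1 f] almost everywhere. *)
Lemma absolutely_continuous_density T f : 0 <= T -> absolutely_continuous T f ->
  exists g, [/\ mu.-integrable setT (EFin \o g),
    forall a b, 0 <= a -> a <= b -> b <= T ->
      f b - f a = \int[mu]_(t in `[a, b]) g t &
    {ae mu, forall t, 0 < t < T -> derive1 f t = g t}].
Proof.
move=> T0 acf.
have bv := absolutely_continuous_bounded_variation T0 acf.
have acv := tvar_absolutely_continuous T0 acf.
pose v2 x := tvar f x - f x.
have acv2 : absolutely_continuous T v2.
  move=> e e0; have e20 : 0 < e / 2 by rewrite divr_gt0.
  have [d1 d10 H1] := acf _ e20; have [d2 d20 H2] := acv _ e20.
  exists (Num.min d1 d2); first by rewrite lt_min d10.
  move=> n a b h1 h2; rewrite lt_min => /andP[h3 h4].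
  have := H1 n a b h1 h2 h3; have := H2 n a b h1 h2 h4 => K1 K2.
  apply: (@le_lt_trans _ _ (\sum_(i < n) (`|tvar f (b i) - tvar f (a i)| + `|f (b i) - f (a i)|))).
    apply: ler_sum => i _; apply: le_trans (ler_normB _ _).
    by rewrite /v2 le_eqVlt; apply/orP; left; apply/eqP; congr `|_|; ring.
  by rewrite big_split/=; lra.
have [g1 ig1 g1E] : exists2 g, mu.-integrable setT (EFin \o g) &
    forall a b, 0 <= a -> a <= b -> b <= T ->
      tvar f b - tvar f a = \int[mu]_(t in `[a, b]) g t.
  apply: absolutely_continuous_monotone_density => // x y x0 xy yT.
  by have := tvar_ge bv x0 xy yT; have := normr_ge0 (f y - f x); lra.
have [g2 ig2 g2E] : exists2 g, mu.-integrable setT (EFin \o g) &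
    forall a b, 0 <= a -> a <= b -> b <= T ->
      v2 b - v2 a = \int[mu]_(t in `[a, b]) g t.
  apply: absolutely_continuous_monotone_density => // x y x0 xy yT.
  by have := tvar_ge bv x0 xy yT; have := ler_norm (f y - f x); rewrite /v2; lra.
pose g x := g1 x - g2 x.
have ig : mu.-integrable setT (EFin \o g).
  by apply: eq_integrable (integrableB measurableT ig1 ig2).
have gE a b : 0 <= a -> a <= b -> b <= T ->
    f b - f a = \int[mu]_(t in `[a, b]) g t.
  move=> a0 ab bT; rewrite RintegralB//; try exact: (integrableS measurableT).
  by rewrite -g1E// -g2E// /v2; ring.
exists g; split => //.
pose G (y : R) : R := \int[mu]_(t in `[0, y]) g t.
have Hi y : mu.-integrable [set` Interval (BLeft (0 : R)) (BRight y)] (EFin \o g).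
  exact: (integrableS measurableT).
have Hl : locally_integrable [set: R] g.
  by apply: open_integrable_locally => //; exact: openT.
apply: (@filterS _ _ (ae_filter_ringOfSetsType mu) _ _ _ (FTC1 Hi Hl)) => t; rewrite /= lte_fin -/G => H /andP[t0 tT].
have [//|dG <-] := H.
rewrite !derive1E.
have -> : 'D_1 G t = 'D_1 (fun y => f 0 + G y) t.
  by rewrite deriveD// derive_cst add0r.
apply: near_eq_derive; rewrite ?oner_neq0//; near=> y.
have y0 : 0 <= y by near: y; apply: filterS (lt_nbhsr t0) => ? /ltW.
have yT : y <= T by near: y; apply: filterS (lt_nbhsl tT) => ? /ltW.
by rewrite /G -gE//; ring.
Unshelve. all: by end_near. Qed.

End density2.

(** * Finite energy and the Cauchy-Schwarz modulus *)

Section energy.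
Context (R : realType).
Notation mu := (@lebesgue_measure R).

(* No measurability is needed: the integral of a nonnegative function is a supremum over simple
   functions below it. *)
Lemma ge0_subset_integral_le d (X : measurableType d) (m : {measure set X -> \bar R})
    (D : set X) (f g : X -> \bar R) :
  (forall x, D x -> 0 <= f x)%E -> (forall x, D x -> f x <= g x)%E ->
  (\int[m]_(x in D) f x <= \int[m]_(x in D) g x)%E.
Proof.
move=> f0 fg; rewrite !ge0_integralE//; last by move=> x Dx; apply: le_trans (fg x Dx); exact: f0.
apply: ereal_sup_le => _ [h /= hf <-]; exists h => //= x.
apply: le_trans (hf x) _; rewrite !patchE; case: ifPn => // /set_mem Dx; exact: fg.
Qed.

(** Cauchy-Schwarz against the constant function 1: the integral of (g - c)^2 is nonnegative, where
    c is the mean value of [g]. *)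
Lemma Rintegral_square_le a b (g : R -> R) : a <= b ->
  mu.-integrable `[a, b] (EFin \o g) ->
  mu.-integrable `[a, b] (EFin \o (fun t => g t ^+ 2)) ->
  (\int[mu]_(t in `[a, b]) g t) ^+ 2 <= (b - a) * \int[mu]_(t in `[a, b]) (g t ^+ 2).
Proof.
rewrite le_eqVlt => /predU1P[<-|ab] ig ig2.
  by rewrite set_itv1 !Rintegral_set1 expr0n subrr mul0r.
set I := \int[mu]_(t in _) g t; set J := \int[mu]_(t in _) _.
pose c := I / (b - a); have ba : 0 < b - a by rewrite subr_gt0.
have icst r : mu.-integrable `[a, b] (EFin \o (fun=> r)).
  apply: continuous_compact_integrable; first exact: segment_compact.
  by apply: continuous_subspaceT => x; exact: cvg_cst.
have icg : mu.-integrable `[a, b] (EFin \o (fun t => 2 * c * g t)).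
  by apply: (@integrableZl _ _ _ mu _ _ (2 * c) (EFin \o g)).
have : 0 <= \int[mu]_(t in `[a, b]) ((g t ^+ 2 - 2 * c * g t) + c ^+ 2).
  apply: Rintegral_ge0 => t _.
  rewrite (_ : _ + _ = (g t - c) ^+ 2) ?sqr_ge0//; ring.
rewrite RintegralD//; last exact: (integrableB _ ig2 icg).
rewrite RintegralB// RintegralZl// -/I -/J Rintegral_cst//= lebesgue_measure_itv/= lte_fin ab/=.
rewrite (_ : J - _ + _ = J - I ^+ 2 / (b - a)); last by rewrite /c; field; rewrite gt_eqF.
by rewrite subr_ge0 ler_pdivrMr// mulrC.
Qed.

(** [N] is the integral of the squared density of [theta]. The integrand of [energy] is the
    pointwise derivative, whose measurability is not established, so the two integrals are compared
    by an inequality only. *)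
Lemma energy_modulus T (theta : R -> R) : 0 < T ->
  absolutely_continuous T theta -> (energy T theta < +oo)%E ->
  exists N : R -> R, [/\ N 0 = 0, {within `[0, T], continuous N},
    forall a b, 0 <= a -> a <= b -> b <= T -> N a <= N b /\
      (theta b - theta a) ^+ 2 <= (b - a) * (N b - N a) &
    N T <= 2 * fine (energy T theta)].
Proof.
move=> T0 acth Eoo.
have [g [ig gE gae]] := absolutely_continuous_density (ltW T0) acth.
have igT : mu.-integrable `[0, T] (EFin \o g) by exact: (integrableS measurableT).
have mg : measurable_fun setT g by apply/measurable_EFinP; exact: measurable_int ig.
have mg2 : measurable_fun setT (fun t => (g t ^+ 2)%:E).
  by apply/measurable_EFinP; exact: measurable_funX.
set E2 := (\int[mu]_(t in `[0%R, T]) (`|derive1 theta t| ^+ 2)%:E)%E.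
have gle : (\int[mu]_(t in `[0%R, T]) (g t ^+ 2)%:E <= E2)%E.
  (* The squared density is replaced by 0 on a measurable null set that contains every point where
     the density differs from [derive1 theta]; 0 and T are added because [gae] speaks of interior
     points. The result is measurable and below the squared derivative at every point of [0, T]. *)
  have [B [mB B0 Bsub]] := gae.
  pose C := B `|` [set 0] `|` [set T].
  have mC : measurable C by apply: measurableU => //; exact: measurableU.
  have C0 : mu C = 0.
    have s0 (r : R) : mu [set r] = 0 by exact: lebesgue_measure_set1.
    have U0 : mu (B `|` [set 0]) = 0 by apply: null_set_setU => //; exact: s0.
    by apply: null_set_setU => //; [exact: measurableU|exact: s0].
  rewrite (@ge0_ae_eq_integral _ _ _ mu `[0, T] _
    ((fun t => (g t ^+ 2)%:E) \_ (~` C)))//.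
  - apply: ge0_subset_integral_le => t /=.
      by move=> _; apply: erestrict_ge0 => x _; rewrite lee_fin sqr_ge0.
    rewrite in_itv/= patchE => /andP[t0 tT]; case: ifPn => [|_]; last first.
      by rewrite lee_fin exprn_ge0.
    move=> /set_mem tC; rewrite lee_fin real_normK ?num_real//.
    suff -> : derive1 theta t = g t by [].
    apply: contrapT => /= hne; apply: tC.
    have [->|tnT] := eqVneq t T; first by right.
    left; have [->|tn0] := eqVneq t 0; first by right.
    left; apply: Bsub => /= H; apply: hne; apply: H.
    by rewrite !lt_neqAle eq_sym tn0 t0 tnT.
  - exact: measurable_funTS.
  - by apply/measurable_funTS/measurable_restrict => //; [exact: measurableC|exact: measurable_funTS].
  - by move=> x _; rewrite lee_fin sqr_ge0.
  - by move=> x _; apply: erestrict_ge0 => y _; rewrite lee_fin sqr_ge0.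
  - exists C; split => // t /=; apply: contra_notP => tC _.
    by rewrite patchE mem_set.
have E20 : (0 <= E2)%E by apply: integral_ge0 => x _; rewrite lee_fin exprn_ge0.
have E2oo : (E2 < +oo)%E.
  by rewrite -(@lte_pmul2l _ (2^-1)%:E) ?lte_fin ?invr_gt0// gt0_muley ?lte_fin ?invr_gt0.
have ig2 : mu.-integrable `[0, T] (EFin \o (fun t => g t ^+ 2)).
  apply/integrableP; split; first exact: measurable_funTS.
  under eq_integral => t _ do rewrite /= ger0_norm ?sqr_ge0//.
  exact: le_lt_trans gle E2oo.
pose N t := \int[mu]_(s in `[0, t]) (g s ^+ 2).
have sub a b : 0 <= a -> b <= T -> `[a, b]%classic `<=` `[0, T]%classic.
  by move=> a0 bT; apply: subset_itv; rewrite bnd_simp.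
have ND a b : 0 <= a -> a <= b -> b <= T -> N b = N a + \int[mu]_(s in `[a, b]) (g s ^+ 2).
  by move=> a0 ab bT; apply: Rintegral_itv_split => //; apply: integrableS ig2 => //; exact: sub.
exists N; split.
- by rewrite /N set_itv1 Rintegral_set1.
- by apply: parameterized_integral_continuous => //; exact: ltW.
- move=> a b a0 ab bT; rewrite (ND a b)// addrAC subrr add0r; split.
    by rewrite lerDl; apply: Rintegral_ge0 => x _; exact: sqr_ge0.
  rewrite gE//; apply: Rintegral_square_le => //; first exact: (integrableS measurableT).
  by apply: integrableS ig2 => //; exact: sub.
- rewrite /N /energy -/E2.
  rewrite fineM//; last by rewrite ge0_fin_numE.
  rewrite /= mulrA mulfV ?mul1r// /Rintegral fine_le//; last by rewrite ge0_fin_numE.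
  rewrite ge0_fin_numE; first exact: le_lt_trans gle E2oo.
  by apply: integral_ge0 => x _; rewrite lee_fin sqr_ge0.
Qed.

End energy.

(** * Rates along the clock *)

Section local_monotonicity.
Context (R : realType).

(** Each interior t is compared with nearby s only, so monotonicity near t is not given. On [c, d]
    inside ]a, b[, let [m] be the supremum of the points up to which F c is a lower bound: the bound
    reaches [m] from the left and passes beyond it to the right, so [m] is d. The endpoints a and b
    follow by continuity. *)
Lemma locally_increasing_le (F : R -> R) a b : a <= b ->
  {within `[a, b], continuous F} ->
  (forall t, a < t < b -> \forall s \near t,
     (t <= s -> F t <= F s) /\ (s <= t -> F s <= F t)) ->
  F a <= F b.
Proof.
rewrite le_eqVlt => /predU1P[<-//|ab] cF loc.
have inner c d : a < c -> c <= d -> d < b -> F c <= F d.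
  move=> ac cd db.
  pose A := [set x | c <= x <= d /\ forall y, c <= y <= x -> F c <= F y].
  have A0 : A c.
    by split; [rewrite lexx|move=> y /andP[cy yc]; rewrite (@le_anti _ _ y c) ?yc].
  have supA : has_sup A by split; [exists c|exists d => x [/andP[]]].
  set m := sup A.
  have cm : c <= m by apply: ub_le_sup => //; case: supA.
  have md : m <= d by apply: ge_sup; [exists c|move=> x [/andP[]]].
  have /nbhs_ballP[e /= e0 He] := loc m (introT andP (conj (lt_le_trans ac cm) (le_lt_trans md db))).
  have below y : c <= y -> y < m -> F c <= F y.
    move=> cy ym; have my0 : 0 < m - y by rewrite subr_gt0.
    have [x [/andP[cx xd] Hx]] := sup_adherent my0 supA.
    by rewrite subKr => /ltW yx; apply: Hx; rewrite cy.
  have Fm : F c <= F m.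
    have [cm'|?|<-//] := ltgtP c m; last by lra.
    pose y := Num.max c (m - e / 2).
    have cy : c <= y by rewrite le_max lexx.
    have ym : y < m by rewrite gt_max cm'; lra.
    have my : m - e / 2 <= y by rewrite le_max lexx orbT.
    apply: le_trans (below _ cy ym) _.
    by have [|_] := He y; [rewrite /ball/= ger0_norm; lra|apply; exact: ltW].
  suff -> : d = m by [].
  apply/eqP; rewrite eq_le md andbT leNgt; apply/negP => mltd.
  pose z := Num.min d (m + e / 2).
  have mz : m < z by rewrite lt_min mltd; lra.
  have zd : z <= d by rewrite ge_min lexx.
  have ze : z <= m + e / 2 by rewrite ge_min lexx orbT.
  have : z <= m; last by lra.
  apply: ub_le_sup; first by case: supA.
  split; first by rewrite zd andbT; lra.
  move=> y /andP[cy yz]; have [my|ym] := leP m y; last exact: below.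
  apply: le_trans Fm _; have [|h _] := He y; last exact: h.
  by rewrite /ball/= ler0_norm; lra.
have [_ Fa Fb] := (continuous_within_itvP _ ab).1 cF.
apply/ler_addgt0Pr => e e0; have e20 : 0 < e / 2 by rewrite divr_gt0.
have /cvgrPdist_lt/(_ _ e20) Ha := Fa; have /cvgrPdist_lt/(_ _ e20) Hb := Fb.
near a^'+ => c; near b^'- => d.
have ac : a < c by [].
have db : d < b by [].
have cd : c <= d.
  apply: (@le_trans _ _ ((a + b) / 2)); apply/ltW; first by near: c; apply: nbhs_right_lt; lra.
  by near: d; apply: nbhs_left_gt; lra.
have := inner _ _ ac cd db.
have : `|F a - F c| < e / 2 by near: c; exact: Ha.
have : `|F b - F d| < e / 2 by near: d; exact: Hb.
rewrite !ltr_norml => /andP[h1 h2] /andP[h3 h4] h5.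
lra.
Unshelve. all: by end_near. Qed.

End local_monotonicity.

Section taylor.
Context (R : realType).

(** Two mean value theorems in a row, hence the constant C and not C / 2. *)
Lemma taylor1_quadratic (phi psi chi : R -> R) (x r C : R) : 0 < r ->
  (forall y, `|x - y| < r -> is_derive y 1 phi (psi y)) ->
  (forall y, `|x - y| < r -> is_derive y 1 psi (chi y)) ->
  (forall y, `|x - y| < r -> `|chi y| <= C) ->
  forall y, `|x - y| < r -> `|phi y - phi x - psi x * (y - x)| <= C * (y - x) ^+ 2.
Proof.
move=> r0 dphi dpsi bchi y xy.
have mvt (f df : R -> R) u : `|x - u| < r ->
    (forall y, `|x - y| < r -> is_derive y 1 f (df y)) ->
    exists2 v, `|x - v| <= `|x - u| & f u - f x = df v * (u - x).
  move=> xu df'; have cf (v w : R) : (forall y, y \in `[v, w] -> `|x - y| < r) ->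
      {within `[v, w], continuous f}.
    move=> H; apply: derivable_within_continuous => z zvw.
    by have [] := df' z (H z zvw).
  have [xleu|/ltW ulex] := leP x u.
    have H z : z \in `[x, u] -> `|x - z| <= `|x - u|.
      by rewrite in_itv/= => /andP[xz zu]; rewrite !ler0_norm; lra.
    have H' z : z \in `[x, u] -> `|x - z| < r by move=> /H /le_lt_trans; exact.
    have [|v vi ->] := @MVT_segment _ f df x u xleu _ (cf _ _ H').
      by move=> z zi; apply: df'; apply: H'; exact: subset_itv_oo_cc zi.
    by exists v => //; exact: H.
  have H z : z \in `[u, x] -> `|x - z| <= `|x - u|.
    by rewrite in_itv/= => /andP[xz zu]; rewrite !ger0_norm; lra.
  have H' z : z \in `[u, x] -> `|x - z| < r by move=> /H /le_lt_trans; exact.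
  have [|v vi E] := @MVT_segment _ f df u x ulex _ (cf _ _ H').
    by move=> z zi; apply: df'; apply: H'; exact: subset_itv_oo_cc zi.
  by exists v; [exact: H|rewrite -opprB E; ring].
have [v vy ->] := mvt phi psi y xy dphi.
have vr := le_lt_trans vy xy.
have [w wv E] := mvt psi chi v vr dpsi.
rewrite -mulrBl E -mulrA !normrM.
have wr := le_lt_trans wv vr.
rewrite ler_pM ?mulr_ge0 ?bchi// expr2 -[leRHS]ger0_norm ?sqr_ge0// -?expr2 ?sqr_ge0//.
by rewrite normrM ler_pM// distrC (distrC y).
Qed.

End taylor.

(* L is the clock int_0^t lam; n controls the increments of theta through
   (d theta)^2 <= dL dn, which is all that is used of the finite energy. *)
Record driven (R : realType) (T : R) (L theta n : R -> R) : Prop := Driven {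
  driven_clock_continuous : {within `[0, T], continuous L};
  driven_clock_increasing : forall a b, 0 <= a -> a < b -> b <= T -> L a < L b;
  driven_energy_continuous : {within `[0, T], continuous n};
  driven_energy_nondecreasing : forall a b, 0 <= a -> a <= b -> b <= T -> n a <= n b;
  driven_modulus : forall a b, 0 <= a -> a <= b -> b <= T ->
    (theta b - theta a) ^+ 2 <= (L b - L a) * (n b - n a) }.

Lemma within_itvcc_near (R : realType) (f : R -> R) a b t : a < t < b ->
  {within `[a, b], continuous f} -> forall e, 0 < e -> \forall s \near t, `|f s - f t| < e.
Proof.
move=> /andP[at_ tb] cf e e0.
have [H _ _] := (continuous_within_itvP _ (lt_trans at_ tb)).1 cf.
have : {for t, continuous f} by apply: H; rewrite in_itv/= at_.
by move=> /cvgrPdist_lt/(_ _ e0); apply: filterS => s; rewrite distrC.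
Qed.

(** * Expansions in the clock and the driving function *)

Section rates.
Context (R : realType) (T : R) (L theta n : R -> R) (HD : driven T L theta n).
Implicit Types (f g : R -> R) (t rho v : R).

(** The expansion f s - f t = rho dL + v dtheta + o(dL). The pair (rho, v) is not unique in general:
    where [theta] is itself differentiable along [L], one coefficient can be traded for the
    other. *)
Definition rate f t rho v := forall e, 0 < e -> \forall s \near t,
  `|f s - f t - rho * (L s - L t) - v * (theta s - theta t)| <= e * `|L s - L t|.

Lemma rate_eq f t rho rho' v v' : rho = rho' -> v = v' ->
  rate f t rho v -> rate f t rho' v'.
Proof. by move=> -> ->. Qed.

Lemma rate_near_eq f g t rho v : (\forall s \near t, f s = g s) ->
  rate f t rho v -> rate g t rho v.
Proof.
move=> fg rf e e0; have fgt := nbhs_singleton fg.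
by near=> s; rewrite -fgt -(near fg s)//; near: s; exact: rf.
Unshelve. all: by end_near. Qed.

Lemma rate_cst c t : rate (fun=> c) t 0 0.
Proof.
move=> e e0; near=> s.
by rewrite !mul0r subrr !subr0 normr0 mulr_ge0// ltW.
Unshelve. all: by end_near. Qed.

Lemma rate_clock t : rate L t 1 0.
Proof.
move=> e e0; near=> s.
by rewrite mul1r mul0r subrr subr0 normr0 mulr_ge0// ltW.
Unshelve. all: by end_near. Qed.

Lemma rate_driving t : rate theta t 0 1.
Proof.
move=> e e0; near=> s.
by rewrite mul1r mul0r subr0 subrr normr0 mulr_ge0// ltW.
Unshelve. all: by end_near. Qed.

Lemma rateD f g t r1 r2 v1 v2 : rate f t r1 v1 -> rate g t r2 v2 ->
  rate (fun s => f s + g s) t (r1 + r2) (v1 + v2).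
Proof.
move=> rf rg e e0; have e20 : 0 < e / 2 by rewrite divr_gt0.
near=> s.
have h1 : `|f s - f t - r1 * (L s - L t) - v1 * (theta s - theta t)| <= e / 2 * `|L s - L t|.
  by near: s; exact: rf.
have h2 : `|g s - g t - r2 * (L s - L t) - v2 * (theta s - theta t)| <= e / 2 * `|L s - L t|.
  by near: s; exact: rg.
rewrite (_ : _ - _ = (f s - f t - r1 * (L s - L t) - v1 * (theta s - theta t)) +
  (g s - g t - r2 * (L s - L t) - v2 * (theta s - theta t))); last by ring.
by apply: le_trans (ler_normD _ _) _; lra.
Unshelve. all: by end_near. Qed.

Lemma rateZ f t k rho v : rate f t rho v ->
  rate (fun s => k * f s) t (k * rho) (k * v).
Proof.
move=> rf e e0; have k0 : 0 < `|k| + 1 by rewrite ltr_wpDl.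
have e20 : 0 < e / (`|k| + 1) by rewrite divr_gt0.
near=> s.
have h1 : `|f s - f t - rho * (L s - L t) - v * (theta s - theta t)| <= e / (`|k| + 1) * `|L s - L t|.
  by near: s; exact: rf.
rewrite (_ : _ - _ = k * (f s - f t - rho * (L s - L t) - v * (theta s - theta t))); last by ring.
rewrite normrM; apply: le_trans (ler_wpM2l _ h1) _ => //.
rewrite mulrA ler_wpM2r// mulrCA ler_piMr ?(ltW e0)// ler_pdivrMr// mul1r lerDl//.
Unshelve. all: by end_near. Qed.

Lemma rateN f t rho v : rate f t rho v -> rate (fun s => - f s) t (- rho) (- v).
Proof.
move=> /(rateZ (-1)); rewrite !mulN1r; apply: rate_near_eq.
by near=> s; rewrite mulN1r.
Unshelve. all: by end_near. Qed.

Lemma rateB f g t r1 r2 v1 v2 : rate f t r1 v1 -> rate g t r2 v2 ->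
  rate (fun s => f s - g s) t (r1 - r2) (v1 - v2).
Proof. by move=> rf rg; apply: rateD rf _; exact: rateN. Qed.

Section at_time.
Context (t : R) (tT : 0 < t < T).

Lemma near_itv : \forall s \near t, 0 < s < T.
Proof.
move: tT => /andP[t0 tT']; near=> s; apply/andP; split; near: s.
  exact: lt_nbhsr.
exact: lt_nbhsl.
Unshelve. all: by end_near. Qed.

Lemma clock_small e : 0 < e -> \forall s \near t, `|L s - L t| < e.
Proof. by apply: (within_itvcc_near tT); exact: driven_clock_continuous HD. Qed.

(** The square is at most dL dn, and [n] is continuous at t, so it is o(dL). This is why
    second-order terms never appear in the rules below. *)
Lemma driving_square_small e : 0 < e ->
  \forall s \near t, (theta s - theta t) ^+ 2 <= e * `|L s - L t|.
Proof.
move=> e0; near=> s.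
have /andP[s0 sT] : 0 < s < T by near: s; exact: near_itv.
have ns : `|n s - n t| < e.
  by near: s; apply: (within_itvcc_near tT) => //; exact: driven_energy_continuous HD.
move: tT => /andP[t0 tT'].
have [ts|st] := leP t s.
  apply: le_trans (driven_modulus HD (ltW t0) ts (ltW sT)) _.
  have h : L t <= L s.
    by move: ts; rewrite le_eqVlt => /predU1P[->//|/(driven_clock_increasing HD) h]; apply/ltW/h; exact: ltW.
  by rewrite ger0_norm ?subr_ge0// mulrC ler_wpM2r ?subr_ge0// (le_trans (ler_norm _))// ltW.
rewrite -sqrrN opprB; apply: le_trans (driven_modulus HD (ltW s0) (ltW st) (ltW tT')) _.
have h : L s < L t by apply: (driven_clock_increasing HD) => //; exact: ltW.
rewrite distrC ger0_norm ?subr_ge0 ?(ltW h)// mulrC ler_wpM2r ?subr_ge0 ?(ltW h)//.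
by rewrite (le_trans (ler_norm _))// distrC ltW.
Unshelve. all: by end_near. Qed.

Lemma driving_small e : 0 < e -> \forall s \near t, `|theta s - theta t| < e.
Proof.
move=> e0; have e20 : 0 < e ^+ 2 by rewrite exprn_gt0.
near=> s.
have h1 : (theta s - theta t) ^+ 2 <= 1 * `|L s - L t|.
  by near: s; exact: driving_square_small.
have h2 : `|L s - L t| < e ^+ 2 by near: s; exact: clock_small.
by rewrite -(@ltr_pXn2r _ 2%N) ?nnegrE ?(ltW e0)// real_normK ?num_real//; lra.
Unshelve. all: by end_near. Qed.

Lemma rate_small f rho v : rate f t rho v ->
  forall e, 0 < e -> \forall s \near t, `|f s - f t| < e.
Proof.
move=> rf e e0.
pose K := `|rho| + `|v| + 1; have K0 : 0 < K by rewrite /K ltr_wpDl// addr_ge0.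
have eK : 0 < e / K by rewrite divr_gt0.
near=> s.
have h1 : `|f s - f t - rho * (L s - L t) - v * (theta s - theta t)| <= 1 * `|L s - L t|.
  by near: s; exact: rf.
have h2 : `|L s - L t| < e / K by near: s; exact: clock_small.
have h3 : `|theta s - theta t| < e / K by near: s; exact: driving_small.
rewrite (_ : f s - f t = (f s - f t - rho * (L s - L t) - v * (theta s - theta t)) +
   rho * (L s - L t) + v * (theta s - theta t)); last by ring.
apply: le_lt_trans (ler_normD _ _) _; apply: (@le_lt_trans _ _
   (1 * `|L s - L t| + `|rho| * `|L s - L t| + `|v| * `|theta s - theta t|)).
  by rewrite lerD ?normrM// (le_trans (ler_normD _ _))// normrM lerD.
have -> : e = (e / K) + `|rho| * (e / K) + `|v| * (e / K).
  by rewrite /K; field; rewrite gt_eqF.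
have := ler_wpM2l (normr_ge0 rho) (ltW h2); have := ler_wpM2l (normr_ge0 v) (ltW h3).
lra.
Unshelve. all: by end_near. Qed.

Lemma rate_square_small f rho v : rate f t rho v ->
  forall e, 0 < e -> \forall s \near t, (f s - f t) ^+ 2 <= e * `|L s - L t|.
Proof.
move=> rf e e0.
(* From (x + y + z)^2 <= 3 (x^2 + y^2 + z^2), applied to the remainder and the two terms of the
   expansion. *)
pose K := 3 * (rho ^+ 2 + v ^+ 2 + 1).
have K0 : 0 < K by rewrite /K mulr_gt0// ltr_wpDl// addr_ge0 ?sqr_ge0.
have eK : 0 < e / K by rewrite divr_gt0.
near=> s.
have h1 : `|f s - f t - rho * (L s - L t) - v * (theta s - theta t)| <= 1 * `|L s - L t|.
  by near: s; exact: rf.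
have h2 : `|L s - L t| < e / K by near: s; exact: clock_small.
have h3 : (theta s - theta t) ^+ 2 <= e / K * `|L s - L t|.
  by near: s; exact: driving_square_small.
set x := f s - f t - _ - _ in h1.
have -> : f s - f t = x + rho * (L s - L t) + v * (theta s - theta t) by rewrite /x; ring.
have hx : x ^+ 2 <= e / K * `|L s - L t|.
  rewrite mul1r in h1.
  rewrite -(real_normK (num_real x)) expr2 (le_trans (ler_pM _ _ h1 h1))//.
  by rewrite ler_wpM2r// ltW.
have hL : (L s - L t) ^+ 2 <= e / K * `|L s - L t|.
  by rewrite -(real_normK (num_real (L s - L t))) expr2 ler_wpM2r// ltW.
have -> : e * `|L s - L t| = K * (e / K * `|L s - L t|).
  by rewrite mulrA (mulrC K) divfK// gt_eqF.
move: hx hL h3; set Y := e / K * _; set l := L s - L t; set d := theta s - theta t => hx hL h3.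
rewrite /K.
have := ler_wpM2l (sqr_ge0 rho) hL; have := ler_wpM2l (sqr_ge0 v) h3.
have := sqr_ge0 (x - rho * l); have := sqr_ge0 (x - v * d); have := sqr_ge0 (rho * l - v * d).
rewrite -!exprMn => q1 q2 q3 q4 q5; lra.
Unshelve. all: by end_near. Qed.

(** Beyond the Leibniz rule there remains the product of two increments; it is at most the mean of
    their squares, hence o(dL). *)
Lemma rateM f g r1 r2 v1 v2 : rate f t r1 v1 -> rate g t r2 v2 ->
  rate (fun s => f s * g s) t (r1 * g t + f t * r2) (v1 * g t + f t * v2).
Proof.
move=> rf rg e e0.
have e20 : 0 < e / 2 by rewrite divr_gt0.
have := rateD (rateZ (g t) rf) (rateZ (f t) rg) => rfg.
near=> s.
have h1 := near (rfg _ e20) s.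
have h2 : (f s - f t) ^+ 2 <= e / 2 * `|L s - L t| by near: s; exact: rate_square_small rf _ _.
have h3 : (g s - g t) ^+ 2 <= e / 2 * `|L s - L t| by near: s; exact: rate_square_small rg _ _.
rewrite (_ : _ - _ = (g t * f s + f t * g s - (g t * f t + f t * g t) -
   (g t * r1 + f t * r2) * (L s - L t) - (g t * v1 + f t * v2) * (theta s - theta t)) +
   (f s - f t) * (g s - g t)); last by ring.
apply: le_trans (ler_normD _ _) _.
rewrite [leRHS](_ : _ = e / 2 * `|L s - L t| + e / 2 * `|L s - L t|); last by field.
apply: lerD; first by apply: h1.
have := sqr_ge0 (f s - f t - (g s - g t)); have := sqr_ge0 (f s - f t + (g s - g t)).
by rewrite ler_norml; lra.
Unshelve. all: by end_near. Qed.

(** The Taylor remainder of [phi] is quadratic in an increment whose square is o(dL). *)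
Lemma rate_comp (phi : R -> R) (dphi r C : R) f rho v : 0 < r -> 0 <= C ->
  (forall y, `|f t - y| < r ->
     `|phi y - phi (f t) - dphi * (y - f t)| <= C * (y - f t) ^+ 2) ->
  rate f t rho v -> rate (phi \o f) t (dphi * rho) (dphi * v).
Proof.
move=> r0 C0 Hphi rf e e0.
have C10 : 0 < C + 1 by rewrite ltr_wpDl.
have e20 : 0 < e / 2 by rewrite divr_gt0.
have e30 : 0 < e / 2 / (C + 1) by rewrite divr_gt0.
near=> s.
have h1 := near (rateZ dphi rf e20) s.
have h2 : (f s - f t) ^+ 2 <= e / 2 / (C + 1) * `|L s - L t|.
  by near: s; exact: rate_square_small rf _ _.
have h3 : `|f t - f s| < r.
  by rewrite distrC; near: s; exact: rate_small rf _ _.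
have {}Hphi := Hphi _ h3.
rewrite /= (_ : _ - _ = (dphi * f s - dphi * f t - dphi * rho * (L s - L t) -
    dphi * v * (theta s - theta t)) +
  (phi (f s) - phi (f t) - dphi * (f s - f t))); last by ring.
apply: le_trans (ler_normD _ _) _.
rewrite [leRHS](_ : _ = e / 2 * `|L s - L t| + e / 2 * `|L s - L t|); last by field.
apply: lerD; first by apply: h1.
apply: le_trans Hphi _.
apply: (@le_trans _ _ ((C + 1) * (f s - f t) ^+ 2)).
  by rewrite ler_wpM2r ?sqr_ge0// lerDl.
by rewrite mulrC -ler_pdivlMr// mulrAC.
Unshelve. all: by end_near. Qed.

End at_time.
End rates.

Section within.
Context (R : realType) (A : set R).
Implicit Types f g : R -> R.

Lemma within_cst (c : R) : {within A, continuous (fun=> c : R)}.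
Proof. by apply: continuous_subspaceT => x; exact: cvg_cst. Qed.

Lemma withinD f g : {within A, continuous f} -> {within A, continuous g} ->
  {within A, continuous (fun x => f x + g x)}.
Proof. by move=> cf cg x; apply: cvgD; [exact: cf|exact: cg]. Qed.

Lemma withinN f : {within A, continuous f} -> {within A, continuous (fun x => - f x)}.
Proof. by move=> cf x; apply: cvgN; exact: cf. Qed.

Lemma withinB f g : {within A, continuous f} -> {within A, continuous g} ->
  {within A, continuous (fun x => f x - g x)}.
Proof. by move=> cf cg x; apply: cvgB; [exact: cf|exact: cg]. Qed.

Lemma withinM f g : {within A, continuous f} -> {within A, continuous g} ->
  {within A, continuous (fun x => f x * g x)}.
Proof. by move=> cf cg x; apply: cvgM; [exact: cf|exact: cg]. Qed.

Lemma withinV f : (forall x, A x -> f x != 0) -> {within A, continuous f} ->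
  {within A, continuous (fun x => (f x)^-1)}.
Proof.
move=> f0 cf; apply/subspace_continuousP => x Ax; apply: cvgV; first exact: f0.
by move/subspace_continuousP : cf; exact.
Qed.

Lemma within_comp (phi : R -> R) f : (forall x, A x -> {for f x, continuous phi}) ->
  {within A, continuous f} -> {within A, continuous (phi \o f)}.
Proof.
move=> cphi cf; apply/subspace_continuousP => x Ax.
apply: continuous_cvg; first exact: cphi.
by move/subspace_continuousP : cf; exact.
Qed.

Lemma within_ln f : (forall x, A x -> 0 < f x) -> {within A, continuous f} ->
  {within A, continuous (@ln R \o f)}.
Proof. by move=> f0; apply: within_comp => x Ax; exact/continuous_ln/f0. Qed.

Lemma within_expR f : {within A, continuous f} -> {within A, continuous (@expR R \o f)}.
Proof. by apply: within_comp => x _; exact: continuous_expR. Qed.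

Lemma withinS (B : set R) f : B `<=` A -> {within A, continuous f} ->
  {within B, continuous f}.
Proof. by move=> BA; exact: continuous_subspaceW. Qed.

End within.

Section rate_rules.
Context (R : realType) (T : R) (L theta n : R -> R) (HD : driven T L theta n).
Implicit Types (f g : R -> R) (a b t rho v : R).
Local Notation rate := (rate L theta).

Section at_time.
Context (t : R) (tT : 0 < t < T).

Lemma rate_ln f rho v : 0 < f t -> rate f t rho v ->
  rate (@ln R \o f) t (rho / f t) (v / f t).
Proof.
move=> ft0 rf; have f20 : 0 < f t / 2 by rewrite divr_gt0.
apply: (@rate_eq _ _ _ _ _ ((f t)^-1 * rho) _ ((f t)^-1 * v)); [by rewrite mulrC|by rewrite mulrC|].
have low y : `|f t - y| < f t / 2 -> f t / 2 < y by rewrite ltr_norml => /andP[_]; lra.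
apply: (@rate_comp _ _ _ _ _ HD t tT (@ln R) _ (f t / 2) ((f t / 2) ^- 2)) => //.
  by rewrite invr_ge0 exprn_ge0 ?ltW.
apply: (@taylor1_quadratic _ (@ln R) (fun y => y^-1) (fun y => - y ^- 2)) => //.
- by move=> y /low h; apply: is_derive1_ln; apply: lt_trans h.
- move=> y /low h; have y0 : y != 0 by rewrite gt_eqF// (lt_trans f20).
  apply: is_derive_eq; first exact: (@is_deriveV _ (fun y => y) y 1 1 y0).
  by rewrite /GRing.scale /= mulr1.
- move=> y /low h; have y0 : 0 < y by exact: lt_trans h.
  rewrite normrN ger0_norm; last by rewrite invr_ge0 exprn_ge0 ?ltW.
  by rewrite lef_pV2 ?posrE ?exprn_gt0// lerXn2r ?nnegrE ?ltW.
Qed.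

Lemma rate_expR f rho v : rate f t rho v ->
  rate (@expR R \o f) t (rho * expR (f t)) (v * expR (f t)).
Proof.
move=> rf.
apply: (@rate_eq _ _ _ _ _ (expR (f t) * rho) _ (expR (f t) * v)); [by rewrite mulrC|by rewrite mulrC|].
apply: (@rate_comp _ _ _ _ _ HD t tT (@expR R) _ 1 (expR (f t + 1))) => //.
apply: (@taylor1_quadratic _ (@expR R) (@expR R) (@expR R)) => // y.
rewrite ltr_norml => /andP[h _]; rewrite ger0_norm ?expR_ge0// ler_expR; lra.
Qed.

Lemma rate_cos_comp f rho v : rate f t rho v ->
  rate (fun s => cos (f s)) t (- sin (f t) * rho) (- sin (f t) * v).
Proof.
apply: (@rate_comp _ _ _ _ _ HD t tT (@cos R) _ 1 1) => //.
apply: (@taylor1_quadratic _ (@cos R) (fun y => - sin y) (fun y => - cos y)) => // y _.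
by rewrite normrN ler_norml cos_geN1 cos_le1.
Qed.

Lemma rate_sin_comp f rho v : rate f t rho v ->
  rate (fun s => sin (f s)) t (cos (f t) * rho) (cos (f t) * v).
Proof.
apply: (@rate_comp _ _ _ _ _ HD t tT (@sin R) _ 1 1) => //.
apply: (@taylor1_quadratic _ (@sin R) (@cos R) (fun y => - sin y)) => // y _.
by rewrite normrN ler_norml sin_geN1 sin_le1.
Qed.

Lemma rate_cos : rate (@cos R \o theta) t 0 (- sin (theta t)).
Proof. by apply: rate_eq (rate_cos_comp (rate_driving L theta t)); rewrite ?mulr0 ?mulr1. Qed.

Lemma rate_sin : rate (@sin R \o theta) t 0 (cos (theta t)).
Proof. by apply: rate_eq (rate_sin_comp (rate_driving L theta t)); rewrite ?mulr0 ?mulr1. Qed.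

End at_time.

(* If v^2 <= kappa rho then rho dL + v dtheta >= - (kappa / 4) dn, by dtheta^2 <= dL dn and AM-GM. *)
Lemma rate_energy_le f a b kappa : 0 <= a -> a <= b -> b <= T -> 0 <= kappa ->
  {within `[a, b], continuous f} ->
  (forall t, a < t < b -> exists rho v, [/\ rate f t rho v, 0 <= rho & v ^+ 2 <= kappa * rho]) ->
  f a <= f b + kappa / 4 * (n b - n a).
Proof.
move=> a0 ab bT k0 cf rf.
have sub : `[a, b]%classic `<=` `[0, T]%classic by apply: subset_itv; rewrite bnd_simp.
have step l d m rho v : 0 <= l -> 0 <= m -> d ^+ 2 <= l * m -> 0 <= rho ->
    v ^+ 2 <= kappa * rho -> `|v * d| <= rho * l + kappa / 4 * m.
  move=> l0 m0 dlm rho0 vk.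
  have q0 : 0 <= rho * l + kappa / 4 * m by rewrite addr_ge0 ?mulr_ge0.
  rewrite -(@ler_pXn2r _ 2%N) ?nnegrE// real_normK ?num_real// exprMn.
  have : v ^+ 2 * d ^+ 2 <= (kappa * rho) * (l * m) by rewrite ler_pM ?sqr_ge0.
  by have := sqr_ge0 (rho * l - kappa / 4 * m); rewrite !expr2; lra.
(* The slack e L absorbs the remainder of the expansion at each time; e then tends to 0. *)
suff H e : 0 < e -> f a + kappa / 4 * n a + e * L a <= f b + kappa / 4 * n b + e * L b.
  have LL : 0 <= L b - L a.
    by move: ab; rewrite le_eqVlt => /predU1P[->|h]; rewrite subr_ge0// ltW// (driven_clock_increasing HD).
  apply/ler_addgt0Pr => e e0.
  have e1 : 0 < e / (L b - L a + 1) by rewrite divr_gt0// ltr_wpDl.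
  have := H _ e1.
  have : e / (L b - L a + 1) * (L b - L a) <= e.
    by rewrite -mulrA ler_piMr ?(ltW e0)// mulrC ler_pdivrMr ?ltr_wpDl// mul1r lerDl.
  lra.
move=> e0; apply: (@locally_increasing_le _ (fun x => f x + kappa / 4 * n x + e * L x)) => //.
  apply: withinD; first apply: withinD => //.
    apply: withinM; first exact: within_cst.
    exact: withinS sub (driven_energy_continuous HD).
  apply: withinM; first exact: within_cst.
  exact: withinS sub (driven_clock_continuous HD).
move=> t /andP[at_ tb].
have [rho [v [rft rho0 vk]]] := rf t (introT andP (conj at_ tb)).
have tT : 0 < t < T by rewrite (le_lt_trans a0)// (lt_le_trans tb).
have t0 : 0 <= t by case/andP: tT => /ltW.
have tT' : t <= T by case/andP: tT => _ /ltW.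
near=> s.
have /andP[s0 sT] : 0 < s < T by near: s; exact: near_itv.
have hs : `|f s - f t - rho * (L s - L t) - v * (theta s - theta t)| <= e * `|L s - L t|.
  by near: s; exact: rft.
split=> [ts|st].
  have L0 : 0 <= L s - L t.
    by move: ts; rewrite le_eqVlt => /predU1P[->|h]; rewrite subr_ge0// ltW// (driven_clock_increasing HD)// ltW.
  have n0 : 0 <= n s - n t by rewrite subr_ge0 (driven_energy_nondecreasing HD)// ltW.
  have := step _ _ _ _ _ L0 n0 (driven_modulus HD t0 ts (ltW sT)) rho0 vk.
  by move: hs; rewrite (ger0_norm L0) !ler_norml => /andP[+ _] /andP[+ _]; lra.
have L0 : 0 <= L t - L s.
  by move: st; rewrite le_eqVlt => /predU1P[->|h]; rewrite subr_ge0// ltW// (driven_clock_increasing HD)// ltW.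
have n0 : 0 <= n t - n s by rewrite subr_ge0 (driven_energy_nondecreasing HD)// ltW.
have := step _ _ _ _ _ L0 n0 (driven_modulus HD (ltW s0) st tT') rho0 vk.
by move: hs; rewrite (distrC (L s)) (ger0_norm L0) !ler_norml => /andP[_ +] /andP[+ _]; lra.
Unshelve. all: by end_near. Qed.

Lemma rate_nondecreasing f a b : 0 <= a -> a <= b -> b <= T ->
  {within `[a, b], continuous f} ->
  (forall t, a < t < b -> exists2 rho, rate f t rho 0 & 0 <= rho) -> f a <= f b.
Proof.
move=> a0 ab bT cf rf; have := @rate_energy_le f a b 0 a0 ab bT (lexx 0) cf.
rewrite !mul0r addr0; apply => t abt; have [rho r1 r2] := rf t abt.
by exists rho, 0; split => //; rewrite expr0n mul0r.
Qed.

Lemma rate_constant f a b : 0 <= a -> a <= b -> b <= T ->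
  {within `[a, b], continuous f} -> (forall t, a < t < b -> rate f t 0 0) -> f b = f a.
Proof.
move=> a0 ab bT cf rf; apply/eqP; rewrite eq_le; apply/andP; split; last first.
  by apply: rate_nondecreasing => // t h; exists 0; [exact: rf|].
rewrite -lerN2; apply: (@rate_nondecreasing (fun x => - f x)) => //; first exact: withinN.
by move=> t h; exists 0 => //; have := rateN (rf t h); rewrite oppr0.
Qed.

Lemma rate_dist f g a b : 0 <= a -> a <= b -> b <= T ->
  {within `[a, b], continuous f} -> {within `[a, b], continuous g} ->
  (forall t, a < t < b -> exists rho sigma,
     [/\ rate f t rho 0, rate g t sigma 0 & `|rho| <= sigma]) ->
  `|f b - f a| <= g b - g a.
Proof.
move=> a0 ab bT cf cg H; rewrite ler_norml; apply/andP; split.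
  have : f a + g a <= f b + g b.
    apply: (@rate_nondecreasing (fun x => f x + g x)) => //; first exact: withinD.
    move=> t /H[rho [sigma [rf rg]]]; rewrite ler_norml => /andP[h1 h2].
    by exists (rho + sigma); [rewrite -[X in rate _ _ _ X](addr0 0); exact: rateD|lra].
  by lra.
have : g a - f a <= g b - f b.
  apply: (@rate_nondecreasing (fun x => g x - f x)) => //; first exact: withinB.
  move=> t /H[rho [sigma [rf rg]]]; rewrite ler_norml => /andP[h1 h2].
  by exists (sigma - rho); [rewrite -[X in rate _ _ _ X](subr0 0); exact: rateB|lra].
by lra.
Qed.

Lemma gronwall_le f a b K : 0 <= a -> a <= b -> b <= T ->
  {within `[a, b], continuous f} ->
  (forall t, a < t < b -> exists2 rho, rate f t rho 0 & rho <= K * f t) ->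
  f b <= f a * expR (K * (L b - L a)).
Proof.
move=> a0 ab bT cf H.
have sub : `[a, b]%classic `<=` `[0, T]%classic by apply: subset_itv; rewrite bnd_simp.
pose g x := - (f x * expR (- K * L x)).
have : g a <= g b.
  apply: rate_nondecreasing => //.
    apply/withinN/withinM => //; apply: within_expR; apply: withinM; first exact: within_cst.
    exact: withinS sub (driven_clock_continuous HD).
  move=> t /[dup] abt /H[rho rf rhoK].
  have tT : 0 < t < T by case/andP: abt => h1 h2; rewrite (le_lt_trans a0)// (lt_le_trans h2).
  have rL : rate (fun s => - K * L s) t (- K * 1) (- K * 0) by apply: rateZ; exact: rate_clock.
  have := rateN (rateM HD tT rf (rate_expR tT rL)).
  rewrite /= mulr0 !mul0r mulr0 addr0 oppr0 => rg.
  exists (- (rho * expR (- K * L t) + f t * (- K * 1 * expR (- K * L t)))) => //.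
  rewrite (_ : - _ = (K * f t - rho) * expR (- K * L t)); last by ring.
  by rewrite mulr_ge0 ?expR_ge0// subr_ge0.
rewrite /g lerN2 !mulNr !expRN ler_pdivrMr ?expR_gt0// mulrAC -mulrA => h.
by rewrite mulrBr expRB.
Qed.

Lemma gronwall f a b K : 0 <= a -> a <= b -> b <= T ->
  {within `[a, b], continuous f} ->
  (forall t, a < t < b -> exists2 rho, rate f t rho 0 & `|rho| <= K * f t) ->
  f a * expR (- (K * (L b - L a))) <= f b <= f a * expR (K * (L b - L a)).
Proof.
move=> a0 ab bT cf H; apply/andP; split; last first.
  apply: gronwall_le => // t /H[rho rf rhoK]; exists rho => //.
  exact: le_trans (ler_norm _) rhoK.
rewrite -lerN2 -mulNr -mulNr; apply: (@gronwall_le (fun x => - f x)) => //; first exact: withinN.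
move=> t /H[rho rf]; rewrite ler_norml => /andP[h1 h2].
by exists (- rho); [have := rateN rf; rewrite oppr0|lra].
Qed.

(** Gronwall's inequality for f^2, which also bounds from below, shows that [f] never vanishes; the
    intermediate value theorem then keeps its sign. *)
Lemma linear_rate_positive f a b K : 0 <= a -> a <= b -> b <= T ->
  {within `[a, b], continuous f} ->
  (forall t, a < t < b -> exists2 rho, rate f t rho 0 & `|rho| <= K * `|f t|) ->
  0 < f a -> 0 < f b.
Proof.
move=> a0 ab bT cf H fa.
have pos x : a <= x -> x <= b -> f x != 0.
  move=> ax xb; rewrite -sqrf_eq0 expr2 gt_eqF//.
  suff /andP[+ _] : f a * f a * expR (- (2 * K * (L x - L a))) <= f x * f x <=
      f a * f a * expR (2 * K * (L x - L a)).
    by apply: lt_le_trans; rewrite !mulr_gt0// expR_gt0.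
  apply: (@gronwall (fun x => f x * f x) a x (2 * K)) => //; first exact: le_trans bT.
    have sub : `[a, x]%classic `<=` `[a, b]%classic by apply: subset_itvl; rewrite bnd_simp.
    by apply: withinM; exact: withinS sub cf.
  move=> t /andP[at_ tx]; have abt : a < t < b by rewrite at_ (lt_le_trans tx).
  have [rho rf rhoK] := H t abt.
  have tT : 0 < t < T by case/andP: abt => h1 h2; rewrite (le_lt_trans a0)// (lt_le_trans h2).
  have := rateM HD tT rf rf; rewrite mul0r mulr0 addr0 => rff.
  exists (rho * f t + f t * rho) => //.
  rewrite (_ : rho * f t + _ = 2 * (rho * f t)); last by ring.
  rewrite 2!normrM ger0_norm// -mulrA ler_wpM2l//.
  rewrite (_ : f t * f t = `|f t| * `|f t|); last by rewrite -normrM ger0_norm// -expr2 sqr_ge0.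
  by rewrite mulrA ler_wpM2r.
rewrite ltNge; apply/negP => fb.
have [|c] := @IVT _ f a b 0 ab cf.
  by rewrite ge_min fb orbT le_max (ltW fa).
by rewrite in_itv/= => /andP[ac cb] /eqP; rewrite (negPf (pos c ac cb)).
Qed.

End rate_rules.

(** * Integrals against the weight *)

Section weighted_integrals.
Context (R : realType) (T : R) (lam : R -> R) (hlam : weight_function T lam).
Notation mu := (@lebesgue_measure R).

Definition clock (t : R) : R := \int[mu]_(s in `[0, t]) lam s.

Lemma subset_itvcc (a b c d : R) : c <= a -> b <= d -> `[a, b]%classic `<=` `[c, d]%classic.
Proof. by move=> ca bd; apply: subset_itv; rewrite bnd_simp. Qed.

Lemma weight_integrable a b : 0 <= a -> b <= T -> mu.-integrable `[a, b] (EFin \o lam).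
Proof.
by move=> a0 bT; have [_ _ il] := hlam; apply: integrableS il => //; exact: subset_itvcc.
Qed.

Lemma weighted_integrable a b (F : R -> R) : 0 <= a -> b <= T ->
  {within `[a, b], continuous F} ->
  mu.-integrable `[a, b] (EFin \o (fun s => lam s * F s)).
Proof.
move=> a0 bT cF; have cpt : compact `[a, b]%classic by exact: segment_compact.
have bdF : [bounded F x | x in `[a, b]].
  have /compact_bounded[M [Mr HM]] := continuous_compact cF cpt.
  by exists M; split => // x Mx y yab; apply: HM Mx _ _; exists y.
have mF : measurable_fun `[a, b] F.
  by apply: subspace_continuous_measurable_fun.
have mI : measurable (`[a, b]%classic : set (measurableTypeR R)) by exact: measurable_itv.
have := @integrableMr _ _ R mu _ mI F _ mF bdF (weight_integrable a0 bT).
by apply: eq_integrable => // x _; rewrite /= mulrC.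
Qed.

Lemma weighted_split a b c (F : R -> R) : 0 <= a -> a <= b -> b <= c -> c <= T ->
  {within `[a, c], continuous F} ->
  \int[mu]_(s in `[a, c]) (lam s * F s) =
  \int[mu]_(s in `[a, b]) (lam s * F s) + \int[mu]_(s in `[b, c]) (lam s * F s).
Proof.
by move=> a0 ab bc cT cF; apply: Rintegral_itv_split => //; exact: weighted_integrable.
Qed.

Lemma clockB a b : 0 <= a -> a <= b -> b <= T ->
  clock b - clock a = \int[mu]_(s in `[a, b]) lam s.
Proof.
move=> a0 ab bT; rewrite /clock (@Rintegral_itv_split _ _ 0 a b)//; first by ring.
exact: weight_integrable.
Qed.

Lemma clock0 : clock 0 = 0.
Proof. by rewrite /clock set_itv1 Rintegral_set1. Qed.

Lemma clock_continuous : 0 <= T -> {within `[0, T], continuous clock}.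
Proof.
by move=> T0; apply: parameterized_integral_continuous => //; exact: weight_integrable.
Qed.

Lemma weighted_dist a b (F : R -> R) c e : 0 <= a -> a <= b -> b <= T ->
  {within `[a, b], continuous F} -> (forall s, a <= s <= b -> `|F s - c| <= e) ->
  `|\int[mu]_(s in `[a, b]) (lam s * F s) - c * (clock b - clock a)| <=
    e * (clock b - clock a).
Proof.
move=> a0 ab bT cF Fc.
have il := weight_integrable a0 bT.
have iF := weighted_integrable a0 bT cF.
have ic k : mu.-integrable `[a, b] (EFin \o (fun s => k * lam s)).
  by apply: (@integrableZl _ _ _ mu _ _ k (EFin \o lam)).
rewrite clockB// -!RintegralZl// -RintegralB//.
have iB : mu.-integrable `[a, b] (EFin \o (fun s => lam s * F s - c * lam s)).
  exact: (integrableB _ iF (ic c)).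
apply: le_trans (le_normr_Rintegral _ iB) _ => //.
apply: le_Rintegral => //.
  exact: (integrable_abse iB).
move=> s /=; rewrite in_itv/= => /andP[as_ sb].
have [l0 _ _] := hlam.
have ls : 0 < lam s by apply: l0; rewrite (le_trans a0 as_) (le_trans sb).
rewrite (_ : _ - _ = (F s - c) * lam s); last by ring.
by rewrite normrM (gtr0_norm ls) ler_wpM2r ?(ltW ls)// Fc ?as_.
Qed.

Context (hlam_inv : has_ubound (inv_weight_values T lam)) (T0 : 0 < T).
Notation c := (inv_weight_norm T lam).

Lemma inv_weight_norm_gt0 : 0 < c.
Proof.
have [l0 _ _] := hlam.
have H : 0 < lam 0 by rewrite l0// lexx ltW.
apply: (@lt_le_trans _ _ `|lam 0|^-1); first by rewrite invr_gt0 normr_gt0 gt_eqF.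
apply: ub_le_sup => //; exists 0 => //=; by rewrite in_itv/= lexx ltW.
Qed.

Lemma time_le_clock a b : 0 <= a -> a <= b -> b <= T -> b - a <= c * (clock b - clock a).
Proof.
move=> a0 ab bT; have [l0 _ _] := hlam.
rewrite clockB// -RintegralZl//; last exact: weight_integrable.
have -> : b - a = \int[mu]_(s in `[a, b]) 1.
  rewrite Rintegral_cst//= mul1r lebesgue_measure_itv/= lte_fin.
  move: ab; rewrite le_eqVlt => /predU1P[->|->]; last by [].
  by rewrite ltxx subrr.
apply: le_Rintegral => //.
- apply: continuous_compact_integrable; first exact: segment_compact.
  by apply: continuous_subspaceT => x; exact: cvg_cst.
- by apply: (@integrableZl _ _ _ mu _ _ c (EFin \o lam)) => //; exact: weight_integrable.
move=> s /=; rewrite in_itv/= => /andP[as_ sb].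
have s0T : 0 <= s <= T by rewrite (le_trans a0 as_) (le_trans sb).
have ls : 0 < lam s by apply: l0.
rewrite -ler_pdivrMr// div1r; apply: ub_le_sup => //.
by exists s => //=; rewrite gtr0_norm.
Qed.

(** From dt <= c dL and (d theta)^2 <= dt dN follows (d theta)^2 <= dL d(c N), so [n] is c N with c
    the norm of 1 / lam. *)
Lemma weight_driven (theta : R -> R) : absolutely_continuous T theta ->
  (energy T theta < +oo)%E ->
  exists2 n, driven T clock theta n & n T - n 0 <= 2 * c * fine (energy T theta).
Proof.
move=> acth Eoo; have [N [N0 cN HN NT]] := energy_modulus T0 acth Eoo.
have c0 := inv_weight_norm_gt0.
exists (fun t => c * N t); last first.
  by rewrite -mulrBr N0 subr0 (mulrC 2) -mulrA ler_wpM2l ?(ltW c0).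
split.
- exact/clock_continuous/ltW.
- move=> a b a0 ab bT; have := time_le_clock a0 (ltW ab) bT.
  move=> h; rewrite -subr_gt0 -(pmulr_rgt0 _ c0); apply: lt_le_trans h.
  by rewrite subr_gt0.
- by apply: withinM => //; exact: within_cst.
- by move=> a b a0 ab bT; rewrite ler_wpM2l ?(ltW c0)//; have [] := HN a b a0 ab bT.
- move=> a b a0 ab bT; have [h1 h2] := HN a b a0 ab bT.
  apply: le_trans h2 _; rewrite -mulrBr mulrA (mulrC _ c).
  by rewrite ler_wpM2r ?subr_ge0// time_le_clock.
Qed.

(** Over [t, s] the integral of lam F differs from F t (L s - L t) by at most the oscillation of F
    times the clock increment. So the rate is F t at every interior time, jumps of [lam]
    included. *)
Lemma weighted_integral_rate (theta F : R -> R) r t : 0 < t < r -> r <= T ->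
  {within `[0, r], continuous F} ->
  rate clock theta (fun t => \int[mu]_(s in `[0, t]) (lam s * F s)) t (F t) 0.
Proof.
move=> /andP[t0 tr] rT cF e e0.
have t0r : 0 < t < r by rewrite t0.
have /nbhs_ballP[d /= d0 Hd] := within_itvcc_near t0r cF e0.
near=> s.
have sd : `|t - s| < d.
  near: s; have : nbhs t (ball t d) by exact: nbhsx_ballx.
  by apply: filterS => s.
have /andP[s0 sr] : 0 < s < r by near: s; exact: near_itv.
rewrite mul0r subr0.
have cFab a b : 0 <= a -> b <= r -> {within `[a, b], continuous F}.
  by move=> a0 br; apply: withinS cF; exact: subset_itvcc.
have [ts|st] := leP t s.
  have sT := le_trans (ltW sr) rT.
  rewrite (@weighted_split 0 t s) ?(ltW t0)//; last by apply: cFab => //; exact: ltW.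
  have L0 : 0 <= clock s - clock t.
    have := le_trans _ (time_le_clock (ltW t0) ts sT).
    by rewrite -(pmulr_rge0 _ inv_weight_norm_gt0); apply; rewrite subr_ge0.
  rewrite (ger0_norm L0).
  rewrite (_ : _ - _ = \int[mu]_(x in `[t, s]) (lam x * F x) - F t * (clock s - clock t)); last by ring.
  apply: weighted_dist => //; [exact: ltW|exact: cFab (ltW t0) (ltW sr)|].
  move=> x /andP[tx xs]; apply/ltW/Hd; rewrite /ball/=.
  by move: sd; rewrite !ler0_norm; lra.
have tT := le_trans (ltW tr) rT.
rewrite (@weighted_split 0 s t) ?(ltW s0) ?(ltW st)//; last by apply: cFab => //; exact: ltW.
have L0 : 0 <= clock t - clock s.
  have := le_trans _ (time_le_clock (ltW s0) (ltW st) tT).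
  by rewrite -(pmulr_rge0 _ inv_weight_norm_gt0); apply; rewrite subr_ge0 ltW.
rewrite (distrC (clock s)) (ger0_norm L0).
rewrite (_ : _ - _ = - (\int[mu]_(x in `[s, t]) (lam x * F x) - F t * (clock t - clock s))).
  rewrite normrN; apply: weighted_dist => //; [exact: ltW|exact: ltW|exact: cFab (ltW s0) (ltW tr)|].
  move=> x /andP[sx xt]; apply/ltW/Hd; rewrite /ball/=.
  by move: sd; rewrite !ger0_norm; lra.
by ring.
Unshelve. all: by end_near. Qed.

Lemma weighted_integral_continuous (F : R -> R) r : 0 <= r -> r <= T ->
  {within `[0, r], continuous F} ->
  {within `[0, r], continuous (fun t => \int[mu]_(s in `[0, t]) (lam s * F s))}.
Proof.
by move=> r0 rT cF; apply: parameterized_integral_continuous => //; exact: weighted_integrable.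
Qed.

End weighted_integrals.

(** * Trajectories in the disc *)

Section disc_geometry.
Context (R : realType).
Implicit Types (a b th : R).

Definition sqmod a b := a ^+ 2 + b ^+ 2.
Definition gap a b th := (cos th - a) ^+ 2 + (sin th - b) ^+ 2.

(* (w + x) / (w - x) = poisson + i conjugate_poisson for x = a + ib and w = e^{i th} *)
Definition poisson a b th := (1 - sqmod a b) / gap a b th.
Definition conjugate_poisson a b th := 2 * (b * cos th - a * sin th) / gap a b th.

Lemma gap_ge0 a b th : 0 <= gap a b th.
Proof. by rewrite addr_ge0 ?sqr_ge0. Qed.

Lemma sqmod_ge0 a b : 0 <= sqmod a b.
Proof. by rewrite addr_ge0 ?sqr_ge0. Qed.

Lemma gapE a b th : gap a b th = 1 + sqmod a b - 2 * (a * cos th + b * sin th).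
Proof. by have := cos2Dsin2 th; rewrite /gap /sqmod !expr2; lra. Qed.

Lemma gap_gt0 a b th : sqmod a b < 1 -> 0 < gap a b th.
Proof.
move=> N1; rewrite lt_neqAle gap_ge0 andbT eq_sym; apply/negP => /eqP E0.
have [ea eb] : cos th = a /\ sin th = b.
  move: E0; rewrite /gap => /eqP; rewrite paddr_eq0 ?sqr_ge0// !sqrf_eq0 !subr_eq0.
  by move=> /andP[/eqP -> /eqP ->].
by move: N1; rewrite -ea -eb /sqmod cos2Dsin2 ltxx.
Qed.

Lemma dot_sqr_le a b th : (a * cos th + b * sin th) ^+ 2 <= sqmod a b.
Proof.
have -> : sqmod a b = (a * cos th + b * sin th) ^+ 2 + (b * cos th - a * sin th) ^+ 2.
  rewrite (_ : _ + _ = sqmod a b * (cos th ^+ 2 + sin th ^+ 2)); last by rewrite /sqmod; ring.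
  by rewrite cos2Dsin2 mulr1.
by rewrite lerDl sqr_ge0.
Qed.

Lemma poisson_gap a b th : 0 < gap a b th -> poisson a b th * gap a b th = 1 - sqmod a b.
Proof. by move=> E0; rewrite divfK// gt_eqF. Qed.

Lemma conjugate_poisson_gap a b th : 0 < gap a b th ->
  conjugate_poisson a b th * gap a b th = 2 * (b * cos th - a * sin th).
Proof. by move=> E0; rewrite divfK// gt_eqF. Qed.

(** The parallelogram law |w + x|^2 + |w - x|^2 = 2 (1 + |x|^2), since |P|^2 is |w + x|^2 / |w -
    x|^2. *)
Lemma poisson_sqr a b th : 0 < gap a b th ->
  (poisson a b th ^+ 2 + conjugate_poisson a b th ^+ 2 + 1) * gap a b th = 2 * (1 + sqmod a b).
Proof.
move=> E0; have E1 : gap a b th != 0 by rewrite gt_eqF.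
apply: (mulIf E1).
have h1 := poisson_gap E0; have h2 := conjugate_poisson_gap E0; have h3 := gapE a b th.
have h4 : sqmod a b = (a * cos th + b * sin th) ^+ 2 + (b * cos th - a * sin th) ^+ 2.
  rewrite (_ : _ + _ = sqmod a b * (cos th ^+ 2 + sin th ^+ 2)); last by rewrite /sqmod; ring.
  by rewrite cos2Dsin2 mulr1.
rewrite (_ : _ * _ * _ = (poisson a b th * gap a b th) ^+ 2 +
  (conjugate_poisson a b th * gap a b th) ^+ 2 + gap a b th ^+ 2); last by ring.
rewrite h1 h2 h3.
move: h4; set N := sqmod a b; set p := a * cos th + _; set q := b * cos th - _ => h4.
by rewrite (_ : (2 * q) ^+ 2 = 4 * (N - p ^+ 2)); [ring|rewrite h4; ring].
Qed.

Lemma poisson_gt0 a b th : sqmod a b < 1 -> 0 < poisson a b th.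
Proof. by move=> N1; rewrite divr_gt0 ?subr_gt0// gap_gt0. Qed.

End disc_geometry.

Section disc_flow.
Context (R : realType) (T : R) (L theta n : R -> R) (HD : driven T L theta n).
Implicit Types (a b : R -> R) (r t : R).
Local Notation rate := (rate L theta).

Definition fpoisson a b t := poisson (a t) (b t) (theta t).
Definition fconj a b t := conjugate_poisson (a t) (b t) (theta t).
Definition fgap a b t := gap (a t) (b t) (theta t).
Definition fsqmod a b t := sqmod (a t) (b t).

(* The trajectory x = a + ib of a point of the disc under dx = x (w + x) / (w - x) dL. *)
Record disc_flow r a b : Prop := DiscFlow {
  flow_re_continuous : {within `[0, r], continuous a};
  flow_im_continuous : {within `[0, r], continuous b};
  flow_gap : forall t, 0 <= t <= r -> 0 < fgap a b t;
  flow_re_rate : forall t, 0 < t < r ->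
    rate a t (a t * fpoisson a b t - b t * fconj a b t) 0;
  flow_im_rate : forall t, 0 < t < r ->
    rate b t (a t * fconj a b t + b t * fpoisson a b t) 0;
  flow_start : fsqmod a b 0 < 1 }.

Lemma disc_flowS r s a b : s <= r -> disc_flow r a b -> disc_flow s a b.
Proof.
move=> sr [ca cb E0 ra rb N0]; split => //.
- by apply: withinS ca; exact: subset_itvcc.
- by apply: withinS cb; exact: subset_itvcc.
- by move=> t /andP[t0 ts]; apply: E0; rewrite t0 (le_trans ts).
- by move=> t /andP[t0 ts]; apply: ra; rewrite t0 (lt_le_trans ts).
- by move=> t /andP[t0 ts]; apply: rb; rewrite t0 (lt_le_trans ts).
Qed.

Lemma driving_within : {within `[0, T], continuous theta}.
Proof.
apply/subspace_continuousP => x /=; rewrite in_itv/= => /andP[x0 xT].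
apply/cvgrPdist_lt => e e0.
have e20 : 0 < e ^+ 2 by rewrite exprn_gt0.
have /subspace_continuousP/(_ x) := driven_clock_continuous HD.
rewrite /= in_itv/= x0 xT => /(_ isT) /cvgrPdist_lt/(_ 1 ltr01) h1.
have /subspace_continuousP/(_ x) := driven_energy_continuous HD.
rewrite /= in_itv/= x0 xT => /(_ isT) /cvgrPdist_lt/(_ _ e20) h2.
have h3 : \forall s \near within `[0, T]%classic (nbhs x), 0 <= s <= T.
  by apply: filterS (withinT _ _) => s; rewrite /= in_itv.
near=> s.
have /andP[s0 sT] : 0 <= s <= T by near: s.
have k1 : `|L x - L s| < 1 by near: s.
have k2 : `|n x - n s| < e ^+ 2 by near: s.
have key u v : 0 <= u -> u <= v -> v <= T -> `|L u - L v| < 1 -> `|n u - n v| < e ^+ 2 ->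
    `|theta v - theta u| < e.
  move=> u0 uv vT; have L0 : 0 <= L v - L u.
    by move: uv; rewrite le_eqVlt => /predU1P[->|h]; rewrite subr_ge0// ltW// (driven_clock_increasing HD).
  have n0 : 0 <= n v - n u by rewrite subr_ge0 (driven_energy_nondecreasing HD).
  rewrite distrC (ger0_norm L0) distrC (ger0_norm n0) => l1 l2.
  rewrite -(@ltr_pXn2r _ 2%N) ?nnegrE ?(ltW e0)// real_normK ?num_real//.
  apply: le_lt_trans (driven_modulus HD u0 uv vT) _.
  apply: le_lt_trans l2; rewrite ler_piMl//; exact: ltW.
have [xs|/ltW sx] := leP x s; first by rewrite distrC; exact: key.
by apply: key => //; rewrite distrC.
Unshelve. all: by end_near. Qed.

Lemma poisson_within r (a b : R -> R) : r <= T -> {within `[0, r], continuous a} ->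
  {within `[0, r], continuous b} -> (forall t, 0 <= t <= r -> 0 < fgap a b t) ->
  {within `[0, r], continuous (fpoisson a b)} /\ {within `[0, r], continuous (fconj a b)}.
Proof.
move=> rT ca cb E0.
have cth : {within `[0, r], continuous theta}.
  by apply: withinS (driving_within); exact: subset_itvcc.
have cc : {within `[0, r], continuous (fun s => cos (theta s))}.
  by apply: (within_comp _ cth) => x _; exact: continuous_cos.
have cs : {within `[0, r], continuous (fun s => sin (theta s))}.
  by apply: (within_comp _ cth) => x _; exact: continuous_sin.
have cE : {within `[0, r], continuous (fun s => (fgap a b s)^-1)}.
  apply: withinV; first by move=> x /=; rewrite in_itv/= => xr; rewrite gt_eqF// E0.
  by rewrite /fgap /gap; apply: withinD; under [X in continuous X]eq_fun do rewrite expr2;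
    apply: withinM; apply: withinB.
split; apply: withinM => //.
  apply: withinB; first exact: within_cst.
  by rewrite /sqmod; apply: withinD; under [X in continuous X]eq_fun do rewrite expr2; apply: withinM.
apply: withinM; first exact: within_cst.
by apply: withinB; apply: withinM.
Qed.

Section along.
Context (r : R) (a b : R -> R) (rT : r <= T) (Hf : disc_flow r a b).

Lemma flow_driving_within : {within `[0, r], continuous theta}.
Proof. by apply: withinS driving_within; exact: subset_itvcc. Qed.

Lemma flow_sqmod_within : {within `[0, r], continuous (fsqmod a b)}.
Proof.
rewrite /fsqmod /sqmod.
apply: withinD; under [X in continuous X]eq_fun do rewrite expr2; apply: withinM.
- exact: flow_re_continuous Hf.
- exact: flow_re_continuous Hf.
- exact: flow_im_continuous Hf.
- exact: flow_im_continuous Hf.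
Qed.

Lemma cos_driving_within : {within `[0, r], continuous (fun s => cos (theta s))}.
Proof. by apply: (within_comp _ flow_driving_within) => x _; exact: continuous_cos. Qed.

Lemma sin_driving_within : {within `[0, r], continuous (fun s => sin (theta s))}.
Proof. by apply: (within_comp _ flow_driving_within) => x _; exact: continuous_sin. Qed.

Lemma flow_gap_within : {within `[0, r], continuous (fgap a b)}.
Proof.
have ca := flow_re_continuous Hf; have cb := flow_im_continuous Hf.
rewrite /fgap /gap.
apply: withinD; under [X in continuous X]eq_fun do rewrite expr2; apply: withinM;
  apply: withinB => //; first [exact: cos_driving_within|exact: sin_driving_within].
Qed.

Lemma flow_poisson_within : {within `[0, r], continuous (fpoisson a b)}.
Proof. exact: (poisson_within rT (flow_re_continuous Hf) (flow_im_continuous Hf) (flow_gap Hf)).1. Qed.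

Lemma flow_conj_within : {within `[0, r], continuous (fconj a b)}.
Proof. exact: (poisson_within rT (flow_re_continuous Hf) (flow_im_continuous Hf) (flow_gap Hf)).2. Qed.

Lemma flow_gap_bound : 0 <= r -> exists2 e, 0 < e & forall t, 0 <= t <= r -> e <= fgap a b t.
Proof.
move=> r0; have [c cr Hc] := EVT_min r0 flow_gap_within.
exists (fgap a b c); first by apply: (flow_gap Hf); move: cr; rewrite in_itv.
by move=> t tr; apply: Hc; rewrite in_itv.
Qed.

Lemma flow_sqmod_rate t : 0 < t < r ->
  rate (fsqmod a b) t (2 * fsqmod a b t * fpoisson a b t) 0.
Proof.
move=> /andP[t0 tr]; have tT : 0 < t < T by rewrite t0 (lt_le_trans tr).
have t0r : 0 < t < r by rewrite t0.
have ra := flow_re_rate Hf t0r; have rb := flow_im_rate Hf t0r.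
apply: rate_near_eq (rate_eq _ _ (rateD (rateM HD tT ra ra) (rateM HD tT rb rb))).
- by near=> s; rewrite /fsqmod /sqmod !expr2.
- by rewrite /fsqmod /sqmod; ring.
- by ring.
Unshelve. all: by end_near. Qed.

(** The function 1 - N solves a linear equation with coefficient - 2 N / E, which is bounded on
    [0, r] because the gap E has a positive minimum there. *)
Lemma flow_sqmod_lt1 t : 0 <= t -> t <= r -> fsqmod a b t < 1.
Proof.
move=> t0 tr; rewrite -subr_gt0.
have r0 := le_trans t0 tr.
have [e e0 He] := flow_gap_bound r0.
have sub : `[0, t]%classic `<=` `[0, r]%classic by exact: subset_itvcc.
have [M HM] : exists M, forall s, 0 <= s <= r -> fsqmod a b s <= M.
  have [c cr Hc] := EVT_max r0 flow_sqmod_within.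
  by exists (fsqmod a b c) => s sr; apply: Hc; rewrite in_itv.
apply: (@linear_rate_positive _ T L theta n HD (fun s => 1 - fsqmod a b s) 0 t (2 * M / e)) => //.
- exact: le_trans rT.
- by apply: withinB; [exact: within_cst|exact: withinS sub flow_sqmod_within].
- move=> s /andP[s0 st]; have s0r : 0 < s < r by rewrite s0 (lt_le_trans st).
  exists (0 - (2 * fsqmod a b s * fpoisson a b s)).
    by rewrite -[X in rate _ _ _ X](subr0 0); apply: rateB; [exact: rate_cst|exact: flow_sqmod_rate].
  have sr : 0 <= s <= r by case/andP: s0r => /ltW -> /ltW.
  have E0 := He _ sr.
  rewrite sub0r normrN /fpoisson /poisson normrM [`|_ / _|]normrM mulrA mulrAC ler_wpM2r//.
  rewrite normfV (ger0_norm (gap_ge0 _ _ _)) normrM (ger0_norm (sqmod_ge0 _ _)) ger0_norm//.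
  rewrite -!mulrA ler_wpM2l//; apply: ler_pM; rewrite ?invr_ge0 ?gap_ge0 ?sqmod_ge0//.
    exact: HM.
  by rewrite lef_pV2// posrE//; exact: lt_le_trans E0.
- by rewrite subr_gt0; exact: flow_start Hf.
Qed.

Lemma flow_poisson_gt0 t : 0 <= t -> t <= r -> 0 < fpoisson a b t.
Proof. by move=> t0 tr; apply: poisson_gt0; exact: flow_sqmod_lt1. Qed.

Lemma flow_sqmod_nondecreasing s t : 0 <= s -> s <= t -> t <= r -> fsqmod a b s <= fsqmod a b t.
Proof.
move=> s0 st tr; apply: (@rate_nondecreasing _ T L theta n HD) => //.
- exact: le_trans rT.
- by apply: withinS flow_sqmod_within; exact: subset_itvcc.
move=> x /andP[sx xt]; have xr : 0 < x < r by rewrite (le_lt_trans s0) ?(lt_le_trans xt).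
exists (2 * fsqmod a b x * fpoisson a b x); first exact: flow_sqmod_rate.
case/andP: xr => x0 xr.
apply: mulr_ge0; first by apply: mulr_ge0 => //; exact: sqmod_ge0.
by apply/ltW/flow_poisson_gt0; exact: ltW.
Qed.

(** With w / (w - x) = (1 + P) / 2 and x / (w - x) = (P - 1) / 2, the differential of ln |w - x|^2
    is Re (i (1 + P)) dtheta - Re (P (P - 1)) dL, where P = U + i V. *)
Lemma flow_log_gap_rate t : 0 < t < r ->
  rate (@ln R \o fgap a b) t (fpoisson a b t - fpoisson a b t ^+ 2 + fconj a b t ^+ 2) (- fconj a b t).
Proof.
move=> /andP[t0 tr]; have tT : 0 < t < T by rewrite t0 (lt_le_trans tr).
have t0r : 0 < t < r by rewrite t0.
have E0 : 0 < fgap a b t by apply: (flow_gap Hf); rewrite (ltW t0) ltW.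
have ra := flow_re_rate Hf t0r; have rb := flow_im_rate Hf t0r.
have rA := rateB (rate_cos HD tT) ra; have rB := rateB (rate_sin HD tT) rb.
have rE := rateD (rateM HD tT rA rA) (rateM HD tT rB rB).
set rho := (X in rate _ _ X _) in rE; set v := (X in rate _ _ _ X) in rE.
have {}rE : rate (fgap a b) t rho v.
  by apply: rate_near_eq rE; near=> s; rewrite /fgap /gap !expr2.
apply: rate_eq (rate_ln HD tT E0 rE).
  rewrite /rho /=; apply: (mulIf (lt0r_neq0 E0)); rewrite divfK ?lt0r_neq0//.
  have := gapE (a t) (b t) (theta t); have := poisson_gap E0; have := conjugate_poisson_gap E0.
  rewrite -/(fgap a b t) -/(fpoisson a b t) -/(fconj a b t) /sqmod.
  move: (fgap a b t) (fpoisson a b t) (fconj a b t) (cos _) (sin _) => E U V C S h1 h2 h3.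
  have k1 : U * E = U * (1 + (a t ^+ 2 + b t ^+ 2) - 2 * (a t * C + b t * S)) by rewrite h3.
  have k2 : U * (U * E) = U * (1 - (a t ^+ 2 + b t ^+ 2)) by rewrite h2.
  have k3 : V * (V * E) = V * (2 * (b t * C - a t * S)) by rewrite h1.
  lra.
rewrite /v /=; apply: (mulIf (lt0r_neq0 E0)); rewrite divfK ?lt0r_neq0//.
rewrite mulNr conjugate_poisson_gap//; ring.
Unshelve. all: by end_near. Qed.

End along.
End disc_flow.

Section disc_geometry2.
Context (R : realType).
Implicit Types (a b th : R).

(** Real and imaginary parts of x (1 + P) = w (P - 1), both sides being 2 w x / (w - x). *)
Lemma poisson_relation a b th : 0 < gap a b th ->
  a * (1 + poisson a b th) - b * conjugate_poisson a b th =
    cos th * (poisson a b th - 1) - sin th * conjugate_poisson a b th /\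
  b * (1 + poisson a b th) + a * conjugate_poisson a b th =
    sin th * (poisson a b th - 1) + cos th * conjugate_poisson a b th.
Proof.
move=> E0; have E1 : gap a b th != 0 by rewrite gt_eqF.
have := poisson_gap E0; have := conjugate_poisson_gap E0; have := gapE a b th.
have := cos2Dsin2 th; rewrite /sqmod.
move: (gap a b th) (poisson a b th) (conjugate_poisson a b th) (cos th) (sin th) E0 E1.
move=> E U V C S E0 E1 cs hE hV hU.
have k1 : a * C ^+ 2 + a * S ^+ 2 = a by rewrite -mulrDr cs mulr1.
have k2 : b * C ^+ 2 + b * S ^+ 2 = b by rewrite -mulrDr cs mulr1.
have l1 : b * (V * E) = b * (2 * (b * C - a * S)) by rewrite hV.
have l2 : S * (V * E) = S * (2 * (b * C - a * S)) by rewrite hV.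
have l3 : a * (U * E) = a * (1 - (a ^+ 2 + b ^+ 2)) by rewrite hU.
have l4 : C * (U * E) = C * (1 - (a ^+ 2 + b ^+ 2)) by rewrite hU.
have l5 : a * (V * E) = a * (2 * (b * C - a * S)) by rewrite hV.
have l6 : C * (V * E) = C * (2 * (b * C - a * S)) by rewrite hV.
have l7 : b * (U * E) = b * (1 - (a ^+ 2 + b ^+ 2)) by rewrite hU.
have l8 : S * (U * E) = S * (1 - (a ^+ 2 + b ^+ 2)) by rewrite hU.
have m1 : a * E = a * (1 + (a ^+ 2 + b ^+ 2) - 2 * (a * C + b * S)) by rewrite hE.
have m2 : b * E = b * (1 + (a ^+ 2 + b ^+ 2) - 2 * (a * C + b * S)) by rewrite hE.
have m3 : C * E = C * (1 + (a ^+ 2 + b ^+ 2) - 2 * (a * C + b * S)) by rewrite hE.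
have m4 : S * E = S * (1 + (a ^+ 2 + b ^+ 2) - 2 * (a * C + b * S)) by rewrite hE.
by split; apply: (mulIf E1); lra.
Qed.

(** Geometrically, 1 - |x| <= |w - x| and (1 + |x|)^2 <= 2 (1 + |x|^2). *)
Lemma sqr_sqmod_le a b th : 0 < gap a b th ->
  (1 - sqmod a b) ^+ 2 <= 2 * (1 + sqmod a b) * gap a b th.
Proof.
move=> E0; have := dot_sqr_le a b th; rewrite gapE.
move: (sqmod a b) (a * cos th + b * sin th) => N p h.
by have := sqr_ge0 (1 + N - 2 * p); rewrite !expr2 in h *; lra.
Qed.

End disc_geometry2.

(** * Almost monotone functionals of one trajectory *)

Section estimates.
Context (R : realType) (T : R) (L theta n : R -> R) (HD : driven T L theta n).
Implicit Types (a b : R -> R) (r t : R).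
Local Notation rate := (rate L theta).

(** In the covering coordinate X + i Y of the trajectory relative to theta this is ln (|sin ((X + i
    Y) / 2)|^2 / sinh(Y)^2), which is large when the driving point is seen in a tangential
    direction. *)
Definition angle a b (t : R) : R :=
  ln (fgap theta a b t) + 2^-1 * ln (fsqmod a b t) - 2 * ln (1 - fsqmod a b t).
(** This is 2 ln (2 cosh Y) with |x| = exp (- Y); its infimum ln 4 is approached at the unit
    circle. *)
Definition log_size a b (t : R) : R := 2 * ln (1 + fsqmod a b t) - ln (fsqmod a b t).

Section one_flow.
Context (r : R) (a b : R -> R) (rT : r <= T) (Hf : disc_flow L theta r a b).
Local Notation N := (fsqmod a b).
Local Notation E := (fgap theta a b).
Local Notation U := (fpoisson theta a b).
Local Notation V := (fconj theta a b).

Lemma flow_one_sub_rate t : 0 < t < r ->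
  rate (fun s => ln (1 - N s)) t (- (2 * N t) / E t) 0.
Proof.
move=> /andP[t0 tr]; have tT : 0 < t < T by rewrite t0 (lt_le_trans tr).
have t0r : 0 < t < r by rewrite t0.
have N1 : 0 < 1 - N t by rewrite subr_gt0 (flow_sqmod_lt1 HD rT Hf)// ltW.
apply: rate_eq (rate_ln HD tT N1 (rateB (rate_cst _ _ 1 t) (flow_sqmod_rate HD rT Hf t0r))).
  rewrite sub0r /fpoisson /poisson -/(E t) -/(N t); field.
  rewrite !lt0r_neq0//; apply: (flow_gap Hf); rewrite !ltW//.
by rewrite subrr mul0r.
Qed.

Lemma flow_gap_pos t : 0 < t < r -> 0 < E t.
Proof. by move=> /andP[t0 tr]; apply: (flow_gap Hf); rewrite !ltW. Qed.

Context (N0 : 0 < N 0).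

Lemma flow_sqmod_gt0 t : 0 <= t -> t <= r -> 0 < N t.
Proof. by move=> t0 tr; apply: lt_le_trans N0 _; exact: (flow_sqmod_nondecreasing HD rT Hf). Qed.

Lemma flow_log_sqmod_rate t : 0 < t < r -> rate (fun s => ln (N s)) t (2 * U t) 0.
Proof.
move=> /andP[t0 tr]; have tT : 0 < t < T by rewrite t0 (lt_le_trans tr).
have t0r : 0 < t < r by rewrite t0.
have Nt : 0 < N t by apply: flow_sqmod_gt0; exact: ltW.
apply: rate_eq (rate_ln HD tT Nt (flow_sqmod_rate HD rT Hf t0r)).
  by field; rewrite lt0r_neq0.
by rewrite mul0r.
Qed.

(** Both sides are |P - 1|^2, because P - 1 = 2 x / (w - x). *)
Lemma flow_sizeE t : 0 < t < r -> 4 * N t / E t = U t ^+ 2 + V t ^+ 2 + 1 - 2 * U t.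
Proof.
move=> /[dup] t0r /flow_gap_pos E0; apply: (mulIf (lt0r_neq0 E0)).
rewrite divfK ?lt0r_neq0// mulrBl poisson_sqr// -[2 * _ * _]mulrA poisson_gap//.
rewrite -/(N t); ring.
Qed.

(** The coefficients 1 / 2 and 2 in [angle] are those for which all terms in U cancel. *)
Lemma angle_rate t : 0 < t < r -> rate (angle a b) t (1 + 2 * V t ^+ 2) (- V t).
Proof.
move=> t0r; have h := flow_sizeE t0r.
apply: rate_eq (rateB (rateD (flow_log_gap_rate HD rT Hf t0r)
   (rateZ 2^-1 (flow_log_sqmod_rate t0r))) (rateZ 2 (flow_one_sub_rate t0r))).
  rewrite (_ : 2 * (- (2 * N t) / E t) = - (4 * N t / E t)); last by ring.
  by rewrite h; field.
by rewrite !mulr0 addr0 subr0.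
Qed.

Lemma log_gap_within : {within `[0, r], continuous (fun s => ln (E s))}.
Proof.
apply: (within_ln _ (flow_gap_within HD rT Hf)) => x /=; rewrite in_itv/=.
exact: (flow_gap Hf).
Qed.

Lemma log_sqmod_within : {within `[0, r], continuous (fun s => ln (N s))}.
Proof.
apply: (within_ln _ (flow_sqmod_within Hf)) => x /=; rewrite in_itv/= => /andP[x0 xr].
exact: flow_sqmod_gt0.
Qed.

Lemma log_one_sub_within : {within `[0, r], continuous (fun s => ln (1 - N s))}.
Proof.
apply: (within_ln (f := fun s => 1 - N s)).
  move=> x /=; rewrite in_itv/= => /andP[x0 xr].
  by rewrite subr_gt0; exact: (flow_sqmod_lt1 HD rT Hf).
by apply: withinB; [exact: within_cst|exact: flow_sqmod_within Hf].
Qed.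

Lemma log_one_add_within : {within `[0, r], continuous (fun s => ln (1 + N s))}.
Proof.
apply: (within_ln (f := fun s => 1 + N s)).
  by move=> x _; rewrite ltr_wpDr// sqmod_ge0.
by apply: withinD; [exact: within_cst|exact: flow_sqmod_within Hf].
Qed.

Lemma angle_within : {within `[0, r], continuous (angle a b)}.
Proof.
apply: withinB; first apply: withinD; first exact: log_gap_within.
  by apply: withinM; [exact: within_cst|exact: log_sqmod_within].
by apply: withinM; [exact: within_cst|exact: log_one_sub_within].
Qed.

Lemma angle_le s t : 0 <= s -> s <= t -> t <= r ->
  angle a b s <= angle a b t + 4^-1 * (n t - n s).
Proof.
move=> s0 st tr; have tT := le_trans tr rT.
have := @rate_energy_le _ T L theta n HD (angle a b) s t 1 s0 st tT ler01.
rewrite div1r; apply.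
  by apply: withinS angle_within; exact: subset_itvcc.
move=> x /andP[sx xt]; have xr : 0 < x < r by rewrite (le_lt_trans s0) ?(lt_le_trans xt).
exists (1 + 2 * V x ^+ 2), (- V x); split; first exact: angle_rate.
  by have := sqr_ge0 (V x); lra.
by rewrite sqrrN mul1r; have := sqr_ge0 (V x); lra.
Qed.

(* While the angle is nonnegative the trajectory is far from the normal direction at the
   driving point and is repelled by it: the gap cannot vanish. *)
Lemma log_gap_bound s t : 0 <= s -> s <= t -> t <= r ->
  (forall x, s <= x <= t -> 0 <= angle a b x) ->
  ln (E s) - 2^-1 * ln (N s) + 2^-1 * L s <=
    ln (E t) - 2^-1 * ln (N t) + 2^-1 * L t + 2^-1 * (n t - n s).
Proof.
move=> s0 st tr Ax; have tT := le_trans tr rT.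
pose f x := ln (E x) - 2^-1 * ln (N x) + 2^-1 * L x.
have := @rate_energy_le _ T L theta n HD f s t 2 s0 st tT (ler0n _ 2).
rewrite (_ : 2 / 4 = 2^-1 :> R); last by field.
have subr' : `[s, t]%classic `<=` `[0, r]%classic by exact: subset_itvcc.
apply.
  apply: withinD; first apply: withinB; first exact: withinS subr' log_gap_within.
    by apply: withinM; [exact: within_cst|exact: withinS subr' log_sqmod_within].
  apply: withinM; first exact: within_cst.
  by apply: withinS (driven_clock_continuous HD); exact: subset_itvcc.
move=> x /andP[sx xt]; have xr : 0 < x < r by rewrite (le_lt_trans s0) ?(lt_le_trans xt).
have E0 := flow_gap_pos xr.
have Nx : 0 < N x by case/andP: xr => x0 xr; apply: flow_sqmod_gt0; exact: ltW.
have N1 : N x < 1 by case/andP: xr => x0 xr; apply: (flow_sqmod_lt1 HD rT Hf); exact: ltW.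
(* This is V^2 <= 2 rho for rho = V^2 - U^2 + 1 / 2. A nonnegative angle means (1 - N)^2 <= E sqrt
   N, that is U^2 E <= sqrt N. By [poisson_sqr] the claim becomes 3 U^2 E <= 2 (1 + N), and 2 (1 +
   N) >= 4 sqrt N. *)
have key : 0 <= V x ^+ 2 - 2 * U x ^+ 2 + 1.
  rewrite -(pmulr_lge0 _ E0).
  have h1 := poisson_sqr E0; rewrite -/(U x) -/(V x) -/(E x) -/(N x) in h1.
  have h2 := poisson_gap E0; rewrite -/(U x) -/(E x) -/(N x) in h2.
  suff : 3 * (U x ^+ 2 * E x) <= 2 * (1 + N x) by move: h1; lra.
  have q0 : 0 < Num.sqrt (N x) by rewrite sqrtr_gt0.
  have qq : Num.sqrt (N x) ^+ 2 = N x by rewrite sqr_sqrtr ?ltW.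
  have angle0 : (1 - N x) ^+ 2 <= E x * Num.sqrt (N x).
    have hq : ln (N x) = 2 * ln (Num.sqrt (N x)) by rewrite -{1}qq lnXn// mulr_natl.
    have := Ax x; rewrite (ltW sx) (ltW xt) => /(_ isT); rewrite /angle => hA.
    rewrite -ler_ln ?posrE ?exprn_gt0 ?mulr_gt0 ?subr_gt0//.
    by rewrite lnXn ?subr_gt0// lnM ?posrE// -(mulr_natl (ln _)); lra.
  have : U x ^+ 2 * E x <= Num.sqrt (N x).
    rewrite -(ler_pM2r E0) (_ : _ * _ * _ = (U x * E x) ^+ 2); last by ring.
    by rewrite h2 mulrC.
  have := sqr_ge0 (1 - Num.sqrt (N x)); rewrite expr2; rewrite expr2 in qq; lra.
exists (V x ^+ 2 - U x ^+ 2 + 2^-1), (- V x); split.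
- apply: rate_eq (rateD (rateB (flow_log_gap_rate HD rT Hf xr)
   (rateZ 2^-1 (flow_log_sqmod_rate xr))) (rateZ 2^-1 (rate_clock L theta x))).
    by field.
  by rewrite !mulr0 addr0 subr0.
- by have := sqr_ge0 (V x); lra.
- by rewrite sqrrN; lra.
Qed.

(** The rate of [log_size] is - 2 U (1 - N) / (1 + N), and U (1 - N) = (1 - N)^2 / E is at most 2 (1
    + N) by [sqr_sqmod_le]. *)
Lemma log_size_le s t : 0 <= s -> s <= t -> t <= r ->
  log_size a b s <= log_size a b t + 4 * (L t - L s).
Proof.
move=> s0 st tr; have tT := le_trans tr rT.
have sub : `[s, t]%classic `<=` `[0, r]%classic by exact: subset_itvcc.
have : log_size a b s + 4 * L s <= log_size a b t + 4 * L t; last by lra.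
apply: (@rate_nondecreasing _ T L theta n HD (fun x => log_size a b x + 4 * L x)) => //.
  apply: withinD; first apply: withinB.
  - by apply: withinM; [exact: within_cst|exact: withinS sub log_one_add_within].
  - exact: withinS sub log_sqmod_within.
  - apply: withinM; first exact: within_cst.
    by apply: withinS (driven_clock_continuous HD); exact: subset_itvcc.
move=> x /andP[sx xt]; have xr : 0 < x < r by rewrite (le_lt_trans s0) ?(lt_le_trans xt).
have xT : 0 < x < T by case/andP: xr => -> /lt_le_trans; exact.
have E0 := flow_gap_pos xr.
have Np : 0 < 1 + N x by rewrite ltr_wpDr ?sqmod_ge0.
have r1 := rate_ln HD xT Np (rateD (rate_cst _ _ 1 x) (flow_sqmod_rate HD rT Hf xr)).
exists (2 * ((0 + 2 * N x * U x) / (1 + N x)) - 2 * U x + 4 * 1).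
  apply: rate_eq (rateD (rateB (rateZ 2 r1) (flow_log_sqmod_rate xr)) (rateZ 4 (rate_clock L theta x))) => //.
  by rewrite !addr0 mul0r !mulr0 subrr addr0.
rewrite add0r mulr1 -(pmulr_lge0 _ Np).
rewrite (_ : _ * (1 + N x) = 4 * (1 + N x) - 2 * (U x * (1 - N x))); last first.
  by field; rewrite lt0r_neq0.
have h2 := poisson_gap E0; rewrite -/(U x) -/(E x) -/(N x) in h2.
rewrite -(pmulr_lge0 _ E0) mulrBl.
rewrite (_ : 2 * _ * E x = 2 * ((U x * E x) * (1 - N x))); last by ring.
rewrite h2 -expr2; have := sqr_sqmod_le E0; rewrite -/(E x) -/(N x); lra.
Qed.

(** It rests on (1 - N)^2 <= 4 E alone. It serves to remove the angles at the earlier time when two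
    trajectories are compared. *)
Lemma angle_ge t : 0 <= t -> t <= r -> - ln 4 - 2^-1 * log_size a b t <= angle a b t.
Proof.
move=> t0 tr.
have E0 : 0 < E t by apply: (flow_gap Hf); rewrite t0.
have Nt := flow_sqmod_gt0 t0 tr; have N1 := flow_sqmod_lt1 HD rT Hf t0 tr.
have : ln ((1 - N t) ^+ 2) <= ln (4 * E t).
  rewrite ler_ln ?posrE ?mulr_gt0 ?exprn_gt0 ?subr_gt0//.
  by have := sqr_sqmod_le E0; rewrite -/(E t) -/(N t) => /le_trans; apply;
    rewrite ler_wpM2r ?(ltW E0)//; lra.
rewrite lnXn ?subr_gt0// lnM ?posrE// -mulr_natl.
have : 0 <= ln (1 + N t) by rewrite ln_ge0// lerDl ltW.
rewrite /angle /log_size; lra.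
Qed.

End one_flow.
End estimates.

(** * Comparison of two trajectories *)

Section two_flows.
Context (R : realType) (T : R) (L theta n : R -> R) (HD : driven T L theta n).
Context (r : R) (a b a' b' : R -> R) (rT : r <= T).
Context (Hf : disc_flow L theta r a b) (Hf' : disc_flow L theta r a' b').
Local Notation rate := (rate L theta).
Local Notation N := (fsqmod a b).
Local Notation E := (fgap theta a b).
Local Notation U := (fpoisson theta a b).
Local Notation V := (fconj theta a b).
Local Notation N' := (fsqmod a' b').
Local Notation E' := (fgap theta a' b').
Local Notation U' := (fpoisson theta a' b').
Local Notation V' := (fconj theta a' b').

(* The difference d of two trajectories satisfies d' = d (-1 + (1 + P) (1 + P') / 2), where
   P = U + i V, since x (1 + P) = w (P - 1). *)
Definition mult_re (t : R) := -1 + ((1 + U t) * (1 + U' t) - V t * V' t) / 2.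
Definition mult_im (t : R) := ((1 + U t) * V' t + V t * (1 + U' t)) / 2.

Definition sqdist (t : R) := sqmod (a t - a' t) (b t - b' t).

Lemma sqdist_ge0 t : 0 <= sqdist t. Proof. exact: sqmod_ge0. Qed.

Lemma difference_rate t : 0 < t < r ->
  rate (fun s => a s - a' s) t ((a t - a' t) * mult_re t - (b t - b' t) * mult_im t) 0 /\
  rate (fun s => b s - b' s) t ((a t - a' t) * mult_im t + (b t - b' t) * mult_re t) 0.
Proof.
move=> t0r.
have [h1 h2] := poisson_relation (flow_gap_pos Hf t0r).
have [h3 h4] := poisson_relation (flow_gap_pos Hf' t0r).
rewrite -/(U t) -/(V t) -/(U' t) -/(V' t) in h1 h2 h3 h4.
have ra := flow_re_rate Hf t0r; have rb := flow_im_rate Hf t0r.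
have ra' := flow_re_rate Hf' t0r; have rb' := flow_im_rate Hf' t0r.
rewrite /mult_re /mult_im.
split; [apply: rate_eq (rateB ra ra'); last by rewrite subr0|
        apply: rate_eq (rateB rb rb'); last by rewrite subr0];
  move: h1 h2 h3 h4 {ra rb ra' rb'};
  move: (U t) (V t) (U' t) (V' t) (cos _) (sin _) (a t) (b t) (a' t) (b' t);
  move=> u v u' v' C S x y x' y' h1 h2 h3 h4.
- have k1 : (x * (1 + u) - y * v) * (1 + u') = (C * (u - 1) - S * v) * (1 + u') by rewrite h1.
  have k2 : (y * (1 + u) + x * v) * v' = (S * (u - 1) + C * v) * v' by rewrite h2.
  have k3 : (x' * (1 + u') - y' * v') * (1 + u) = (C * (u' - 1) - S * v') * (1 + u) by rewrite h3.
  have k4 : (y' * (1 + u') + x' * v') * v = (S * (u' - 1) + C * v') * v by rewrite h4.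
  lra.
- have k1 : (x * (1 + u) - y * v) * v' = (C * (u - 1) - S * v) * v' by rewrite h1.
  have k2 : (y * (1 + u) + x * v) * (1 + u') = (S * (u - 1) + C * v) * (1 + u') by rewrite h2.
  have k3 : (x' * (1 + u') - y' * v') * v = (C * (u' - 1) - S * v') * v by rewrite h3.
  have k4 : (y' * (1 + u') + x' * v') * (1 + u) = (S * (u' - 1) + C * v') * (1 + u) by rewrite h4.
  lra.
Qed.

Lemma sqdist_rate t : 0 < t < r -> rate sqdist t (2 * mult_re t * sqdist t) 0.
Proof.
move=> /[dup] /andP[t0 tr] t0r; have tT : 0 < t < T by rewrite t0 (lt_le_trans tr).
have [h1 h2] := difference_rate t0r.
apply: rate_near_eq (rate_eq _ _ (rateD (rateM HD tT h1 h1) (rateM HD tT h2 h2))).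
- by near=> s; rewrite /sqdist /sqmod !expr2.
- by rewrite /sqdist /sqmod; ring.
- by ring.
Unshelve. all: by end_near. Qed.

Lemma sqdist_within : {within `[0, r], continuous sqdist}.
Proof.
rewrite /sqdist /sqmod; apply: withinD;
  under [X in continuous X]eq_fun do rewrite expr2; apply: withinM; apply: withinB.
all: by [exact: flow_re_continuous Hf|exact: flow_re_continuous Hf'|
         exact: flow_im_continuous Hf|exact: flow_im_continuous Hf'].
Qed.

Lemma mult_re_within : {within `[0, r], continuous mult_re}.
Proof.
have cU := flow_poisson_within HD rT Hf; have cV := flow_conj_within HD rT Hf.
have cU' := flow_poisson_within HD rT Hf'; have cV' := flow_conj_within HD rT Hf'.
have c1 := @within_cst R `[0, r]%classic 1.
apply: withinD; first exact: within_cst.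
apply: withinM; last exact: within_cst.
by apply: withinB; apply: withinM => //; apply: withinD.
Qed.

Lemma mult_im_within : {within `[0, r], continuous mult_im}.
Proof.
have cU := flow_poisson_within HD rT Hf; have cV := flow_conj_within HD rT Hf.
have cU' := flow_poisson_within HD rT Hf'; have cV' := flow_conj_within HD rT Hf'.
have c1 := @within_cst R `[0, r]%classic 1.
apply: withinM; last exact: within_cst.
by apply: withinD; apply: withinM => //; apply: withinD.
Qed.

Lemma sqdist_gronwall K s t : 0 <= s -> s <= t -> t <= r ->
  (forall x, s < x < t -> 2 * `|mult_re x| <= K) ->
  sqdist s * expR (- (K * (L t - L s))) <= sqdist t <= sqdist s * expR (K * (L t - L s)).
Proof.
move=> s0 st tr HK; apply: (gronwall HD) => //; first exact: le_trans rT.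
  by apply: withinS sqdist_within; exact: subset_itvcc.
move=> x sxt; have /andP[sx xt] := sxt.
have xr : 0 < x < r by rewrite (le_lt_trans s0) ?(lt_le_trans xt).
exists (2 * mult_re x * sqdist x); first exact: sqdist_rate.
by rewrite normrM (ger0_norm (sqdist_ge0 x)) ler_wpM2r ?sqdist_ge0// normrM ger0_norm// HK.
Qed.

(** Uniqueness in both directions of time: Gronwall's inequality bounds the squared distance from
    above and from below, with a bound for the multiplier on the compact interval. *)
Lemma sqdist_eq0 s t : 0 <= s -> s <= t -> t <= r -> (sqdist s == 0) = (sqdist t == 0).
Proof.
move=> s0 st tr.
have [M HM] : exists M, forall x, s < x < t -> 2 * `|mult_re x| <= M.
  have c2 : {within `[0, r], continuous (fun x => 2 * `|mult_re x|)}.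
    apply: withinM; first exact: within_cst.
    by apply: (within_comp _ mult_re_within) => x _; exact: norm_continuous.
  have [c cr Hc] := EVT_max (le_trans s0 (le_trans st tr)) c2.
  exists (2 * `|mult_re c|) => x /andP[sx xt]; apply: Hc.
  by rewrite in_itv/= (le_trans s0 (ltW sx)) (le_trans (ltW xt)).
have /andP[h1 h2] := sqdist_gronwall s0 st tr HM.
apply/eqP/eqP => h.
  by apply/eqP; rewrite eq_le sqdist_ge0 andbT; move: h2; rewrite h mul0r.
move: h1; rewrite h pmulr_lle0 ?expR_gt0// => h1.
by apply/eqP; rewrite eq_le sqdist_ge0 andbT.
Qed.

(** Here E >= (1 - c)^2 / 4 by [sqr_sqmod_le], and (U^2 + V^2) E <= 4 by [poisson_sqr]. *)
Lemma poisson_norm_bound (c th x y : R) : c < 1 -> sqmod x y <= c ->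
  `|poisson x y th| <= 4 / (1 - c) /\ `|conjugate_poisson x y th| <= 4 / (1 - c).
Proof.
move=> c1 xc; have x1 : sqmod x y < 1 by exact: le_lt_trans c1.
have E0 := gap_gt0 th x1.
have k0 : 0 < 4 / (1 - c) by rewrite divr_gt0// subr_gt0.
suff h : poisson x y th ^+ 2 + conjugate_poisson x y th ^+ 2 <= (4 / (1 - c)) ^+ 2.
  split; rewrite -(@ler_pXn2r _ 2%N) ?nnegrE ?(ltW k0)// real_normK ?num_real//;
    apply: le_trans h; rewrite ?lerDl ?lerDr sqr_ge0//.
have := poisson_sqr E0; have := sqr_sqmod_le E0.
set p2 := poisson _ _ _ ^+ 2; set q2 := conjugate_poisson _ _ _ ^+ 2 => h1 h2.
have hN : 0 <= sqmod x y by exact: sqmod_ge0.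
have c0 : 0 < (1 - c) ^+ 2 by rewrite exprn_gt0// subr_gt0.
rewrite expr_div_n ler_pdivlMr//.
have h3 : (1 - c) ^+ 2 <= 4 * gap x y th.
  apply: (@le_trans _ _ ((1 - sqmod x y) ^+ 2)).
    by rewrite lerXn2r ?nnegrE ?subr_ge0 ?(ltW c1) ?(ltW x1)// lerD2l lerN2.
  by apply: le_trans h1 _; rewrite ler_wpM2r ?(ltW E0)//; lra.
have p0 : 0 <= p2 + q2 by rewrite addr_ge0 ?sqr_ge0.
have h4 := ler_wpM2l p0 h3.
apply: le_trans h4 _.
have : (p2 + q2) * gap x y th <= 4 by have := ltW E0; lra.
by rewrite expr2; lra.
Qed.

Definition lipschitz_rate (c : R) := 2 * (2 + (1 + 4 / (1 - c)) ^+ 2).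

(** Backward in time the moduli decrease, so the bound c at time t holds on all of [s, t] and bounds
    the multiplier there by a constant that depends on c only. *)
Lemma sqdist_backward c s t : c < 1 -> 0 <= s -> s <= t -> t <= r ->
  N t <= c -> N' t <= c ->
  sqdist s <= sqdist t * expR (lipschitz_rate c * (L t - L s)).
Proof.
move=> c1 s0 st tr Nc Nc'.
have HK x : s < x < t -> 2 * `|mult_re x| <= lipschitz_rate c.
  move=> /andP[sx xt]; have x0 := le_trans s0 (ltW sx).
  have [u1 v1] := poisson_norm_bound (theta x) c1
    (le_trans (flow_sqmod_nondecreasing HD rT Hf x0 (ltW xt) tr) Nc).
  have [u2 v2] := poisson_norm_bound (theta x) c1
    (le_trans (flow_sqmod_nondecreasing HD rT Hf' x0 (ltW xt) tr) Nc').
  rewrite -/(U x) -/(U' x) -/(V x) -/(V' x) in u1 v1 u2 v2.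
  rewrite /lipschitz_rate; move: u1 v1 u2 v2; set k := 4 / (1 - c) => u1 v1 u2 v2.
  have k0 : 0 <= k by apply: le_trans u1.
  rewrite ler_wpM2l// /mult_re.
  have w1 : `|(1 + U x) * (1 + U' x)| <= (1 + k) * (1 + k).
    by rewrite normrM ler_pM// (le_trans (ler_normD _ _))// normr1 lerD2l.
  have w2 : `|V x * V' x| <= k * k by rewrite normrM ler_pM.
  apply: le_trans (ler_normD _ _) _; rewrite normrN1 normrM (ger0_norm (_ : 0 <= 2^-1)) ?invr_ge0//.
  have := ler_normB ((1 + U x) * (1 + U' x)) (V x * V' x); rewrite expr2.
  have : 0 <= k * k by rewrite mulr_ge0.
  lra.
have /andP[h1 h2] := sqdist_gronwall s0 st tr HK.
by move: h1; rewrite expRN ler_pdivrMr ?expR_gt0.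
Qed.

Context (N0 : 0 < N 0) (N0' : 0 < N' 0).

(* Adding half the two angle functionals makes the rate at least V^2 / 2 + V'^2 / 2, which
   absorbs the driving term. *)
Lemma log_sqdist_le s t : 0 <= s -> s <= t -> t <= r -> 0 < sqdist t ->
  ln (sqdist s) + 2^-1 * (angle theta a b s + angle theta a' b' s) <=
  ln (sqdist t) + 2^-1 * (angle theta a b t + angle theta a' b' t) + 4^-1 * (n t - n s).
Proof.
move=> s0 st tr G0; have tT := le_trans tr rT.
have Gpos x : 0 <= x -> x <= t -> 0 < sqdist x.
  move=> x0 xt; rewrite lt_neqAle sqdist_ge0 andbT eq_sym (sqdist_eq0 x0 xt tr).
  by rewrite gt_eqF.
have := @rate_energy_le _ T L theta n HD (fun x => ln (sqdist x) +
  2^-1 * (angle theta a b x + angle theta a' b' x)) s t 1 s0 st tT ler01.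
rewrite div1r; apply.
  apply: withinD.
    apply: (within_ln (f := sqdist)).
      by move=> x /=; rewrite in_itv/= => /andP[sx xt]; rewrite Gpos// (le_trans s0).
    by apply: withinS sqdist_within; exact: subset_itvcc.
  apply: withinM; first exact: within_cst.
  by apply: withinD; [apply: withinS (angle_within HD rT Hf N0)|
    apply: withinS (angle_within HD rT Hf' N0')]; exact: subset_itvcc.
move=> x /andP[sx xt]; have x0 := le_lt_trans s0 sx.
have xr : 0 < x < r by rewrite x0 (lt_le_trans xt).
have xT : 0 < x < T by rewrite x0 (lt_le_trans xt).
have Gx := Gpos x (ltW x0) (ltW xt).
have xr' : x <= r by rewrite (le_trans (ltW xt)).
have U0 := flow_poisson_gt0 HD rT Hf (ltW x0) xr'.
have U0' := flow_poisson_gt0 HD rT Hf' (ltW x0) xr'.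
exists (2 * mult_re x + 2^-1 * (1 + 2 * V x ^+ 2 + (1 + 2 * V' x ^+ 2))),
  (2^-1 * (- V x + - V' x)); split.
- apply: rate_eq (rateD (rate_ln HD xT Gx (sqdist_rate xr))
    (rateZ 2^-1 (rateD (angle_rate HD rT Hf N0 xr) (angle_rate HD rT Hf' N0' xr)))).
    by rewrite mulfK// gt_eqF.
  by rewrite mul0r add0r.
- rewrite /mult_re; have := mulr_gt0 U0 U0'; have := sqr_ge0 (V x - V' x).
  have := sqr_ge0 (V x); have := sqr_ge0 (V' x).
  rewrite !expr2; lra.
- rewrite /mult_re; have := mulr_gt0 U0 U0'; have := sqr_ge0 (V x - V' x).
  have := sqr_ge0 (V x + V' x); have := sqr_ge0 (V x); have := sqr_ge0 (V' x).
  rewrite !expr2; lra.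
Qed.

Lemma sqdist_gap_le t : sqdist t <= 2 * (E t + E' t).
Proof.
rewrite /sqdist /fgap /gap /sqmod.
have := sqr_ge0 ((cos (theta t) - a t) + (cos (theta t) - a' t)).
have := sqr_ge0 ((sin (theta t) - b t) + (sin (theta t) - b' t)).
by rewrite !expr2; lra.
Qed.

End two_flows.

(** * Swallowed trajectories *)

Lemma within_left_approx (R : realType) (T : R) (f : R -> R) s x e :
  0 <= x -> x < s -> s <= T -> 0 < e ->
  {within `[0, T], continuous f} -> exists r, [/\ x <= r, r < s & `|f s - f r| < e].
Proof.
move=> x0 xs sT e0 cf.
have cf' : {within `[x, s], continuous f} by apply: withinS cf; exact: subset_itvcc.
have [_ _ /cvgrPdist_lt/(_ _ e0) H] := (continuous_within_itvP _ xs).1 cf'.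
near s^'- => r; exists r; split => //.
  by near: r; exact: nbhs_left_ge.
by near: r; exact: H.
Unshelve. all: by end_near. Qed.

Section swallowed.
Context (R : realType) (T : R) (L theta n : R -> R) (HD : driven T L theta n).
Implicit Types (a b : R -> R) (r s t : R).
Local Notation fgap := (fgap theta).
Local Notation angle := (angle theta).

Record swallowed s a b : Prop := Swallowed {
  swallowed_gt0 : 0 < s;
  swallowed_leT : s <= T;
  swallowed_flow : forall r, 0 <= r -> r < s -> disc_flow L theta r a b;
  swallowed_inf : forall e, 0 < e -> exists t, [/\ 0 <= t, t < s & fgap a b t < e] }.

Lemma clock_le s t : 0 <= s -> s <= t -> t <= T -> L s <= L t.
Proof.
move=> s0; rewrite le_eqVlt => /predU1P[->//|st tT]; apply/ltW.
exact: (driven_clock_increasing HD).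
Qed.

Lemma zero_flow r : disc_flow L theta r (fun=> 0) (fun=> 0).
Proof.
have E1 t : fgap (fun=> 0) (fun=> 0) t = 1 by rewrite /fgap /gap !subr0 cos2Dsin2.
split; try exact: within_cst.
- by move=> t _; rewrite E1.
- by move=> t _; rewrite !mul0r subr0; exact: rate_cst.
- by move=> t _; rewrite !mul0r addr0; exact: rate_cst.
- by rewrite /fsqmod /sqmod expr0n addr0.
Qed.

Lemma swallowed_late s a b r e : swallowed s a b -> 0 <= r -> r < s -> 0 < e ->
  exists t, [/\ r < t, t < s & fgap a b t < e].
Proof.
move=> [s0 sT Hf Hinf] r0 rs e0.
have rT : r <= T by exact: le_trans (ltW rs) sT.
have [e1 e10 He1] := flow_gap_bound HD rT (Hf r r0 rs) r0.
have [|t [t0 ts]] := Hinf (Num.min e e1); first by rewrite lt_min e0.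
rewrite lt_min => /andP[te te1]; exists t; split => //.
by rewrite ltNge; apply/negP => tr; have := He1 t; rewrite t0 tr leNgt te1 => /(_ isT).
Qed.

(** The point 0 rests and keeps gap 1, so by uniqueness a swallowed trajectory does not start there.
    This licenses the logarithms of N. *)
Lemma swallowed_sqmod_gt0 s a b : swallowed s a b -> 0 < fsqmod a b 0.
Proof.
move=> Hs; have [s0 sT Hf Hinf] := Hs.
rewrite lt_neqAle sqmod_ge0 andbT eq_sym; apply/negP => /eqP N0.
have [t [t0 ts Et]] := Hinf 1 ltr01.
have tT : t <= T by exact: le_trans (ltW ts) sT.
have := sqdist_eq0 HD tT (Hf t t0 ts) (zero_flow t) (lexx 0) t0 (lexx t).
rewrite /sqdist !subr0 -/(fsqmod a b 0) N0 eqxx => /esym /eqP.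
rewrite /sqmod => /eqP; rewrite paddr_eq0 ?sqr_ge0// !sqrf_eq0 => /andP[/eqP at0 /eqP bt0].
by move: Et; rewrite /fgap /gap at0 bt0 !subr0 cos2Dsin2 ltxx.
Qed.

Definition angle_bound := 4^-1 * (n T - n 0).

Lemma energy_le_bound s t : 0 <= s -> s <= t -> t <= T -> 4^-1 * (n t - n s) <= angle_bound.
Proof.
move=> s0 st tT; rewrite ler_wpM2l// lerB//; apply: (driven_energy_nondecreasing HD) => //.
  exact: le_trans st.
exact: le_trans tT.
Qed.

(** If the angle exceeded the total energy cost at r, it would stay nonnegative up to time s, since
    it loses at most that cost. Then [log_gap_bound] would keep the gap away from 0 on [r, s[,
    against [swallowed_late]. *)
Lemma swallowed_angle s a b r : swallowed s a b -> 0 <= r -> r < s ->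
  angle a b r <= angle_bound.
Proof.
move=> Hs r0 rs; have [s0 sT Hf Hinf] := Hs; have N0 := swallowed_sqmod_gt0 Hs.
rewrite leNgt; apply/negP => Ar.
have rT : r <= T by exact: le_trans (ltW rs) sT.
have Apos t : r <= t -> t < s -> 0 <= angle a b t.
  move=> rt ts; have t0 := le_trans r0 rt; have tT := le_trans (ltW ts) sT.
  have := angle_le HD tT (Hf t t0 ts) N0 r0 rt (lexx t).
  by have := energy_le_bound r0 rt tT; lra.
(* The lower bound for ln (fgap a b t) that [log_gap_bound] yields: 2 [angle_bound] is (n T - n 0) /
   2, and the terms in N help because N is nondecreasing. *)
pose C := ln (fgap a b r) - 2^-1 * (L T - L 0) - 2 * angle_bound.
have [t [rt ts Et]] := swallowed_late Hs r0 rs (expR_gt0 C).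
have t0 := le_trans r0 (ltW rt); have tT := le_trans (ltW ts) sT.
have Ht := Hf t t0 ts.
have Aall x : r <= x <= t -> 0 <= angle a b x.
  by move=> /andP[rx xt]; apply: Apos => //; exact: le_lt_trans ts.
have h := log_gap_bound HD tT Ht N0 r0 (ltW rt) (lexx t) Aall.
have E0 : 0 < fgap a b t by apply: (flow_gap Ht); rewrite t0 lexx.
have : ln (fgap a b t) < C by rewrite -ltr_expR lnK.
have : ln (fsqmod a b r) <= ln (fsqmod a b t).
  rewrite ler_ln ?posrE; first exact: (flow_sqmod_nondecreasing HD tT Ht r0 (ltW rt)).
    exact: (flow_sqmod_gt0 HD tT Ht N0 r0 (ltW rt)).
  exact: (flow_sqmod_gt0 HD tT Ht N0 t0).
have := energy_le_bound r0 (ltW rt) tT.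
have := clock_le (lexx 0) r0 rT; have := clock_le t0 tT (lexx T).
rewrite /C; lra.
Qed.

(** After r there are times at which the gap is as small as desired; there N is close to 1 and
    [log_size] close to ln 4. From such a time [log_size_le] leads back to r. *)
Lemma swallowed_size s a b r : swallowed s a b -> 0 <= r -> r < s ->
  log_size a b r <= ln 4 + 4 * (L s - L r).
Proof.
move=> Hs r0 rs; have [s0 sT Hf Hinf] := Hs; have N0 := swallowed_sqmod_gt0 Hs.
apply/ler_addgt0Pr => e e0.
have eN : 0 < fsqmod a b 0 * e by rewrite mulr_gt0.
have [t [rt ts Et]] := swallowed_late Hs r0 rs eN.
have t0 := le_trans r0 (ltW rt); have tT := le_trans (ltW ts) sT.
have Ht := Hf t t0 ts.
have E0 : 0 < fgap a b t by apply: (flow_gap Ht); rewrite t0 lexx.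
have Nt := flow_sqmod_gt0 HD tT Ht N0 t0 (lexx t).
have N1 := flow_sqmod_lt1 HD tT Ht t0 (lexx t).
have h1 := log_size_le HD tT Ht N0 r0 (ltW rt) (lexx t).
have h2 := clock_le t0 (ltW ts) sT.
suff : log_size a b t <= ln 4 + e by lra.
have Nm : fsqmod a b 0 <= fsqmod a b t.
  exact: (flow_sqmod_nondecreasing HD tT Ht (lexx 0) t0 (lexx t)).
have N1' : 0 < 1 + fsqmod a b t by rewrite ltr_wpDl.
rewrite /log_size mulr_natl -lnXn// -ln_div ?posrE ?exprn_gt0//.
rewrite -ler_expR expRD !lnK ?posrE ?divr_gt0 ?exprn_gt0//.
rewrite ler_pdivrMr//.
apply: (@le_trans _ _ (4 * (1 + e) * fsqmod a b t)); last first.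
  by rewrite ler_wpM2r ?(ltW Nt)// ler_wpM2l// expR_ge1Dx.
have := sqr_sqmod_le E0; rewrite -/(fsqmod a b t) -/(fgap a b t) => h3.
have h4 : 2 * (1 + fsqmod a b t) * fgap a b t <= 4 * (fsqmod a b t * e).
  apply: ler_pM; rewrite ?(ltW E0) ?mulr_ge0 ?(ltW N1')//; first by lra.
  by apply: le_trans (ltW Et) _; rewrite ler_wpM2r ?(ltW e0).
by rewrite !expr2 in h3 *; lra.
Qed.

Definition tip_modulus (l : R) := 4 * expR angle_bound * (expR (4 * l) - 1).

(** The bound on the angle gives E N <= exp K (1 - N)^2, as N <= 1, and the bound on the size gives
    (1 - N)^2 <= 4 (exp (4 l) - 1) N. The factor N cancels. *)
Lemma gap_le_of_angle a b t K l : 0 < fgap a b t -> 0 < fsqmod a b t -> fsqmod a b t < 1 ->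
  angle a b t <= K -> log_size a b t <= ln 4 + 4 * l ->
  fgap a b t <= 4 * expR K * (expR (4 * l) - 1).
Proof.
move=> E0 N0 N1 hA hS.
have q0 : 0 < 1 - fsqmod a b t by rewrite subr_gt0.
have N1' : 0 < 1 + fsqmod a b t by rewrite ltr_wpDl// ltW.
have hS' : (1 + fsqmod a b t) ^+ 2 <= 4 * expR (4 * l) * fsqmod a b t.
  move: hS; rewrite /log_size mulr_natl -lnXn// -ln_div ?posrE ?exprn_gt0//.
  by rewrite -ler_expR expRD !lnK ?posrE ?divr_gt0 ?exprn_gt0// ler_pdivrMr.
have lnN : ln (fsqmod a b t) <= 0 by rewrite ln_le0// ltW.
have hA' : fgap a b t * fsqmod a b t <= expR K * (1 - fsqmod a b t) ^+ 2.
  rewrite -ler_ln ?posrE ?mulr_gt0 ?exprn_gt0 ?expR_gt0//.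
  rewrite (lnM E0 N0) lnM ?posrE ?expR_gt0 ?exprn_gt0// expRK lnXn// -(mulr_natl (ln _)).
  by move: hA; rewrite /angle; lra.
have h3 : (1 - fsqmod a b t) ^+ 2 <= 4 * (expR (4 * l) - 1) * fsqmod a b t.
  by move: hS'; rewrite !expr2; lra.
rewrite -(ler_pM2r N0); apply: le_trans hA' _.
rewrite (_ : _ * _ * _ * _ = expR K * (4 * (expR (4 * l) - 1) * fsqmod a b t)); last by ring.
by rewrite ler_wpM2l ?expR_ge0.
Qed.

Lemma swallowed_gap s a b r : swallowed s a b -> 0 <= r -> r < s ->
  fgap a b r <= tip_modulus (L s - L r).
Proof.
move=> Hs r0 rs; have [s0 sT Hf Hinf] := Hs; have N0 := swallowed_sqmod_gt0 Hs.
have rT : r <= T by exact: le_trans (ltW rs) sT.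
apply: gap_le_of_angle.
- by apply: (flow_gap (Hf r r0 rs)); rewrite r0 lexx.
- exact: (flow_sqmod_gt0 HD rT (Hf r r0 rs) N0 r0).
- exact: (flow_sqmod_lt1 HD rT (Hf r r0 rs) r0).
- exact: swallowed_angle rs.
- exact: swallowed_size.
Qed.

(** The costs in [log_sqdist_le]: one [angle_bound] for the mean of the angles at the later time,
    one for the energy, and ln 4 + S / 2 from [angle_ge] at the earlier time. *)
Definition comparison_exponent (S : R) := 2 * angle_bound + ln 4 + 2^-1 * S.

Definition start_size := ln 4 + 4 * (L T - L 0).

Lemma sqdist_le s r a b a' b' S : 0 <= s -> s <= r -> r <= T ->
  disc_flow L theta r a b -> disc_flow L theta r a' b' ->
  0 < fsqmod a b 0 -> 0 < fsqmod a' b' 0 ->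
  angle a b r <= angle_bound -> angle a' b' r <= angle_bound ->
  log_size a b s <= S -> log_size a' b' s <= S ->
  sqdist a b a' b' s <= expR (comparison_exponent S) * sqdist a b a' b' r.
Proof.
move=> s0 sr rT Hf Hf' N0 N0' A1 A2 S1 S2.
have := sqdist_ge0 a b a' b' r; rewrite le_eqVlt => /predU1P[G0|Gr].
  suff : sqdist a b a' b' s == 0 by move=> /eqP ->; rewrite -G0 mulr0.
  by rewrite (sqdist_eq0 HD rT Hf Hf' s0 sr (lexx r)) -G0.
have h := log_sqdist_le HD rT Hf Hf' N0 N0' s0 sr (lexx r) Gr.
have Gs : 0 < sqdist a b a' b' s.
  rewrite lt_neqAle sqdist_ge0 andbT eq_sym.
  by rewrite (sqdist_eq0 HD rT Hf Hf' s0 sr (lexx r)) gt_eqF.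
rewrite -ler_ln ?posrE ?mulr_gt0 ?expR_gt0// lnM ?posrE ?expR_gt0// expRK.
have := angle_ge HD rT Hf N0 s0 sr; have := angle_ge HD rT Hf' N0' s0 sr.
have := energy_le_bound s0 sr rT.
by move: h; rewrite /comparison_exponent; lra.
Qed.

Lemma swallowed_size0 s a b : swallowed s a b -> log_size a b 0 <= start_size.
Proof.
move=> Hs; have [s0 sT _ _] := Hs; apply: le_trans (swallowed_size Hs (lexx 0) s0) _.
by rewrite lerD2l ler_wpM2l// lerB// clock_le// ltW.
Qed.

(* Both uniqueness of the point swallowed at a given time and continuity of the tip in time. *)
Lemma swallowed_dist s s' a b a' b' : swallowed s a b -> swallowed s' a' b' -> s <= s' ->
  sqdist a b a' b' 0 <= expR (comparison_exponent start_size) * (2 * tip_modulus (L s' - L s)).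
Proof.
move=> Hs Hs' ss'; have [s0 sT Hf _] := Hs; have [_ s'T Hf' _] := Hs'.
(* The bound obtained at a time r < s, where both trajectories are still defined; as r increases to
   s its first summand vanishes. *)
pose f r := expR (comparison_exponent start_size) * (2 * (tip_modulus (L s - L r) + tip_modulus (L s' - L r))).
have cL : {within `[0, T], continuous L} := driven_clock_continuous HD.
have cf : {within `[0, T], continuous f}.
  have ct l : {within `[0, T], continuous (fun r => tip_modulus (L l - L r))}.
    apply: withinM; first exact: within_cst.
    apply: withinB; last exact: within_cst.
    apply: (within_expR (f := fun r => 4 * (L l - L r))).
    by apply: withinM; [exact: within_cst|apply: withinB => //; exact: within_cst].
  apply: withinM; first exact: within_cst.
  by apply: withinM; [exact: within_cst|exact: withinD].
have fs : f s = expR (comparison_exponent start_size) * (2 * tip_modulus (L s' - L s)).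
  by rewrite /f [in X in _ * (2 * (X + _))]/tip_modulus subrr mulr0 expR0 subrr mulr0 add0r.
rewrite -fs; apply/ler_addgt0Pr => e e0.
have [r [r0 rs fr]] := within_left_approx (lexx 0) s0 sT e0 cf.
have rT : r <= T by exact: le_trans (ltW rs) sT.
have rs' := lt_le_trans rs ss'.
have h := sqdist_le (lexx 0) r0 rT (Hf r r0 rs) (Hf' r r0 rs') (swallowed_sqmod_gt0 Hs)
  (swallowed_sqmod_gt0 Hs') (swallowed_angle Hs r0 rs) (swallowed_angle Hs' r0 rs')
  (swallowed_size0 Hs) (swallowed_size0 Hs').
apply: le_trans h _; apply: (@le_trans _ _ (f r)); last first.
  by move: fr; rewrite ltr_norml => /andP[]; lra.
rewrite /f ler_wpM2l ?expR_ge0//; apply: le_trans (sqdist_gap_le _ _ _ _ _ _) _.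
rewrite ler_wpM2l//; apply: lerD; [exact: (swallowed_gap Hs)|exact: (swallowed_gap Hs')].
Qed.

End swallowed.

(** * Flow lines with a prescribed endpoint *)

Section geometric_sequences.
Context (R : realType).

Lemma half_pow_small (B e : R) : 0 < e -> exists k : nat, B * 2^-1 ^+ k < e.
Proof.
move=> e0; have B1 : 0 < `|B| + 1 by rewrite ltr_wpDl.
have h : `|2^-1 : R| < 1 by rewrite ger0_norm ?invr_ge0//; lra.
have /cvgrPdist_lt/(_ _ (divr_gt0 e0 B1))[k _ Hk] := cvg_expr h.
exists k; have := Hk k (leqnn k); rewrite /= sub0r normrN ger0_norm ?exprn_ge0 ?invr_ge0// => hk.
apply: (@le_lt_trans _ _ ((`|B| + 1) * 2^-1 ^+ k)).
  rewrite ler_wpM2r ?exprn_ge0 ?invr_ge0//.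
  by apply: le_trans (ler_norm _) _; rewrite lerDl.
by rewrite mulrC -ltr_pdivlMr.
Qed.

(** The intervals of radius 2 B 2^-k around u k are nested, since the radius drops by B 2^-k at each
    step. *)
Lemma geometric_limit (u : nat -> R) B : (forall k, `|u k.+1 - u k| <= B * 2^-1 ^+ k) ->
  exists l, forall k, `|u k - l| <= 2 * B * 2^-1 ^+ k.
Proof.
move=> Hu.
have B0 : 0 <= B by have := Hu 0%N; rewrite expr0 mulr1; exact: le_trans.
have e0 k : 0 <= B * 2^-1 ^+ k :> R by rewrite mulr_ge0// exprn_ge0// invr_ge0.
have eS k : 2 * B * 2^-1 ^+ k = 2 * B * 2^-1 ^+ k.+1 + B * 2^-1 ^+ k :> R.
  by rewrite exprS; field.
have lo k j : u k - 2 * B * 2^-1 ^+ k <= u (k + j)%N - 2 * B * 2^-1 ^+ (k + j).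
  elim: j => [|j IH]; first by rewrite addn0.
  apply: le_trans IH _; rewrite addnS eS.
  by have := Hu (k + j)%N; rewrite ler_norml => /andP[]; lra.
have hi k j : u (k + j)%N + 2 * B * 2^-1 ^+ (k + j) <= u k + 2 * B * 2^-1 ^+ k.
  elim: j => [|j IH]; first by rewrite addn0.
  apply: le_trans IH; rewrite addnS [in leRHS]eS.
  by have := Hu (k + j)%N; rewrite ler_norml => /andP[]; lra.
have lohi k j : u k - 2 * B * 2^-1 ^+ k <= u j + 2 * B * 2^-1 ^+ j.
  apply: le_trans (lo k j) _; apply: le_trans (hi j k); rewrite addnC.
  by have := e0 (j + k)%N; lra.
pose A := [set u k - 2 * B * 2^-1 ^+ k | k in setT].
have Aub j : ubound A (u j + 2 * B * 2^-1 ^+ j) by move=> _ [k _ <-].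
exists (sup A) => k; rewrite ler_norml; apply/andP; split.
  have : sup A <= u k + 2 * B * 2^-1 ^+ k.
    by apply: ge_sup => //; exists (u 0%N - 2 * B * 2^-1 ^+ 0); exists 0%N.
  lra.
have : u k - 2 * B * 2^-1 ^+ k <= sup A.
  by apply: ub_le_sup; [exists (u 0%N + 2 * B * 2^-1 ^+ 0)|exists k].
lra.
Qed.

Lemma within_uniform_limit (A : set R) (F : nat -> R -> R) (G : R -> R) B :
  (forall k, {within A, continuous (F k)}) ->
  (forall k x, A x -> `|F k x - G x| <= B * 2^-1 ^+ k) ->
  {within A, continuous G}.
Proof.
move=> cF FG; apply/subspace_continuousP => x Ax; apply/cvgrPdist_lt => e e0.
have e30 : 0 < e / 3 by rewrite divr_gt0.
have [k hk] := half_pow_small B e30.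
have /subspace_continuousP/(_ x Ax)/cvgrPdist_lt/(_ _ e30) H := cF k.
have HA : \forall y \near within A (nbhs x), A y by exact: withinT.
near=> y.
have Ay : A y by near: y.
have h1 : `|F k x - F k y| < e / 3 by near: y.
have h2 := FG k x Ax; have h3 := FG k y Ay.
rewrite (_ : G x - G y = (F k x - F k y) + ((F k y - G y) - (F k x - G x))); last by ring.
apply: le_lt_trans (ler_normD _ _) _.
have := ler_normB (F k y - G y) (F k x - G x); lra.
Unshelve. all: by end_near. Qed.

Lemma within_bounded (f : R -> R) (a b : R) : a <= b -> {within `[a, b], continuous f} ->
  exists M, forall x, a <= x <= b -> `|f x| <= M.
Proof.
move=> ab cf; have cf' : {within `[a, b], continuous (fun x => `|f x|)}.
  by apply: (within_comp _ cf) => x _; exact: norm_continuous.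
have [c cab Hc] := EVT_max ab cf'.
by exists `|f c| => x xab; apply: Hc; rewrite in_itv.
Qed.

Lemma expRN_lipschitz (x y : R) : 0 <= x -> 0 <= y -> `|expR (- x) - expR (- y)| <= `|x - y|.
Proof.
move=> x0 y0; wlog xy : x y x0 y0 / x <= y.
  by move=> H; have [/H|/ltW/H] := leP x y; [|rewrite distrC (distrC x)]; apply.
rewrite ger0_norm ?subr_ge0 ?ler_expR ?lerN2// distrC ger0_norm ?subr_ge0//.
have -> : - y = - x - (y - x) by ring.
rewrite expRB; have ey : 1 - (y - x) <= (expR (y - x))^-1.
  by rewrite -expRN; have := expR_ge1Dx (- (y - x)); rewrite addrC addrC.
have e0 := expR_gt0 (- x).
have e1 : expR (- x) <= 1 by rewrite -expR0 ler_expR oppr_le0.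
rewrite -{1}(mulr1 (expR (- x))) -mulrBr.
apply: (@le_trans _ _ (expR (- x) * (y - x))).
  by rewrite ler_wpM2l ?(ltW e0)//; lra.
by rewrite ler_piMl ?subr_ge0.
Qed.

Lemma lipschitz_of_derivative (f df : R -> R) : (forall x : R, is_derive x 1 f (df x)) ->
  (forall x, `|df x| <= 1) -> forall x y, `|f x - f y| <= `|x - y|.
Proof.
move=> df1 dfb x y; wlog xy : x y / x <= y.
  by move=> H; have [/H //|/ltW/H] := leP x y; rewrite distrC (distrC y).
have cf : {within `[x, y], continuous f}.
  by apply: derivable_within_continuous => z _; have [] := df1 z.
have [c _] := @MVT_segment _ f df x y xy (fun z _ => df1 z) cf.
rewrite distrC (distrC x) => ->; rewrite normrM ler_piMl//.
Qed.

Lemma cos_lipschitz (x y : R) : `|cos x - cos y| <= `|x - y|.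
Proof.
apply: (@lipschitz_of_derivative (@cos R) (fun z => - sin z)) => z.
by rewrite normrN ler_norml sin_geN1 sin_le1.
Qed.

Lemma sin_lipschitz (x y : R) : `|sin x - sin y| <= `|x - y|.
Proof.
apply: (@lipschitz_of_derivative (@sin R) (@cos R)) => z.
by rewrite ler_norml cos_geN1 cos_le1.
Qed.

End geometric_sequences.

Section poisson_lipschitz.
Context (R : realType).
Implicit Types (a b x y th c : R).

Definition poisson_lipschitz_constant c : R := (1 + 4 / (1 - c)) ^+ 2 + (4 / (1 - c)) ^+ 2 + 1.

(** From x = w (P - 1) / (P + 1) follows w (P - P') = (x - x') (1 + P) (1 + P') / 2; [e1] and [e2]
    are its real and imaginary parts, and the last factor is bounded by [poisson_norm_bound]. *)
Lemma poisson_diff_sqr c th x y x' y' : c < 1 -> sqmod x y <= c -> sqmod x' y' <= c ->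
  (poisson x y th - poisson x' y' th) ^+ 2 +
    (conjugate_poisson x y th - conjugate_poisson x' y' th) ^+ 2 <=
  sqmod (x - x') (y - y') * (2 * poisson_lipschitz_constant c ^+ 2).
Proof.
move=> c1 xc xc'.
have E0 := gap_gt0 th (le_lt_trans xc c1); have E0' := gap_gt0 th (le_lt_trans xc' c1).
have [u1 v1] := poisson_norm_bound th c1 xc; have [u2 v2] := poisson_norm_bound th c1 xc'.
have [h1 h2] := poisson_relation E0; have [h3 h4] := poisson_relation E0'.
have := cos2Dsin2 th; rewrite /poisson_lipschitz_constant; move: u1 v1 u2 v2 h1 h2 h3 h4.
set k := 4 / (1 - c); move: (poisson x y th) (conjugate_poisson x y th) (poisson x' y' th)
  (conjugate_poisson x' y' th) (cos th) (sin th) => u v u' v' C S u1 v1 u2 v2 h1 h2 h3 h4 cs.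
pose m1 := ((1 + u) * (1 + u') - v * v') / 2; pose m2 := ((1 + u) * v' + v * (1 + u')) / 2.
have k0 : 0 <= k by apply: le_trans u1.
have e1 : C * (u - u') - S * (v - v') = (x - x') * m1 - (y - y') * m2.
  have k1 : (x * (1 + u) - y * v) * (1 + u') = (C * (u - 1) - S * v) * (1 + u') by rewrite h1.
  have k2 : (y * (1 + u) + x * v) * v' = (S * (u - 1) + C * v) * v' by rewrite h2.
  have k3 : (x' * (1 + u') - y' * v') * (1 + u) = (C * (u' - 1) - S * v') * (1 + u) by rewrite h3.
  have k4 : (y' * (1 + u') + x' * v') * v = (S * (u' - 1) + C * v') * v by rewrite h4.
  by rewrite /m1 /m2; lra.
have e2 : S * (u - u') + C * (v - v') = (x - x') * m2 + (y - y') * m1.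
  have k1 : (x * (1 + u) - y * v) * v' = (C * (u - 1) - S * v) * v' by rewrite h1.
  have k2 : (y * (1 + u) + x * v) * (1 + u') = (S * (u - 1) + C * v) * (1 + u') by rewrite h2.
  have k3 : (x' * (1 + u') - y' * v') * v = (C * (u' - 1) - S * v') * v by rewrite h3.
  have k4 : (y' * (1 + u') + x' * v') * (1 + u) = (S * (u' - 1) + C * v') * (1 + u) by rewrite h4.
  by rewrite /m1 /m2; lra.
have -> : (u - u') ^+ 2 + (v - v') ^+ 2 = sqmod (x - x') (y - y') * (m1 ^+ 2 + m2 ^+ 2).
  rewrite (_ : (u - u') ^+ 2 + _ = (C ^+ 2 + S ^+ 2) * ((u - u') ^+ 2 + (v - v') ^+ 2)); last first.
    by rewrite cs mul1r.
  rewrite (_ : _ * _ = (C * (u - u') - S * (v - v')) ^+ 2 + (S * (u - u') + C * (v - v')) ^+ 2); last by ring.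
  by rewrite e1 e2 /sqmod; ring.
rewrite ler_wpM2l ?sqmod_ge0//.
have n1 : `|1 + u| <= 1 + k by rewrite (le_trans (ler_normD _ _))// normr1 lerD2l.
have n2 : `|1 + u'| <= 1 + k by rewrite (le_trans (ler_normD _ _))// normr1 lerD2l.
set K := _ + _ + 1.
have K0 : 0 <= K by rewrite /K !addr_ge0 ?sqr_ge0.
have hm m : `|m| <= K -> m ^+ 2 <= K ^+ 2.
  by move=> mK; rewrite -(real_normK (num_real m)) lerXn2r ?nnegrE.
rewrite mulr_natl mulr2n lerD// hm//.
  rewrite /m1 normrM (ger0_norm (_ : 0 <= 2^-1)) ?invr_ge0//.
  have := ler_normB ((1 + u) * (1 + u')) (v * v').
  have w1 : `|(1 + u) * (1 + u')| <= (1 + k) * (1 + k) by rewrite normrM ler_pM.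
  have w2 : `|v * v'| <= k * k by rewrite normrM ler_pM.
  by have := mulr_ge0 k0 k0; rewrite /K !expr2; lra.
rewrite /m2 normrM (ger0_norm (_ : 0 <= 2^-1)) ?invr_ge0//.
have := ler_normD ((1 + u) * v') (v * (1 + u')).
have w1 : `|(1 + u) * v'| <= (1 + k) * k by rewrite normrM ler_pM.
have w2 : `|v * (1 + u')| <= k * (1 + k) by rewrite normrM ler_pM.
by have := mulr_ge0 k0 k0; rewrite /K !expr2; lra.
Qed.

Lemma poisson_lipschitz c th x y x' y' : c < 1 -> sqmod x y <= c -> sqmod x' y' <= c ->
  `|poisson x y th - poisson x' y' th| <=
    2 * poisson_lipschitz_constant c * (`|x - x'| + `|y - y'|) /\
  `|conjugate_poisson x y th - conjugate_poisson x' y' th| <=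
    2 * poisson_lipschitz_constant c * (`|x - x'| + `|y - y'|).
Proof.
move=> c1 xc xc'; have := poisson_diff_sqr th c1 xc xc'.
set p := poisson _ _ _ - _; set q := conjugate_poisson _ _ _ - _.
set K := poisson_lipschitz_constant c.
have K0 : 0 <= K by rewrite /K /poisson_lipschitz_constant !addr_ge0 ?sqr_ge0.
set d := `|x - x'|; set d' := `|y - y'| => h.
have d0 : 0 <= d by exact: normr_ge0.
have d0' : 0 <= d' by exact: normr_ge0.
have r0 : 0 <= 2 * K * (d + d') by apply: mulr_ge0; [apply: mulr_ge0|apply: addr_ge0].
have h' : p ^+ 2 + q ^+ 2 <= (2 * K * (d + d')) ^+ 2.
  apply: le_trans h _; rewrite /sqmod -(real_normK (num_real (x - x'))) -(real_normK (num_real (y - y'))) -/d -/d'.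
  have q1 : 0 <= K ^+ 2 * (d * d') by rewrite !mulr_ge0.
  have q2 : 0 <= K ^+ 2 * (d ^+ 2) by rewrite !mulr_ge0 ?sqr_ge0.
  have q3 : 0 <= K ^+ 2 * (d' ^+ 2) by rewrite !mulr_ge0 ?sqr_ge0.
  by rewrite !expr2 in q1 q2 q3 *; lra.
by split; rewrite -(@ler_pXn2r _ 2%N) ?nnegrE// real_normK ?num_real//;
  apply: le_trans h'; rewrite ?lerDl ?lerDr sqr_ge0.
Qed.

End poisson_lipschitz.

(** * Picard iteration for the logarithm of a flow line *)

Section picard.
Context (R : realType) (T : R) (lam : R -> R) (hlam : weight_function T lam).
Context (hlam_inv : has_ubound (inv_weight_values T lam)) (T0 : 0 < T).
Context (theta n : R -> R) (HD : driven T (clock lam) theta n).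
Local Notation L := (clock lam).
Local Notation rate := (rate L theta).

Definition wint (F : R -> R) (t : R) : R := \int[lebesgue_measure]_(s in `[0, t]) (lam s * F s).

Lemma wint0 F : wint F 0 = 0.
Proof. by rewrite /wint set_itv1 Rintegral_set1. Qed.

Lemma wint_within F r : 0 <= r -> r <= T -> {within `[0, r], continuous F} ->
  {within `[0, r], continuous (wint F)}.
Proof. exact: weighted_integral_continuous. Qed.

Lemma wint_rate F r t : 0 < t < r -> r <= T -> {within `[0, r], continuous F} ->
  rate (wint F) t (F t) 0.
Proof. exact: weighted_integral_rate. Qed.

Lemma wint_dist F G r e t : 0 <= r -> r <= T ->
  {within `[0, r], continuous F} -> {within `[0, r], continuous G} ->
  (forall s, 0 <= s <= r -> `|F s - G s| <= e) -> 0 <= t -> t <= r ->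
  `|wint F t - wint G t| <= e * L t.
Proof.
move=> r0 rT cF cG FG t0 tr.
have sub : `[0, t]%classic `<=` `[0, r]%classic by exact: subset_itvcc.
have := @rate_dist _ T L theta n HD (fun s => wint F s - wint G s) (fun s => e * L s) 0 t
  (lexx 0) t0 (le_trans tr rT).
rewrite !wint0 subrr subr0 clock0 mulr0 subr0; apply.
- by apply: withinB; apply: withinS sub _; exact: wint_within.
- apply: withinM; first exact: within_cst.
  by apply: withinS (driven_clock_continuous HD); apply: subset_itvcc => //; exact: le_trans rT.
- move=> s /andP[s0 st]; have sr : 0 < s < r by rewrite s0 (lt_le_trans st).
  exists (F s - G s), (e * 1); split.
  + by apply: rate_eq (rateB (wint_rate sr rT cF) (wint_rate sr rT cG)) => //; rewrite subr0.
  + by apply: rate_eq (rateZ e (rate_clock L theta s)) => //; rewrite mulr0.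
  + by rewrite mulr1; apply: FG; case/andP: sr => /ltW -> /ltW.
Qed.

(* The point (z1 + i z2) exp (- (Q + i V)). *)
Definition exp_re (z1 z2 Q V : R) := expR (- Q) * (z1 * cos V + z2 * sin V).
Definition exp_im (z1 z2 Q V : R) := expR (- Q) * (z2 * cos V - z1 * sin V).

Section terminal.
Context (t z1 z2 : R) (t0 : 0 <= t) (tT : t <= T) (z_lt1 : sqmod z1 z2 < 1).
Local Notation c := (sqmod z1 z2).

Lemma exp_sqmod Q V : sqmod (exp_re z1 z2 Q V) (exp_im z1 z2 Q V) = expR (- Q) ^+ 2 * c.
Proof.
rewrite /sqmod /exp_re /exp_im.
rewrite (_ : _ + _ = expR (- Q) ^+ 2 * ((cos V ^+ 2 + sin V ^+ 2) * (z1 ^+ 2 + z2 ^+ 2))); last by ring.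
by rewrite cos2Dsin2 mul1r.
Qed.

Lemma exp_sqmod_le Q V : 0 <= Q -> sqmod (exp_re z1 z2 Q V) (exp_im z1 z2 Q V) <= c.
Proof.
move=> Q0; rewrite exp_sqmod ler_piMl ?sqmod_ge0// expr2.
by rewrite mulr_ile1 ?expR_ge0// -expR0 ler_expR oppr_le0.
Qed.

Lemma exp_lipschitz Q V Q' V' : 0 <= Q -> 0 <= Q' ->
  `|exp_re z1 z2 Q V - exp_re z1 z2 Q' V'| + `|exp_im z1 z2 Q V - exp_im z1 z2 Q' V'| <=
    6 * (`|Q - Q'| + `|V - V'|).
Proof.
move=> Q0 Q0'.
have bnd x : x ^+ 2 <= c -> `|x| <= 1.
  move=> xc; rewrite -(@ler_pXn2r _ 2%N) ?nnegrE// real_normK ?num_real// expr1n.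
  by rewrite (le_trans xc)// ltW.
have b1 : `|z1| <= 1 by apply: bnd; rewrite lerDl sqr_ge0.
have b2 : `|z2| <= 1 by apply: bnd; rewrite lerDr sqr_ge0.
have hQ := expRN_lipschitz Q0 Q0'.
have hc := cos_lipschitz V V'; have hs := sin_lipschitz V V'.
have e1 : `|expR (- Q')| <= 1 by rewrite ger0_norm ?expR_ge0// -expR0 ler_expR oppr_le0.
have c1 : `|cos V| <= 1 by rewrite ler_norml cos_geN1 cos_le1.
have s1 : `|sin V| <= 1 by rewrite ler_norml sin_geN1 sin_le1.
have prod (u v k : R) : `|u| <= 1 -> `|v| <= k -> `|u * v| <= k.
  move=> u1 vk; rewrite normrM; apply: le_trans vk.
  by rewrite ler_piMl.
have prod' (u v k : R) : `|u| <= 1 -> `|v| <= k -> `|v * u| <= k by rewrite mulrC; exact: prod.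
have aux (u v w x : R) : `|u| <= 1 -> `|v| <= 1 ->
    `|w| <= `|V - V'| -> `|x| <= `|V - V'| ->
    `|(expR (- Q) - expR (- Q')) * (u * cos V) + (expR (- Q) - expR (- Q')) * (v * sin V) +
      (expR (- Q') * (u * w) + expR (- Q') * (v * x))| <= 2 * `|Q - Q'| + 2 * `|V - V'|.
  move=> u1 v1 w1 x1.
  have q1 := prod' _ _ _ (prod _ _ _ u1 c1) hQ; have q2 := prod' _ _ _ (prod _ _ _ v1 s1) hQ.
  have q3 := prod _ _ _ e1 (prod _ _ _ u1 w1); have q4 := prod _ _ _ e1 (prod _ _ _ v1 x1).
  apply: le_trans (ler_normD _ _) _.
  have := ler_normD ((expR (- Q) - expR (- Q')) * (u * cos V)) ((expR (- Q) - expR (- Q')) * (v * sin V)).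
  have := ler_normD (expR (- Q') * (u * (w))) (expR (- Q') * (v * (x))).
  lra.
have n1 : `|- z1| <= 1 by rewrite normrN.
have h1 := aux z1 z2 _ _ b1 b2 hc hs.
have h2 := aux z2 (- z1) _ _ b2 n1 hc hs.
rewrite /exp_re /exp_im.
rewrite (_ : expR (- Q) * (z1 * cos V + _) - _ = (expR (- Q) - expR (- Q')) * (z1 * cos V) + (expR (- Q) - expR (- Q')) * (z2 * sin V) +
      (expR (- Q') * (z1 * (cos V - cos V')) + expR (- Q') * (z2 * (sin V - sin V')))); last by ring.
rewrite (_ : expR (- Q) * (z2 * cos V - _) - _ = (expR (- Q) - expR (- Q')) * (z2 * cos V) + (expR (- Q) - expR (- Q')) * (- z1 * sin V) +
      (expR (- Q') * (z2 * (cos V - cos V')) + expR (- Q') * (- z1 * (sin V - sin V')))); last by ring.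
by have := normr_ge0 (Q - Q'); have := normr_ge0 (V - V'); lra.
Qed.

Definition pU (Q V : R -> R) s := poisson (exp_re z1 z2 (Q s) (V s)) (exp_im z1 z2 (Q s) (V s)) (theta s).
Definition pV (Q V : R -> R) s := conjugate_poisson (exp_re z1 z2 (Q s) (V s)) (exp_im z1 z2 (Q s) (V s)) (theta s).

(** The condition Q >= 0 keeps the point exp (- (Q + i V)) z in the disc of radius |z|, where the
    Poisson terms are Lipschitz. A Picard step preserves it because U > 0. *)
Definition admissible (Q V : R -> R) := [/\ {within `[0, t], continuous Q},
  {within `[0, t], continuous V} & forall s, 0 <= s <= t -> 0 <= Q s].

Lemma exp_within Q V : admissible Q V ->
  {within `[0, t], continuous (fun s => exp_re z1 z2 (Q s) (V s))} /\
  {within `[0, t], continuous (fun s => exp_im z1 z2 (Q s) (V s))}.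
Proof.
move=> [cQ cV _].
have ce : {within `[0, t], continuous (fun s => expR (- Q s))}.
  by apply: (within_expR (f := fun s => - Q s)); exact: withinN.
have cc : {within `[0, t], continuous (fun s => cos (V s))}.
  by apply: (within_comp _ cV) => x _; exact: continuous_cos.
have cs : {within `[0, t], continuous (fun s => sin (V s))}.
  by apply: (within_comp _ cV) => x _; exact: continuous_sin.
split; apply: withinM => //.
  by apply: withinD; apply: withinM => //; exact: within_cst.
by apply: withinB; apply: withinM => //; exact: within_cst.
Qed.

Lemma exp_gap_gt0 Q V s : admissible Q V -> 0 <= s <= t ->
  0 < gap (exp_re z1 z2 (Q s) (V s)) (exp_im z1 z2 (Q s) (V s)) (theta s).
Proof.
move=> [_ _ Q0] st; apply: gap_gt0; apply: le_lt_trans z_lt1; exact/exp_sqmod_le/Q0.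
Qed.

Lemma pUV_within Q V : admissible Q V ->
  {within `[0, t], continuous (pU Q V)} /\ {within `[0, t], continuous (pV Q V)}.
Proof.
move=> H; have [ca cb] := exp_within H.
apply: (poisson_within HD tT ca cb) => s st; exact: exp_gap_gt0.
Qed.

Lemma pUV_lipschitz Q V Q' V' s : admissible Q V -> admissible Q' V' -> 0 <= s <= t ->
  `|pU Q V s - pU Q' V' s| <=
     12 * poisson_lipschitz_constant c * (`|Q s - Q' s| + `|V s - V' s|) /\
  `|pV Q V s - pV Q' V' s| <=
     12 * poisson_lipschitz_constant c * (`|Q s - Q' s| + `|V s - V' s|).
Proof.
move=> H H' st; have [_ _ Q0] := H; have [_ _ Q0'] := H'.
have k0 : 0 <= poisson_lipschitz_constant c.
  by rewrite /poisson_lipschitz_constant !addr_ge0 ?sqr_ge0.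
have e := exp_lipschitz (V s) (V' s) (Q0 s st) (Q0' s st).
have [h1 h2] := poisson_lipschitz (theta s) z_lt1 (exp_sqmod_le (V s) (Q0 s st)) (exp_sqmod_le (V' s) (Q0' s st)).
have e' : 2 * poisson_lipschitz_constant c *
    (`|exp_re z1 z2 (Q s) (V s) - exp_re z1 z2 (Q' s) (V' s)| +
     `|exp_im z1 z2 (Q s) (V s) - exp_im z1 z2 (Q' s) (V' s)|) <=
    12 * poisson_lipschitz_constant c * (`|Q s - Q' s| + `|V s - V' s|).
  rewrite (_ : 12 * _ * _ = 2 * poisson_lipschitz_constant c * (6 * (`|Q s - Q' s| + `|V s - V' s|))); last by ring.
  by rewrite ler_wpM2l// mulr_ge0.
by split; [exact: le_trans h1 e'|exact: le_trans h2 e'].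
Qed.

Definition picard_step (f : (R -> R) * (R -> R)) : (R -> R) * (R -> R) :=
  (fun s => wint (pU f.1 f.2) t - wint (pU f.1 f.2) s,
   fun s => wint (pV f.1 f.2) t - wint (pV f.1 f.2) s).

Lemma picard_step_rate f s : admissible f.1 f.2 -> 0 < s < t ->
  rate (picard_step f).1 s (- pU f.1 f.2 s) 0 /\ rate (picard_step f).2 s (- pV f.1 f.2 s) 0.
Proof.
move=> /pUV_within[cU cV] st; split.
  by apply: rate_eq (rateB (rate_cst L theta _ s) (wint_rate st tT cU)); ring.
by apply: rate_eq (rateB (rate_cst L theta _ s) (wint_rate st tT cV)); ring.
Qed.

Lemma picard_step_admissible f : admissible f.1 f.2 ->
  admissible (picard_step f).1 (picard_step f).2.
Proof.
move=> H; have [cU cV] := pUV_within H.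
have c1 : {within `[0, t], continuous (picard_step f).1}.
  by apply: withinB; [exact: within_cst|exact: wint_within].
have c2 : {within `[0, t], continuous (picard_step f).2}.
  by apply: withinB; [exact: within_cst|exact: wint_within].
split => // s /andP[s0 st].
have : - (picard_step f).1 s <= - (picard_step f).1 t.
  apply: (@rate_nondecreasing _ T L theta n HD (fun x => - (picard_step f).1 x)) => //.
    by apply: withinN; apply: withinS c1; exact: subset_itvcc.
  move=> x /andP[sx xt]; have x0t : 0 < x < t by rewrite (le_lt_trans s0).
  have [h _] := picard_step_rate H x0t.
  exists (- - pU f.1 f.2 x); first by apply: rate_eq (rateN h) => //; rewrite oppr0.
  rewrite opprK ltW// poisson_gt0//; apply: le_lt_trans z_lt1; apply: exp_sqmod_le.
  by have [_ _] := H; apply; case/andP: x0t => /ltW -> /ltW.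
by rewrite {2}/picard_step /= subrr oppr0 oppr_le0.
Qed.

Definition picard (k : nat) := iter k picard_step (fun=> 0, fun=> 0).

Lemma picard_admissible k : admissible (picard k).1 (picard k).2.
Proof.
elim: k => [|k IH]; last exact: picard_step_admissible.
by split => //; exact: within_cst.
Qed.

Local Notation kappa := (48 * poisson_lipschitz_constant c).

(* Contraction by 1/2 in the norm weighted by exp (kappa (L t - L s)). *)
Lemma picard_contraction : exists M, forall k s, 0 <= s <= t ->
  `|(picard k.+1).1 s - (picard k).1 s| <= M * expR (kappa * (L t - L s)) * 2^-1 ^+ k /\
  `|(picard k.+1).2 s - (picard k).2 s| <= M * expR (kappa * (L t - L s)) * 2^-1 ^+ k.
Proof.
have K0 : 0 <= poisson_lipschitz_constant c.
  by rewrite /poisson_lipschitz_constant !addr_ge0 ?sqr_ge0.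
have [cQ1 cV1 _] := picard_admissible 1.
have [M1 HM1] := within_bounded t0 cQ1; have [M2 HM2] := within_bounded t0 cV1.
exists (Num.max M1 M2); set M := Num.max M1 M2.
have Lst s : 0 <= s <= t -> 0 <= L t - L s.
  by move=> /andP[s0 st]; rewrite subr_ge0; apply: (clock_le HD).
elim=> [|k IH] s st.
  rewrite expr0 mulr1 !subr0.
  have h1 : `|(picard 1).1 s| <= M by rewrite le_max HM1.
  have h2 : `|(picard 1).2 s| <= M by rewrite le_max HM2 ?orbT.
  have M0 : 0 <= M by apply: le_trans h1.
  have e1 : M <= M * expR (kappa * (L t - L s)).
    by rewrite ler_peMr// -expR0 ler_expR mulr_ge0 ?Lst// mulr_ge0.
  by split; [exact: le_trans h1 e1|exact: le_trans h2 e1].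
have /andP[s0 st'] := st.
(* Writing K for [poisson_lipschitz_constant], the rate of [g] is kappa / 2 = 24 K times the bound
   of step k. The two coordinates together move U and V by at most 2 * 12 K times that bound, hence
   the 48 in kappa. *)
pose g (x : R) := - (M * 2^-1 ^+ k.+1) * expR (kappa * (L t - L x)).
have sub : `[s, t]%classic `<=` `[0, t]%classic by exact: subset_itvcc.
have cg : {within `[s, t], continuous g}.
  apply: withinM; first exact: within_cst.
  apply: (within_expR (f := fun x => kappa * (L t - L x))).
  apply: withinM; first exact: within_cst.
  apply: withinB; first exact: within_cst.
  by apply: withinS (driven_clock_continuous HD); exact: subset_itvcc.
have H1 := picard_admissible k; have H2 := picard_admissible k.+1; have H3 := picard_admissible k.+2.
have rg x : 0 < x < t -> rate g x (24 * poisson_lipschitz_constant c * (M * expR (kappa * (L t - L x)) * 2^-1 ^+ k)) 0.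
  move=> /andP[x0 xt]; have xT : 0 < x < T by rewrite x0 (lt_le_trans xt).
  apply: rate_eq (rateZ (- (M * 2^-1 ^+ k.+1)) (rate_expR HD xT (rateZ kappa
    (rateB (rate_cst L theta (L t) x) (rate_clock L theta x))))).
    by rewrite exprS; field.
  by rewrite subrr mulr0 mul0r mulr0.
have gt : g t <= 0.
  rewrite /g mulNr oppr_le0 subrr mulr0 expR0 mulr1.
  have [h _] := IH s st; have e0 := expR_gt0 (kappa * (L t - L s)).
  have := le_trans (normr_ge0 _) h; rewrite mulrAC pmulr_lge0// exprS => h'.
  by rewrite mulrCA mulr_ge0// invr_ge0.
have bound x : 0 <= x <= t ->
    12 * poisson_lipschitz_constant c * (`|(picard k.+1).1 x - (picard k).1 x| +
       `|(picard k.+1).2 x - (picard k).2 x|) <=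
    24 * poisson_lipschitz_constant c * (M * expR (kappa * (L t - L x)) * 2^-1 ^+ k).
  move=> /IH[h1 h2].
  rewrite (_ : 24 * _ * _ = 12 * poisson_lipschitz_constant c * (2 * (M * expR (kappa * (L t - L x)) * 2^-1 ^+ k))); last by ring.
  by rewrite ler_wpM2l ?mulr_ge0//; lra.
have goalE : - g s = M * expR (kappa * (L t - L s)) * 2^-1 ^+ k.+1 by rewrite /g; ring.
have [c21 c22 _] := H2; have [c31 c32 _] := H3.
split.
- have := @rate_dist _ T L theta n HD (fun x => (picard k.+2).1 x - (picard k.+1).1 x) g s t s0 st' tT.
  rewrite [X in `|X - _|](_ : _ = 0); last by rewrite /picard /= !subrr.
  rewrite sub0r normrN -goalE => h.
  apply: le_trans (h _ cg _) _; last by lra.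
    by apply: withinB; [exact: withinS sub c31|exact: withinS sub c21].
  move=> x /andP[sx xt]; have x0t : 0 < x < t by rewrite (le_lt_trans s0).
  have x0t' : 0 <= x <= t by case/andP: x0t => /ltW -> /ltW.
  have [r1 _] := picard_step_rate H2 x0t; have [r2 _] := picard_step_rate H1 x0t.
  have [l1 _] := pUV_lipschitz H2 H1 x0t'.
  eexists; eexists; split; [|exact: rg|].
    by apply: rate_eq (rateB r1 r2) => //; rewrite subr0.
  by rewrite -opprD normrN (le_trans l1)// bound.
- have := @rate_dist _ T L theta n HD (fun x => (picard k.+2).2 x - (picard k.+1).2 x) g s t s0 st' tT.
  rewrite [X in `|X - _|](_ : _ = 0); last by rewrite /picard /= !subrr.
  rewrite sub0r normrN -goalE => h.
  apply: le_trans (h _ cg _) _; last by lra.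
    by apply: withinB; [exact: withinS sub c32|exact: withinS sub c22].
  move=> x /andP[sx xt]; have x0t : 0 < x < t by rewrite (le_lt_trans s0).
  have x0t' : 0 <= x <= t by case/andP: x0t => /ltW -> /ltW.
  have [_ r1] := picard_step_rate H2 x0t; have [_ r2] := picard_step_rate H1 x0t.
  have [_ l1] := pUV_lipschitz H2 H1 x0t'.
  eexists; eexists; split; [|exact: rg|].
    by apply: rate_eq (rateB r1 r2) => //; rewrite subr0.
  by rewrite -opprD normrN (le_trans l1)// bound.
Qed.

Lemma picard_fixpoint : exists Q V, admissible Q V /\ forall s, 0 <= s <= t ->
  Q s = wint (pU Q V) t - wint (pU Q V) s /\ V s = wint (pV Q V) t - wint (pV Q V) s.
Proof.
have [M HM] := picard_contraction.
have K0 : 0 <= poisson_lipschitz_constant c.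
  by rewrite /poisson_lipschitz_constant !addr_ge0 ?sqr_ge0.
have M0 : 0 <= M.
  have [|h _] := HM 0%N t; first by rewrite t0 lexx.
  by have := le_trans (normr_ge0 _) h; rewrite subrr mulr0 expR0 !mulr1.
pose B := M * expR (kappa * L t).
have HB k s : 0 <= s <= t -> `|(picard k.+1).1 s - (picard k).1 s| <= B * 2^-1 ^+ k /\
    `|(picard k.+1).2 s - (picard k).2 s| <= B * 2^-1 ^+ k.
  move=> st; have [h1 h2] := HM k s st; have /andP[s0 st'] := st.
  have e : M * expR (kappa * (L t - L s)) * 2^-1 ^+ k <= B * 2^-1 ^+ k.
    rewrite ler_wpM2r ?exprn_ge0 ?invr_ge0// ler_wpM2l// ler_expR ler_wpM2l ?mulr_ge0//.
    by rewrite gerBl -(clock0 lam); apply: (clock_le HD) => //; exact: le_trans tT.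
  by split; [exact: le_trans h1 e|exact: le_trans h2 e].
have /choice[Q HQ] : forall s, exists l, 0 <= s <= t -> forall k, `|(picard k).1 s - l| <= 2 * B * 2^-1 ^+ k.
  move=> s; have [st|] := boolP (0 <= s <= t); last by exists 0.
  by have [|l Hl] := @geometric_limit R (fun k => (picard k).1 s) B;
    [move=> k; have [] := HB k s st|exists l].
have /choice[V HV] : forall s, exists l, 0 <= s <= t -> forall k, `|(picard k).2 s - l| <= 2 * B * 2^-1 ^+ k.
  move=> s; have [st|] := boolP (0 <= s <= t); last by exists 0.
  by have [|l Hl] := @geometric_limit R (fun k => (picard k).2 s) B;
    [move=> k; have [] := HB k s st|exists l].
have adm : admissible Q V.
  split.
  - apply: (@within_uniform_limit _ _ (fun k => (picard k).1) _ (2 * B)).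
      by move=> k; have [] := picard_admissible k.
    by move=> k x /=; rewrite in_itv/= => /HQ.
  - apply: (@within_uniform_limit _ _ (fun k => (picard k).2) _ (2 * B)).
      by move=> k; have [] := picard_admissible k.
    by move=> k x /=; rewrite in_itv/= => /HV.
  - move=> s st; apply/ler_addgt0Pr => e e0.
    have [k hk] := half_pow_small (2 * B) e0.
    have := HQ s st k; have [_ _ /(_ s st)] := picard_admissible k.
    by rewrite ler_norml => h /andP[]; lra.
exists Q, V; split => // s st.
have [cU cV] := pUV_within adm.
have LT0 : 0 <= L t by rewrite -(clock0 lam); exact: (clock_le HD).
set K := poisson_lipschitz_constant c in K0 HB HM.
(* Errors relative to 2^-k: the integrals up to t and up to s each inherit the Lipschitz error 12 K
   (4 B), multiplied by the clock, and 2 B is the distance of iterate k + 1 from the limit. *)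
pose C := 12 * K * (4 * B) * (2 * L t) + 2 * B.
have B0 : 0 <= B by rewrite mulr_ge0 ?expR_ge0.
have pk0 k : 0 <= 2^-1 ^+ k :> R by rewrite exprn_ge0 ?invr_ge0.
have lip k x : 0 <= x <= t ->
   `|pU (picard k).1 (picard k).2 x - pU Q V x| <= 12 * K * (4 * B) * 2^-1 ^+ k /\
   `|pV (picard k).1 (picard k).2 x - pV Q V x| <= 12 * K * (4 * B) * 2^-1 ^+ k.
  move=> xt; have [h1 h2] := pUV_lipschitz (picard_admissible k) adm xt.
  have e : 12 * K * (`|(picard k).1 x - Q x| + `|(picard k).2 x - V x|) <= 12 * K * (4 * B) * 2^-1 ^+ k.
    rewrite -[leRHS]mulrA ler_wpM2l ?mulr_ge0//.
    by have := HQ x xt k; have := HV x xt k; lra.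
  by split; [exact: le_trans h1 e|exact: le_trans h2 e].
have Lst x : 0 <= x <= t -> L x <= L t by move=> /andP[x0 xt]; exact: (clock_le HD).
have fin (x y : R) : (forall k, `|x - y| <= C * 2^-1 ^+ k) -> x = y.
  move=> H; apply/eqP; rewrite -subr_eq0 -normr_le0; apply/ler_addgt0Pr => e e0.
  by have [k hk] := half_pow_small C e0; rewrite add0r; apply: le_trans (H k) (ltW hk).
have half k : 2^-1 ^+ k.+1 <= 2^-1 ^+ k :> R by rewrite exprS ler_piMl//; lra.
have c0 k : 0 <= 12 * K * (4 * B) * 2^-1 ^+ k by rewrite !mulr_ge0.
have tt : 0 <= t <= t by rewrite t0 lexx.
split; apply: fin => k.
- have [ck ck'] := pUV_within (picard_admissible k).
  have d1 := wint_dist t0 tT ck cU (fun x xt => (lip k x xt).1) t0 (lexx t).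
  have /andP[s0 st'] := st.
  have d2 := wint_dist t0 tT ck cU (fun x xt => (lip k x xt).1) s0 st'.
  have d3 := HQ s st k.+1.
  have := ler_wpM2l (c0 k) (Lst s st).
  rewrite [X in `|X - _| <= _](_ : _ = wint (pU (picard k).1 (picard k).2) t -
    wint (pU (picard k).1 (picard k).2) s) // in d3.
  have := half k; move: d1 d2 d3.
  set w1 := wint (pU (picard k).1 (picard k).2) t; set w2 := wint (pU (picard k).1 (picard k).2) s.
  set w3 := wint (pU Q V) t; set w4 := wint (pU Q V) s.
  move: (2^-1 ^+ k) (pk0 k) (2^-1 ^+ k.+1) (pk0 k.+1) => p p0 p' p0' d1 d2 d3 pp' hl.
  have := ler_wpM2l B0 pp'.
  rewrite (_ : Q s - _ = - (w1 - w2 - Q s) + (w1 - w3) - (w2 - w4)); last by ring.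
  move=> hB; apply: le_trans (ler_normB _ _) _.
  apply: le_trans (lerD (ler_normD _ _) (lexx _)) _; rewrite normrN /C; lra.
- have [ck ck'] := pUV_within (picard_admissible k).
  have d1 := wint_dist t0 tT ck' cV (fun x xt => (lip k x xt).2) t0 (lexx t).
  have /andP[s0 st'] := st.
  have d2 := wint_dist t0 tT ck' cV (fun x xt => (lip k x xt).2) s0 st'.
  have d3 := HV s st k.+1.
  have := ler_wpM2l (c0 k) (Lst s st).
  rewrite [X in `|X - _| <= _](_ : _ = wint (pV (picard k).1 (picard k).2) t -
    wint (pV (picard k).1 (picard k).2) s) // in d3.
  have := half k; move: d1 d2 d3.
  set w1 := wint (pV (picard k).1 (picard k).2) t; set w2 := wint (pV (picard k).1 (picard k).2) s.
  set w3 := wint (pV Q V) t; set w4 := wint (pV Q V) s.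
  move: (2^-1 ^+ k) (pk0 k) (2^-1 ^+ k.+1) (pk0 k.+1) => p p0 p' p0' d1 d2 d3 pp' hl.
  have := ler_wpM2l B0 pp'.
  rewrite (_ : V s - _ = - (w1 - w2 - V s) + (w1 - w3) - (w2 - w4)); last by ring.
  move=> hB; apply: le_trans (ler_normB _ _) _.
  apply: le_trans (lerD (ler_normD _ _) (lexx _)) _; rewrite normrN /C; lra.
Qed.

End terminal.
End picard.

Section solutions.
Context (R : realType) (T : R) (lam : R -> R) (hlam : weight_function T lam).
Context (hlam_inv : has_ubound (inv_weight_values T lam)) (T0 : 0 < T).
Context (theta n : R -> R) (HD : driven T (clock lam) theta n).
Local Notation L := (clock lam).
Local Notation rate := (rate L theta).
Local Notation disc_flow := (disc_flow L theta).
Local Notation wint := (wint lam).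

(** The logarithm (Q, V) is returned with the flow line because it provides the lift to the covering
    coordinate, where [inverse_flow] is computed. *)
Lemma terminal_flow t z1 z2 : 0 <= t -> t <= T -> sqmod z1 z2 < 1 ->
  exists a b Q V, [/\ disc_flow t a b, [/\ a t = z1, b t = z2, Q t = 0 & V t = 0],
    {within `[0, t], continuous Q} /\ {within `[0, t], continuous V},
    forall s, a s = exp_re z1 z2 (Q s) (V s) /\ b s = exp_im z1 z2 (Q s) (V s) &
    forall s, 0 < s < t -> rate Q s (- fpoisson theta a b s) 0 /\
                           rate V s (- fconj theta a b s) 0].
Proof.
move=> t0 tT z1_lt1.
have [Q [V [adm HQV]]] := picard_fixpoint hlam hlam_inv T0 HD t0 tT z1_lt1.
have [cQ cV Q0] := adm.
have [ca cb] := exp_within z1 z2 adm.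
have [cU cW] := pUV_within HD tT z1_lt1 adm.
pose a s := exp_re z1 z2 (Q s) (V s); pose b s := exp_im z1 z2 (Q s) (V s).
have [Qt Vt] : Q t = 0 /\ V t = 0.
  by have [|-> ->] := HQV t; rewrite ?t0 ?lexx// !subrr.
have rQV s : 0 < s < t -> rate Q s (- fpoisson theta a b s) 0 /\ rate V s (- fconj theta a b s) 0.
  move=> st.
  have near_eq (F G : R -> R) : (forall x, 0 <= x <= t -> F x = G x) -> \forall x \near s, F x = G x.
    move=> FG; near=> x; apply: FG.
    have /andP[x0 xt] : 0 < x < t by near: x; exact: near_itv.
    by rewrite !ltW.
  split.
    apply: (@rate_near_eq _ _ _ (fun x => wint (pU theta z1 z2 Q V) t - wint (pU theta z1 z2 Q V) x)).
      by apply: near_eq => x /HQV[-> _].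
    by apply: rate_eq (rateB (rate_cst L theta _ s) (wint_rate hlam hlam_inv T0 theta st tT cU)); [rewrite sub0r|ring].
  apply: (@rate_near_eq _ _ _ (fun x => wint (pV theta z1 z2 Q V) t - wint (pV theta z1 z2 Q V) x)).
    by apply: near_eq => x /HQV[_ ->].
  by apply: rate_eq (rateB (rate_cst L theta _ s) (wint_rate hlam hlam_inv T0 theta st tT cW)); [rewrite sub0r|ring].
exists a, b, Q, V; split => //; last first.
  by rewrite /a /b Qt Vt /exp_re /exp_im oppr0 expR0 cos0 sin0 !mul1r !mulr1 !mulr0 addr0 subr0.
split => //.
- by move=> s st; exact: exp_gap_gt0.
- move=> s /[dup] st /andP[s0 st']; have sT : 0 < s < T by rewrite s0 (lt_le_trans st').
  have [rQ rV] := rQV s st.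
  have re := rate_expR HD sT (rateN rQ).
  have rc := rate_cos_comp HD sT rV; have rs := rate_sin_comp HD sT rV.
  apply: rate_eq (rateM HD sT re (rateD (rateZ z1 rc) (rateZ z2 rs))).
    by rewrite /= /a /b /exp_re /exp_im; ring.
  by rewrite /=; ring.
- move=> s /[dup] st /andP[s0 st']; have sT : 0 < s < T by rewrite s0 (lt_le_trans st').
  have [rQ rV] := rQV s st.
  have re := rate_expR HD sT (rateN rQ).
  have rc := rate_cos_comp HD sT rV; have rs := rate_sin_comp HD sT rV.
  apply: rate_eq (rateM HD sT re (rateB (rateZ z2 rc) (rateZ z1 rs))).
    by rewrite /= /a /b /exp_re /exp_im; ring.
  by rewrite /=; ring.
- rewrite /fsqmod /a /b; apply: le_lt_trans z1_lt1; apply: exp_sqmod_le.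
  by apply: Q0; rewrite lexx.
Unshelve. all: by end_near. Qed.

Definition vel_re (a b : R -> R) s := a s * fpoisson theta a b s - b s * fconj theta a b s.
Definition vel_im (a b : R -> R) s := a s * fconj theta a b s + b s * fpoisson theta a b s.

Lemma vel_within r (a b : R -> R) : r <= T -> {within `[0, r], continuous a} ->
  {within `[0, r], continuous b} -> (forall t, 0 <= t <= r -> 0 < fgap theta a b t) ->
  {within `[0, r], continuous (vel_re a b)} /\ {within `[0, r], continuous (vel_im a b)}.
Proof.
move=> rT ca cb E0.
have [c1 c2] := poisson_within HD rT ca cb E0.
by split; [apply: withinB|apply: withinD]; apply: withinM.
Qed.

Lemma flow_integral r a b s : r <= T -> disc_flow r a b -> 0 <= s -> s <= r ->
  a s = a 0 + wint (vel_re a b) s /\ b s = b 0 + wint (vel_im a b) s.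
Proof.
move=> rT Hf s0 sr; have r0 := le_trans s0 sr.
have [ca cb E0 ra rb N0] := Hf.
have [c1 c2] := vel_within rT ca cb E0.
have sub : `[0, s]%classic `<=` `[0, r]%classic by exact: subset_itvcc.
have sT := le_trans sr rT.
have main f v : {within `[0, r], continuous f} -> {within `[0, r], continuous v} ->
    (forall t, 0 < t < r -> rate f t (v t) 0) -> f s = f 0 + wint v s.
  move=> cf cv rf.
  have := @rate_constant _ T L theta n HD (fun x => f x - wint v x) 0 s (lexx 0) s0 sT.
  rewrite wint0 subr0 => H; suff : f s - wint v s = f 0 by move=> <-; ring.
  apply: H.
    apply: withinB; first exact: withinS sub cf.
    by apply: withinS sub _; exact: (wint_within hlam r0 rT cv).
  move=> t /andP[t0 ts]; have tr : 0 < t < r by rewrite t0 (lt_le_trans ts).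
  by apply: rate_eq (rateB (rf t tr) (wint_rate hlam hlam_inv T0 theta tr rT cv)); rewrite subrr.
by split; apply: main.
Qed.

Lemma integral_flow r a b : r <= T -> {within `[0, r], continuous a} ->
  {within `[0, r], continuous b} -> (forall t, 0 <= t <= r -> 0 < fgap theta a b t) ->
  fsqmod a b 0 < 1 ->
  (forall s, 0 <= s <= r ->
    a s = a 0 + wint (vel_re a b) s /\ b s = b 0 + wint (vel_im a b) s) ->
  disc_flow r a b.
Proof.
move=> rT ca cb E0 N0 H; have [c1 c2] := vel_within rT ca cb E0.
have near_eq s (F G : R -> R) : 0 < s < r -> (forall x, 0 <= x <= r -> F x = G x) ->
    \forall x \near s, F x = G x.
  move=> sr FG; near=> x; apply: FG.
  have /andP[x0 xt] : 0 < x < r by near: x; exact: near_itv.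
  by rewrite !ltW.
split => // t tr.
  apply: (@rate_near_eq _ _ _ (fun s => a 0 + wint (vel_re a b) s)).
    by apply: (near_eq t) => // x /H[].
  by apply: rate_eq (rateD (rate_cst L theta _ t) (wint_rate hlam hlam_inv T0 theta tr rT c1)); [rewrite add0r|rewrite addr0].
apply: (@rate_near_eq _ _ _ (fun s => b 0 + wint (vel_im a b) s)).
  by apply: (near_eq t) => // x /H[].
by apply: rate_eq (rateD (rate_cst L theta _ t) (wint_rate hlam hlam_inv T0 theta tr rT c2)); [rewrite add0r|rewrite addr0].
Unshelve. all: by end_near. Qed.

Lemma vel_lipschitz c a b a' b' s : c < 1 -> sqmod (a s) (b s) <= c -> sqmod (a' s) (b' s) <= c ->
  `|vel_re a b s - vel_re a' b' s| <=
    (4 / (1 - c) + 4 * poisson_lipschitz_constant c) * (`|a s - a' s| + `|b s - b' s|) /\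
  `|vel_im a b s - vel_im a' b' s| <=
    (4 / (1 - c) + 4 * poisson_lipschitz_constant c) * (`|a s - a' s| + `|b s - b' s|).
Proof.
move=> c1 xc xc'.
have [u1 v1] := poisson_norm_bound (theta s) c1 xc.
have [l1 l2] := poisson_lipschitz (theta s) c1 xc xc'.
have bnd (x : R) : x ^+ 2 <= c -> `|x| <= 1.
  move=> h; rewrite -(@ler_pXn2r _ 2%N) ?nnegrE// real_normK ?num_real// expr1n.
  by rewrite (le_trans h)// ltW.
have b1 : `|a' s| <= 1 by apply: bnd; apply: le_trans xc'; rewrite /sqmod lerDl sqr_ge0.
have b2 : `|b' s| <= 1 by apply: bnd; apply: le_trans xc'; rewrite /sqmod lerDr sqr_ge0.
rewrite /vel_re /vel_im /fpoisson /fconj; move: u1 v1 l1 l2.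
set k := 4 / _; set K := poisson_lipschitz_constant c.
move: (poisson (a s) _ _) (conjugate_poisson (a s) _ _) (poisson (a' s) _ _) (conjugate_poisson (a' s) _ _).
move=> u v u' v' u1 v1 l1 l2.
set d := `|a s - a' s| + `|b s - b' s| in l1 l2 *.
have d1 : `|a s - a' s| <= d by rewrite lerDl.
have d2 : `|b s - b' s| <= d by rewrite lerDr.
have k0 : 0 <= k by apply: le_trans u1.
have pm (x y p q : R) : `|x| <= p -> `|y| <= q -> `|x * y| <= p * q.
  by move=> ? ?; rewrite normrM ler_pM.
split.
- rewrite (_ : _ - _ = ((a s - a' s) * u - (b s - b' s) * v) + (a' s * (u - u') - b' s * (v - v'))); last by ring.
  apply: le_trans (ler_normD _ _) _.
  have h1 : `|(a s - a' s) * u| <= `|a s - a' s| * k by exact: pm.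
  have h2 : `|(b s - b' s) * v| <= `|b s - b' s| * k by exact: pm.
  have h3 : `|a' s * (u - u')| <= 1 * (2 * K * d) by exact: pm.
  have h4 : `|b' s * (v - v')| <= 1 * (2 * K * d) by exact: pm.
  have := ler_normB ((a s - a' s) * u) ((b s - b' s) * v).
  have := ler_normB (a' s * (u - u')) (b' s * (v - v')).
  by rewrite /d in h3 h4 *; lra.
- rewrite (_ : _ - _ = ((a s - a' s) * v + (b s - b' s) * u) + (a' s * (v - v') + b' s * (u - u'))); last by ring.
  apply: le_trans (ler_normD _ _) _.
  have h1 : `|(a s - a' s) * v| <= `|a s - a' s| * k by exact: pm.
  have h2 : `|(b s - b' s) * u| <= `|b s - b' s| * k by exact: pm.
  have h3 : `|a' s * (v - v')| <= 1 * (2 * K * d) by exact: pm.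
  have h4 : `|b' s * (u - u')| <= 1 * (2 * K * d) by exact: pm.
  have := ler_normD ((a s - a' s) * v) ((b s - b' s) * u).
  have := ler_normD (a' s * (v - v')) (b' s * (u - u')).
  by rewrite /d in h3 h4 *; lra.
Qed.

(** The common bound c < 1 makes the velocity Lipschitz along all the lines, so the integral
    equation passes to the limit; the rates of the limit are then read off its integral equation. *)
Lemma limit_flow r c B (A A' : nat -> R -> R) a b : 0 <= r -> r <= T -> c < 1 ->
  (forall k, disc_flow r (A k) (A' k)) ->
  (forall k s, 0 <= s <= r -> fsqmod (A k) (A' k) s <= c) ->
  (forall k s, 0 <= s <= r -> `|A k s - a s| <= B * 2^-1 ^+ k /\ `|A' k s - b s| <= B * 2^-1 ^+ k) ->
  disc_flow r a b.
Proof.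
move=> r0 rT c1 HA HN Hlim.
have ca : {within `[0, r], continuous a}.
  apply: (@within_uniform_limit _ _ A _ B); first by move=> k; exact: flow_re_continuous (HA k).
  by move=> k x /=; rewrite in_itv/= => /(Hlim k)[].
have cb : {within `[0, r], continuous b}.
  apply: (@within_uniform_limit _ _ A' _ B); first by move=> k; exact: flow_im_continuous (HA k).
  by move=> k x /=; rewrite in_itv/= => /(Hlim k)[].
have pk0 k : 0 <= 2^-1 ^+ k :> R by rewrite exprn_ge0 ?invr_ge0.
have pk1 k : 2^-1 ^+ k <= 1 :> R by rewrite exprn_ile1 ?invr_ge0//; lra.
have B0 : 0 <= B.
  have [|h _] := Hlim 0%N 0; first by rewrite lexx.
  by have := le_trans (normr_ge0 _) h; rewrite expr0 mulr1.
have Nab s : 0 <= s <= r -> fsqmod a b s <= c.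
  move=> sr; apply/ler_addgt0Pr => e e0.
  have [k hk] := half_pow_small (4 * B * (1 + B)) e0.
  have [h1 h2] := Hlim k s sr; have := HN k s sr; rewrite /fsqmod /sqmod => hN.
  have bnd (x y : R) : sqmod x y <= c -> `|x| <= 1 /\ `|y| <= 1.
    move=> xy; split; rewrite -(@ler_pXn2r _ 2%N) ?nnegrE// real_normK ?num_real// expr1n;
      by apply: le_trans (le_trans _ xy) (ltW c1); rewrite ?lerDl ?lerDr sqr_ge0.
  have [b1 b2] := bnd _ _ hN.
  have sq (x y : R) : `|x| <= 1 -> `|x - y| <= B * 2^-1 ^+ k -> y ^+ 2 <= x ^+ 2 + 2 * B * (1 + B) * 2^-1 ^+ k.
    move=> x1 xy; rewrite (_ : y ^+ 2 = x ^+ 2 - 2 * (x * (x - y)) + (x - y) ^+ 2); last by ring.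
    have q1 : `|x * (x - y)| <= 1 * (B * 2^-1 ^+ k) by rewrite normrM ler_pM.
    have q2 : (x - y) ^+ 2 <= (B * 2^-1 ^+ k) * (B * 1).
      rewrite -(real_normK (num_real (x - y))) expr2 ler_pM//.
      by apply: le_trans xy _; rewrite ler_wpM2l.
    by move: q1; rewrite ler_norml => /andP[q1 _]; have := mulr_ge0 B0 (pk0 k);
      have := mulr_ge0 B0 (mulr_ge0 B0 (pk0 k)); lra.
  have := sq _ _ b1 h1; have := sq _ _ b2 h2; lra.
have E0 s : 0 <= s <= r -> 0 < fgap theta a b s.
  by move=> sr; apply: gap_gt0; apply: le_lt_trans c1; exact: Nab.
have [cv1 cv2] := vel_within rT ca cb E0.
apply: integral_flow => //; first by apply: le_lt_trans c1; apply: Nab; rewrite lexx.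
move=> s sr; have /andP[s0 sr'] := sr.
set K := 4 / (1 - c) + 4 * poisson_lipschitz_constant c.
have K0 : 0 <= K.
  by rewrite addr_ge0 ?divr_ge0 ?subr_ge0 ?(ltW c1)// mulr_ge0// /poisson_lipschitz_constant !addr_ge0 ?sqr_ge0.
have Ls0 : 0 <= L s by rewrite -(clock0 lam); apply: (clock_le HD) => //; exact: le_trans rT.
have zz : 0 <= (0 : R) <= r by rewrite lexx.
pose C := 2 * B + K * (2 * B) * L s.
have fin (x y : R) : (forall k, `|x - y| <= C * 2^-1 ^+ k) -> x = y.
  move=> H; apply/eqP; rewrite -subr_eq0 -normr_le0; apply/ler_addgt0Pr => e e0.
  by have [k hk] := half_pow_small C e0; rewrite add0r; apply: le_trans (H k) (ltW hk).
have lip k x : 0 <= x <= r -> `|vel_re (A k) (A' k) x - vel_re a b x| <= K * (2 * B) * 2^-1 ^+ k /\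
    `|vel_im (A k) (A' k) x - vel_im a b x| <= K * (2 * B) * 2^-1 ^+ k.
  move=> xr; have [h1 h2] := Hlim k x xr.
  have [l1 l2] := vel_lipschitz c1 (HN k x xr) (Nab x xr).
  have e : K * (`|A k x - a x| + `|A' k x - b x|) <= K * (2 * B) * 2^-1 ^+ k.
    by rewrite -mulrA ler_wpM2l//; lra.
  by split; [exact: le_trans l1 e|exact: le_trans l2 e].
split; apply: fin => k.
- have [ca' cb' E0' _ _ _] := HA k.
  have [cv1' _] := vel_within rT ca' cb' E0'.
  have [e _] := flow_integral rT (HA k) s0 sr'.
  have d := wint_dist hlam hlam_inv T0 HD r0 rT cv1' cv1 (fun x xr => (lip k x xr).1) s0 sr'.
  have [h1 _] := Hlim k s sr; have [h2 _] := Hlim k 0 zz.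
  rewrite (_ : a s - _ = - (A k s - a s) + (A k 0 - a 0) + (wint (vel_re (A k) (A' k)) s - wint (vel_re a b) s)); last first.
    by rewrite {1}e; ring.
  apply: le_trans (ler_normD _ _) _; apply: le_trans (lerD (ler_normD _ _) (lexx _)) _.
  by rewrite normrN /C; lra.
- have [ca' cb' E0' _ _ _] := HA k.
  have [_ cv1'] := vel_within rT ca' cb' E0'.
  have [_ e] := flow_integral rT (HA k) s0 sr'.
  have d := wint_dist hlam hlam_inv T0 HD r0 rT cv1' cv2 (fun x xr => (lip k x xr).2) s0 sr'.
  have [_ h1] := Hlim k s sr; have [_ h2] := Hlim k 0 zz.
  rewrite (_ : b s - _ = - (A' k s - b s) + (A' k 0 - b 0) + (wint (vel_im (A k) (A' k)) s - wint (vel_im a b) s)); last first.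
    by rewrite {1}e; ring.
  apply: le_trans (ler_normD _ _) _; apply: le_trans (lerD (ler_normD _ _) (lexx _)) _.
  by rewrite normrN /C; lra.
Qed.

End solutions.

(** * Existence of the point swallowed at a given time *)

Section tip.
Context (R : realType) (T : R) (lam : R -> R) (hlam : weight_function T lam).
Context (hlam_inv : has_ubound (inv_weight_values T lam)) (T0 : 0 < T).
Context (theta n : R -> R) (HD : driven T (clock lam) theta n).
Local Notation L := (clock lam).
Local Notation rate := (rate L theta).
Local Notation disc_flow := (disc_flow L theta).

(** The exponent starts at 1, so that all radii are at least 1 / 2 and the sizes at the endpoints
    are bounded uniformly in k. *)
Definition radius (k : nat) : R := 1 - 2^-1 ^+ k.+1.

Lemma radius_itv k : 2^-1 <= radius k /\ radius k < 1.
Proof.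
rewrite /radius exprS; have h : 0 < 2^-1 ^+ k :> R by rewrite exprn_gt0 ?invr_gt0.
have h1 : 2^-1 ^+ k <= 1 :> R by rewrite exprn_ile1 ?invr_ge0//; lra.
by split; lra.
Qed.

Lemma radius_sqmod k (th : R) : sqmod (radius k * cos th) (radius k * sin th) = radius k ^+ 2.
Proof.
by rewrite /sqmod !exprMn -mulrDr cos2Dsin2 mulr1.
Qed.

Lemma radius_gap k (th : R) : gap (radius k * cos th) (radius k * sin th) th = (1 - radius k) ^+ 2.
Proof.
by rewrite /gap -{1}(mul1r (cos th)) -{1}(mul1r (sin th)) -!mulrBl !exprMn -mulrDr cos2Dsin2 mulr1.
Qed.

Section terminal_radius.
Context (t : R) (t0 : 0 <= t) (tT : t <= T) (k : nat) (a b : R -> R) (Hf : disc_flow t a b).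
Context (at_ : a t = radius k * cos (theta t)) (bt : b t = radius k * sin (theta t)).

Lemma terminal_sqmod : fsqmod a b t = radius k ^+ 2.
Proof. by rewrite /fsqmod at_ bt radius_sqmod. Qed.

Lemma terminal_sqmod_gt0 : 0 < fsqmod a b 0.
Proof.
rewrite lt_neqAle sqmod_ge0 andbT eq_sym.
have := sqdist_eq0 HD tT Hf (zero_flow L theta t) (lexx 0) t0 (lexx t).
rewrite /sqdist !subr0 -/(fsqmod a b 0) -/(fsqmod a b t) => ->.
rewrite terminal_sqmod gt_eqF// exprn_gt0//; have [h _] := radius_itv k.
by apply: lt_le_trans h; rewrite invr_gt0.
Qed.

(** At the endpoint E = (1 - rho)^2 with rho the radius, so the angle functional is ln rho - 2 ln (1
    + rho) <= 0. Going back in time raises it by at most the energy cost, whatever k is. *)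
Lemma terminal_angle s : 0 <= s -> s <= t -> angle theta a b s <= angle_bound T n.
Proof.
move=> s0 st; have := angle_le HD tT Hf terminal_sqmod_gt0 s0 st (lexx t).
have [r1 r2] := radius_itv k; have r0 : 0 < radius k by apply: lt_le_trans r1; rewrite invr_gt0.
have q0 : 0 < 1 - radius k by rewrite subr_gt0.
have p0 : 0 < 1 + radius k by rewrite ltr_wpDl// ltW.
have : angle theta a b t <= 0.
  rewrite /angle terminal_sqmod /fgap at_ bt radius_gap.
  have -> : ln (1 - radius k ^+ 2) = ln (1 - radius k) + ln (1 + radius k).
    by rewrite -lnM ?posrE//; congr ln; ring.
  rewrite !lnXn// -!(mulr_natl (ln _)).
  have : ln (radius k) <= 0 by rewrite ln_le0 ?ltW.
  have : 0 <= ln (1 + radius k) by rewrite ln_ge0 ?lerDl ?ltW.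
  lra.
by have := energy_le_bound HD s0 st tT; lra.
Qed.

Lemma terminal_size s : 0 <= s -> s <= t -> log_size a b s <= ln 16 + 4 * (L t - L s).
Proof.
move=> s0 st; apply: le_trans (log_size_le HD tT Hf terminal_sqmod_gt0 s0 st (lexx t)) _.
have [r1 r2] := radius_itv k; have r0 : 0 < radius k by apply: lt_le_trans r1; rewrite invr_gt0.
rewrite lerD2r /log_size terminal_sqmod.
have p0 : 0 < 1 + radius k ^+ 2 by rewrite ltr_wpDr ?sqr_ge0.
rewrite mulr_natl -lnXn// -ln_div ?posrE ?exprn_gt0//.
(* The constant 16 is generous: (1 + q)^2 <= 16 q for q = rho^2 between 1 / 4 and 1. *)
rewrite ler_ln ?posrE ?divr_gt0 ?exprn_gt0// ler_pdivrMr ?exprn_gt0//.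
have : radius k ^+ 2 <= 1 by rewrite expr_le1// ltW.
have : 4^-1 <= radius k ^+ 2.
  rewrite (_ : 4^-1 = 2^-1 ^+ 2 :> R); last by field.
  by rewrite lerXn2r ?nnegrE ?invr_ge0// ltW.
by move=> ? ?; have : 0 <= radius k ^+ 2 * (1 - radius k ^+ 2); [rewrite mulr_ge0; lra|rewrite !expr2; lra].
Qed.

Lemma terminal_sqmod_ge s : 0 <= s -> s <= t ->
  expR (- (ln 16 + 4 * (L T - L 0))) <= fsqmod a b s.
Proof.
move=> s0 st; have N0 := flow_sqmod_gt0 HD tT Hf terminal_sqmod_gt0 s0 st.
rewrite -(lnK N0) ler_expR; have := terminal_size s0 st; rewrite /log_size.
have : 0 <= ln (1 + fsqmod a b s) by rewrite ln_ge0 ?lerDl ?ltW.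
have := clock_le HD (lexx 0) s0 (le_trans st tT); have := clock_le HD t0 tT (lexx T).
lra.
Qed.

Definition escape_rate := 4 * expR (- angle_bound T n) * expR (- (ln 16 + 4 * (L T - L 0))) ^+ 2.

Lemma escape_rate_gt0 : 0 < escape_rate.
Proof. by rewrite !mulr_gt0 ?exprn_gt0 ?expR_gt0. Qed.

(** Along the flow (1 - N)^2 decreases at the rate 4 N (1 - N)^2 / E. The angle bound gives (1 -
    N)^2 / E >= exp (- angle_bound) N, and the size bound keeps N away from 0. The resulting
    distance from the circle is independent of k, so the limit of the flow lines stays in the disc
    before time t. *)
Lemma terminal_escape s : 0 <= s -> s <= t ->
  escape_rate * (L t - L s) <= 1 - fsqmod a b s.
Proof.
move=> s0 st.
have sub : `[s, t]%classic `<=` `[0, t]%classic by exact: subset_itvcc.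
have N1 x : 0 <= x -> x <= t -> 0 < 1 - fsqmod a b x.
  by move=> x0 xt; rewrite subr_gt0; exact: (flow_sqmod_lt1 HD tT Hf).
have c1 : {within `[s, t], continuous (fun x => 1 - fsqmod a b x)}.
  by apply: withinB; [exact: within_cst|exact: withinS sub (flow_sqmod_within Hf)].
have := @rate_nondecreasing _ T L theta n HD
  (fun x => - ((1 - fsqmod a b x) * (1 - fsqmod a b x) + escape_rate * L x)) s t s0 st tT.
have h0 : 0 <= (1 - fsqmod a b t) * (1 - fsqmod a b t) by rewrite -expr2 sqr_ge0.
have h1 : (1 - fsqmod a b s) * (1 - fsqmod a b s) <= 1 - fsqmod a b s.
  by rewrite ler_piMr ?gerBl ?sqmod_ge0// ltW// N1.
move=> H; suff : - ((1 - fsqmod a b s) * (1 - fsqmod a b s) + escape_rate * L s) <=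
  - ((1 - fsqmod a b t) * (1 - fsqmod a b t) + escape_rate * L t) by lra.
apply: H.
  apply: withinN; apply: withinD; first exact: withinM.
  apply: withinM; first exact: within_cst.
  by apply: withinS (driven_clock_continuous HD); exact: subset_itvcc.
move=> x /andP[sx xt]; have x0 := le_lt_trans s0 sx.
have xr : 0 < x < t by rewrite x0.
have xT : 0 < x < T by rewrite x0 (lt_le_trans xt).
have r1 := rateB (rate_cst L theta 1 x) (flow_sqmod_rate HD tT Hf xr).
exists (- ((1 - fsqmod a b x) * (- (4 * fsqmod a b x * fpoisson theta a b x)) + escape_rate * 1)).
  apply: rate_eq (rateN (rateD (rateM HD xT r1 r1) (rateZ escape_rate (rate_clock L theta x)))).
    by ring.
  by ring.
have E0 := flow_gap_pos Hf xr.
have Nx := flow_sqmod_gt0 HD tT Hf terminal_sqmod_gt0 (ltW x0) (ltW xt).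
have q0 := N1 x (ltW x0) (ltW xt).
rewrite -(pmulr_lge0 _ E0).
rewrite (_ : _ * fgap theta a b x = (1 - fsqmod a b x) * (4 * fsqmod a b x * (fpoisson theta a b x * fgap theta a b x)) - escape_rate * fgap theta a b x); last by ring.
rewrite poisson_gap// -/(fsqmod a b x).
have hA : fgap theta a b x * fsqmod a b x <= expR (angle_bound T n) * (1 - fsqmod a b x) ^+ 2.
  rewrite -ler_ln ?posrE ?mulr_gt0 ?exprn_gt0 ?expR_gt0//.
  rewrite (lnM E0 Nx) lnM ?posrE ?expR_gt0 ?exprn_gt0// expRK lnXn// -(mulr_natl (ln _)).
  have : ln (fsqmod a b x) <= 0.
    by rewrite ln_le0// ltW// (flow_sqmod_lt1 HD tT Hf)// ltW.
  by have := terminal_angle (ltW x0) (ltW xt); rewrite /angle; lra.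
have hN := terminal_sqmod_ge (ltW x0) (ltW xt).
have e0 := expR_gt0 (- (ln 16 + 4 * (L T - L 0))).
rewrite /escape_rate; move: hN e0; set m := expR (- (ln 16 + _)) => hN e0.
have hE := ler_wpM2l (expR_ge0 (- angle_bound T n)) hA.
rewrite mulrA in hE; rewrite [leRHS]mulrA -expRD addNr expR0 mul1r in hE.
have hm : m ^+ 2 <= fsqmod a b x ^+ 2 by rewrite lerXn2r ?nnegrE ?(ltW e0) ?(ltW Nx).
have q1 := ler_wpM2l (mulr_ge0 (expR_ge0 (- angle_bound T n)) (ltW E0)) hm.
have q2 := ler_wpM2r (ltW Nx) hE.
by rewrite !expr2 in q1 q2 *; lra.
Qed.

End terminal_radius.

Lemma tip_exists t : 0 < t -> t <= T -> exists a b, swallowed T L theta t a b.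
Proof.
move=> t_gt0 tT; have t0 := ltW t_gt0.
have /choice[AB HAB] : forall k : nat, exists ab : (R -> R) * (R -> R),
    [/\ disc_flow t ab.1 ab.2, ab.1 t = radius k * cos (theta t) &
        ab.2 t = radius k * sin (theta t)].
  move=> k; have [r1 r2] := radius_itv k.
  have h : sqmod (radius k * cos (theta t)) (radius k * sin (theta t)) < 1.
    rewrite radius_sqmod expr_lt1//; apply: le_trans r1; by rewrite invr_ge0.
  have [a [b [Q [V [Hf [h1 h2 _ _] _ _ _]]]]] := terminal_flow hlam hlam_inv T0 HD t0 tT h.
  by exists (a, b).
pose A k := (AB k).1; pose A' k := (AB k).2.
have HA k : disc_flow t (A k) (A' k) by have [] := HAB k.
have HAt k : A k t = radius k * cos (theta t) by have [] := HAB k.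
have HAt' k : A' k t = radius k * sin (theta t) by have [] := HAB k.
pose S := ln 16 + 4 * (L T - L 0).
have sizeS k s : 0 <= s -> s <= t -> log_size (A k) (A' k) s <= S.
  move=> s0 st; apply: le_trans (terminal_size t0 tT (HA k) (HAt k) (HAt' k) s0 st) _.
  rewrite lerD2l ler_wpM2l// lerB// ?(clock_le HD)//; exact: le_trans tT.
(* The square root of the comparison constant, since [dist] bounds distances and not their
   squares. *)
pose C := expR (2^-1 * comparison_exponent T n S).
have C0 : 0 < C by exact: expR_gt0.
have CC : expR (comparison_exponent T n S) = C ^+ 2.
  by rewrite /C expr2 -expRD; congr expR; field.
have dist k s : 0 <= s <= t -> `|A k.+1 s - A k s| <= C * 2^-1 ^+ k /\ `|A' k.+1 s - A' k s| <= C * 2^-1 ^+ k.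
  move=> /andP[s0 st].
  have h := sqdist_le HD s0 st tT (HA k.+1) (HA k)
    (terminal_sqmod_gt0 t0 tT (HA k.+1) (HAt k.+1) (HAt' k.+1))
    (terminal_sqmod_gt0 t0 tT (HA k) (HAt k) (HAt' k))
    (terminal_angle t0 tT (HA k.+1) (HAt k.+1) (HAt' k.+1) t0 (lexx t))
    (terminal_angle t0 tT (HA k) (HAt k) (HAt' k) t0 (lexx t))
    (sizeS k.+1 s s0 st) (sizeS k s s0 st).
  have e : sqdist (A k.+1) (A' k.+1) (A k) (A' k) t <= (2^-1 ^+ k) ^+ 2.
    rewrite /sqdist !HAt !HAt' -!mulrBl /sqmod !exprMn -mulrDr cos2Dsin2 mulr1.
    rewrite lerXn2r ?nnegrE ?exprn_ge0 ?invr_ge0// /radius ?exprS.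
      by have : 0 <= 2^-1 ^+ k :> R; [rewrite exprn_ge0 ?invr_ge0|lra].
    by have : 0 <= 2^-1 ^+ k :> R; [rewrite exprn_ge0 ?invr_ge0|lra].
  have h' : sqdist (A k.+1) (A' k.+1) (A k) (A' k) s <= (C * 2^-1 ^+ k) ^+ 2.
    by apply: le_trans h _; rewrite CC exprMn ler_wpM2l// sqr_ge0.
  have q0 : 0 <= C * 2^-1 ^+ k by rewrite mulr_ge0 ?(ltW C0)// exprn_ge0 ?invr_ge0.
  by split; rewrite -(@ler_pXn2r _ 2%N) ?nnegrE// real_normK ?num_real//;
    apply: le_trans h'; rewrite /sqdist /sqmod ?lerDl ?lerDr sqr_ge0.
have /choice[a Ha] : forall s, exists l, 0 <= s <= t -> forall k, `|A k s - l| <= 2 * C * 2^-1 ^+ k.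
  move=> s; have [st|] := boolP (0 <= s <= t); last by exists 0.
  by have [|l Hl] := @geometric_limit R (fun k => A k s) C;
    [move=> k; have [] := dist k s st|exists l].
have /choice[b Hb] : forall s, exists l, 0 <= s <= t -> forall k, `|A' k s - l| <= 2 * C * 2^-1 ^+ k.
  move=> s; have [st|] := boolP (0 <= s <= t); last by exists 0.
  by have [|l Hl] := @geometric_limit R (fun k => A' k s) C;
    [move=> k; have [] := dist k s st|exists l].
exists a, b; split => //.
- move=> r r0 rt; have rT := le_trans (ltW rt) tT.
  (* By [terminal_escape] every line satisfies N <= 1 - d up to time r; this is the common bound
     that [limit_flow] asks for. *)
  pose d := escape_rate * (L t - L r).
  have d0 : 0 < d.
    by rewrite mulr_gt0 ?escape_rate_gt0// subr_gt0; exact: (driven_clock_increasing HD).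
  apply: (@limit_flow _ _ _ hlam hlam_inv T0 _ _ HD r (1 - d) (2 * C) A A') => //.
  + by rewrite gtrBl.
  + by move=> k; apply: disc_flowS (HA k); exact: ltW.
  + move=> k s /andP[s0 sr]; have st := le_trans sr (ltW rt).
    have := terminal_escape t0 tT (HA k) (HAt k) (HAt' k) s0 st.
    have : d <= escape_rate * (L t - L s).
      by rewrite ler_wpM2l ?(ltW escape_rate_gt0)// lerB// (clock_le HD).
    lra.
  + move=> k s /andP[s0 sr]; have st : 0 <= s <= t by rewrite s0 (le_trans sr (ltW rt)).
    by split; [exact: Ha|exact: Hb].
- move=> e e0.
  have e1 : 0 < e / 16 by rewrite divr_gt0.
  (* [k1] makes the gap at the k-th endpoint small and [k2] the distance between the k-th line and
     the limit. By continuity the k-th line still has a small gap at a time s just before t, and the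
     triangle inequality carries this over to the limit. *)
  have [k1 hk1] := half_pow_small 1 e1; have [k2 hk2] := half_pow_small (8 * C ^+ 2) e1.
  pose k := (k1 + k2)%N.
  have pk (j : nat) : 0 < 2^-1 ^+ j :> R by rewrite exprn_gt0 ?invr_gt0.
  have pk1 (j : nat) : 2^-1 ^+ j <= 1 :> R by rewrite exprn_ile1 ?invr_ge0//; lra.
  have gk : (1 - radius k) ^+ 2 < e / 16.
    apply: le_lt_trans hk1; rewrite /radius subKr mul1r expr2.
    apply: (@le_trans _ _ (2^-1 ^+ k.+1 * 1)); first by rewrite ler_wpM2l ?(ltW (pk _)).
    by rewrite mulr1 -addnS exprD ler_piMr ?(ltW (pk _)).
  have dk : 2 * (2 * C * 2^-1 ^+ k) ^+ 2 < e / 16.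
    apply: le_lt_trans hk2; rewrite (_ : 2 * _ ^+ 2 = 8 * C ^+ 2 * (2^-1 ^+ k) ^+ 2); last by ring.
    apply: ler_wpM2l; [by apply: mulr_ge0 => //; exact: sqr_ge0|rewrite expr2].
    apply: (@le_trans _ _ (1 * 2^-1 ^+ k)); first by rewrite ler_wpM2r ?(ltW (pk _)).
    by rewrite mul1r /k addnC exprD ler_piMr ?(ltW (pk _)).
  have [_ _ /cvgrPdist_lt/(_ _ e1) Hc] := (continuous_within_itvP _ t_gt0).1 (flow_gap_within HD tT (HA k)).
  near t^'- => s; exists s.
  have st : s < t by near: s; exact: nbhs_left_lt.
  have s0 : 0 <= s by near: s; exact: nbhs_left_ge.
  split => //.
  have hs : `|fgap theta (A k) (A' k) t - fgap theta (A k) (A' k) s| < e / 16 by near: s; exact: Hc.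
  have gt : fgap theta (A k) (A' k) t = (1 - radius k) ^+ 2 by rewrite /fgap HAt HAt' radius_gap.
  have st' : 0 <= s <= t by rewrite s0 ltW.
  have hd : sqdist (A k) (A' k) a b s <= 2 * (2 * C * 2^-1 ^+ k) ^+ 2.
    rewrite /sqdist /sqmod mulr_natl mulr2n; apply: lerD.
      by rewrite -(real_normK (num_real (_ - _))) lerXn2r ?nnegrE ?mulr_ge0 ?(ltW C0) ?(ltW (pk _))// Ha.
    by rewrite -(real_normK (num_real (_ - _))) lerXn2r ?nnegrE ?mulr_ge0 ?(ltW C0) ?(ltW (pk _))// Hb.
  have tri : fgap theta a b s <= 2 * (fgap theta (A k) (A' k) s + sqdist (A k) (A' k) a b s).
    rewrite /sqdist /fgap /gap /sqmod.
    have := sqr_ge0 ((cos (theta s) - A k s) - (A k s - a s)).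
    have := sqr_ge0 ((sin (theta s) - A' k s) - (A' k s - b s)).
    by rewrite !expr2; lra.
  by move: hs; rewrite gt ltr_norml => /andP[h1 h2]; lra.
Unshelve. all: by end_near. Qed.

End tip.

(** * Complex coordinates *)

Section complex_numbers.
Context (R : realType).
Implicit Types (z x y : cplx R) (a b : R).
Local Notation Re := complex.Re.
Local Notation Im := complex.Im.

Lemma cplx_eq z x : Re z = Re x -> Im z = Im x -> z = x.
Proof. by case: z => a b; case: x => c d /= -> ->. Qed.

Lemma cReM z x : Re (z * x) = Re z * Re x - Im z * Im x.
Proof. by case: z => a b; case: x => c d. Qed.

Lemma cImM z x : Im (z * x) = Re z * Im x + Im z * Re x.
Proof. by case: z => a b; case: x => c d. Qed.

Lemma cReD z x : Re (z + x) = Re z + Re x.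
Proof. by case: z => a b; case: x => c d. Qed.

Lemma cImD z x : Im (z + x) = Im z + Im x.
Proof. by case: z => a b; case: x => c d. Qed.

Lemma cReN z : Re (- z) = - Re z.
Proof. by case: z. Qed.

Lemma cImN z : Im (- z) = - Im z.
Proof. by case: z. Qed.

Lemma cReV z : Re z^-1 = Re z / sqmod (Re z) (Im z).
Proof. by case: z. Qed.

Lemma cImV z : Im z^-1 = - Im z / sqmod (Re z) (Im z).
Proof. by case: z => a b; rewrite mulNr. Qed.

Lemma imaginaryE : 'i%R = (0 +i* 1) :> cplx R.
Proof. by rewrite -complexiE. Qed.

Lemma Re_muli z : Re ('i * z) = - Im z.
Proof. by rewrite cReM imaginaryE /= mul0r mul1r sub0r. Qed.

Lemma Im_muli z : Im ('i * z) = Re z.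
Proof. by rewrite cImM imaginaryE /= mul0r mul1r add0r. Qed.

Lemma Re_cexp z : Re (cexp z) = expR (Re z) * cos (Im z).
Proof. by rewrite /cexp cReM /= mul0r subr0. Qed.

Lemma Im_cexp z : Im (cexp z) = expR (Re z) * sin (Im z).
Proof. by rewrite /cexp cImM /= mul0r addr0. Qed.

Definition cxE := (Re_muli, Im_muli, cReM, cImM, cReD, cImD, cReN, cImN, Re_cexp, Im_cexp).

Lemma cexpD z x : cexp (z + x) = cexp z * cexp x.
Proof.
by apply: cplx_eq; rewrite !cxE expRD ?cosD ?sinD; ring.
Qed.

Lemma cexp0 : cexp 0 = 1 :> cplx R.
Proof. by apply: cplx_eq; rewrite !cxE /= expR0 ?cos0 ?sin0 ?mulr1 ?mulr0. Qed.

Lemma cexpN z : cexp z * cexp (- z) = 1.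
Proof. by rewrite -cexpD subrr cexp0. Qed.

Lemma cexp_neq0 z : cexp z != 0.
Proof. by apply/eqP => h; have := cexpN z; rewrite h mul0r => /eqP; rewrite eq_sym oner_eq0. Qed.

Lemma Re_driving (theta : R -> R) t : Re (driving theta t) = cos (theta t).
Proof. by rewrite /driving !cxE /= oppr0 expR0 mul1r. Qed.

Lemma Im_driving (theta : R -> R) t : Im (driving theta t) = sin (theta t).
Proof. by rewrite /driving !cxE /= oppr0 expR0 mul1r. Qed.

(** The norm of [cplx R] takes its values in [cplx R]; this is the same modulus as a real number. *)
Definition cmod z : R := Num.sqrt (sqmod (Re z) (Im z)).

Lemma normcE z : `|z| = (cmod z)%:C.
Proof. by rewrite normc_def. Qed.

Lemma cmod_ge0 z : 0 <= cmod z. Proof. exact: sqrtr_ge0. Qed.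

Lemma cmod_sqr z : cmod z ^+ 2 = sqmod (Re z) (Im z).
Proof. by rewrite sqr_sqrtr ?sqmod_ge0. Qed.

Lemma cmod_le z a : 0 <= a -> (cmod z <= a) = (sqmod (Re z) (Im z) <= a ^+ 2).
Proof. by move=> a0; rewrite -cmod_sqr ler_pXn2r ?nnegrE ?cmod_ge0. Qed.

Lemma cmod_lt z a : 0 <= a -> (cmod z < a) = (sqmod (Re z) (Im z) < a ^+ 2).
Proof. by move=> a0; rewrite -cmod_sqr ltr_pXn2r ?nnegrE ?cmod_ge0. Qed.

Lemma normc_lt1 z : (`|z| < 1) = (sqmod (Re z) (Im z) < 1).
Proof. by rewrite normcE -[1]/((1 : R)%:C) ltcR cmod_lt// expr1n. Qed.

Lemma normc_le1 z : (`|z| <= 1) = (sqmod (Re z) (Im z) <= 1).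
Proof. by rewrite normcE -[1]/((1 : R)%:C) lecR cmod_le// expr1n. Qed.

Lemma Re_le_cmod z : `|Re z| <= cmod z.
Proof. by rewrite -(@ler_pXn2r _ 2%N) ?nnegrE ?cmod_ge0// cmod_sqr real_normK ?num_real// lerDl sqr_ge0. Qed.

Lemma Im_le_cmod z : `|Im z| <= cmod z.
Proof. by rewrite -(@ler_pXn2r _ 2%N) ?nnegrE ?cmod_ge0// cmod_sqr real_normK ?num_real// lerDr sqr_ge0. Qed.

Lemma cmod_le_sum z : cmod z <= `|Re z| + `|Im z|.
Proof.
rewrite cmod_le ?addr_ge0// /sqmod -(real_normK (num_real (Re z))) -(real_normK (num_real (Im z))).
by have := mulr_ge0 (normr_ge0 (Re z)) (normr_ge0 (Im z)); rewrite !expr2; lra.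
Qed.

Lemma cmodD z x : cmod (z + x) <= cmod z + cmod x.
Proof. by have := ler_normD z x; rewrite !normcE -rmorphD /= lecR. Qed.

Lemma cmodM z x : cmod (z * x) = cmod z * cmod x.
Proof.
by apply: (@pexpIrn _ 2%N); rewrite ?nnegrE ?mulr_ge0 ?cmod_ge0// exprMn !cmod_sqr !cxE /sqmod; ring.
Qed.

Lemma cmodN z : cmod (- z) = cmod z.
Proof. by rewrite /cmod !cxE /sqmod !sqrrN. Qed.

Lemma cmod_eq0 z : (cmod z == 0) = (z == 0).
Proof.
by rewrite -(normr_eq0 z) normcE -[0 in RHS]/((0 : R)%:C) (inj_eq (@complexI _)).
Qed.

Lemma cplx_pos_real (e : cplx R) : 0 < e -> exists2 r : R, 0 < r & e = r%:C.
Proof.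
by case: e => a b; rewrite ltcE /= => /andP[/eqP -> a0]; exists a.
Qed.

Lemma poissonE x (theta : R -> R) t :
  Re ((driving theta t + x) / (driving theta t - x)) = poisson (Re x) (Im x) (theta t) /\
  Im ((driving theta t + x) / (driving theta t - x)) = conjugate_poisson (Re x) (Im x) (theta t).
Proof.
have cs := cos2Dsin2 (theta t).
rewrite cReM cImM cReV cImV !cReD !cImD !cReN !cImN Re_driving Im_driving.
rewrite -/(gap (Re x) (Im x) (theta t)) /poisson /conjugate_poisson.
move: (gap _ _ _)^-1 => e; move: cs; move: (cos _) (sin _) (Re x) (Im x) => C S a b cs.
have h1 : C ^+ 2 * e + S ^+ 2 * e = e by rewrite -mulrDl cs mul1r.
by rewrite /sqmod !expr2 in h1 *; split; lra.
Qed.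

Lemma velocityE x (theta : R -> R) (l : R) t :
  Re (l%:C * x * ((driving theta t + x) / (driving theta t - x))) =
    l * (Re x * poisson (Re x) (Im x) (theta t) - Im x * conjugate_poisson (Re x) (Im x) (theta t)) /\
  Im (l%:C * x * ((driving theta t + x) / (driving theta t - x))) =
    l * (Re x * conjugate_poisson (Re x) (Im x) (theta t) + Im x * poisson (Re x) (Im x) (theta t)).
Proof.
have [h1 h2] := poissonE x theta t.
by split; [rewrite cReM h1 h2|rewrite cImM h1 h2]; rewrite !cxE /=; ring.
Qed.

Lemma gap_cmod x (theta : R -> R) t :
  gap (Re x) (Im x) (theta t) = cmod (x - driving theta t) ^+ 2.
Proof.
by rewrite cmod_sqr cReD cImD cReN cImN Re_driving Im_driving /gap /sqmod; ring.
Qed.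

Lemma gap_neq0 x (theta : R -> R) t : (0 < gap (Re x) (Im x) (theta t)) = (x != driving theta t).
Proof.
by rewrite lt_neqAle gap_ge0 andbT eq_sym gap_cmod sqrf_eq0 cmod_eq0 subr_eq0.
Qed.

Lemma Re_norm_gap x (theta : R -> R) t :
  Re `|x - driving theta t| ^+ 2 = gap (Re x) (Im x) (theta t).
Proof. by rewrite normcE /= gap_cmod. Qed.

Lemma cot_half (v : cplx R) : csin (v / 2) != 0 ->
  ccot (v / 2) = - 'i * ((1 + cexp ('i * v)) / (1 - cexp ('i * v))).
Proof.
move=> s0; rewrite /ccot; move: s0; rewrite /ccos /csin.
have ev : cexp ('i * v) = cexp ('i * (v / 2)) * cexp ('i * (v / 2)).
  by rewrite -cexpD -mulrDr -splitr.
set e := cexp ('i * (v / 2)) in ev *; set f := cexp (- ('i * (v / 2))).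
have ef : e * f = 1 by exact: cexpN.
have n2 : 2 != 0 :> cplx R by rewrite pnatr_eq0.
have i0 : 'i%R != 0 :> cplx R by exact: neq0Ci.
have e0 : e != 0 by exact: cexp_neq0.
have fE : f = e^-1 by apply: (mulfI e0); rewrite ef divff.
rewrite mulf_eq0 invr_eq0 mulf_eq0 (negPf i0) (negPf n2) !orbF => s0.
have p1 : 1 - e * e != 0.
  by rewrite -ef -mulrBr mulf_neq0// -opprB oppr_eq0.
have p2 : e * e - 1 != 0 by rewrite -opprB oppr_eq0.
have iV : ('i%R : cplx R)^-1 = - 'i.
  by apply: (mulfI i0); rewrite divff// mulrN -expr2 sqrCi opprK.
rewrite ev fE invf_div -[_ / 2 * _]mulrA.
have -> : 'i%R = - ('i%R : cplx R)^-1 by rewrite iV opprK.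
by field; rewrite p1 i0 e0 p2.
Qed.

End complex_numbers.

Section complex_continuity.
Context (R : realType).
Local Notation Re := complex.Re.
Local Notation Im := complex.Im.

Lemma cvg_cplx (X : Type) (F : set_system X) {FF : Filter F} (x : X -> cplx R) (l : cplx R) :
  x @ F --> l <-> (Re (x y) @[y --> F] --> Re l) /\ (Im (x y) @[y --> F] --> Im l).
Proof.
split.
  move=> /cvgrPdist_lt H; split; apply/cvgrPdist_lt => e e0.
    have /H : 0 < (e%:C : cplx R) by rewrite -[0]/((0 : R)%:C) ltcR.
    apply: filterS => y; rewrite normcE ltcR; apply: le_lt_trans.
    by have := Re_le_cmod (l - x y); rewrite cReD cReN.
  have /H : 0 < (e%:C : cplx R) by rewrite -[0]/((0 : R)%:C) ltcR.
  apply: filterS => y; rewrite normcE ltcR; apply: le_lt_trans.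
  by have := Im_le_cmod (l - x y); rewrite cImD cImN.
move=> [/cvgrPdist_lt H1 /cvgrPdist_lt H2]; apply/cvgrPdist_lt => e e0.
have [r r0 ->] := cplx_pos_real e0.
have r2 : 0 < r / 2 by rewrite divr_gt0.
near=> y; rewrite normcE ltcR; apply: (le_lt_trans (cmod_le_sum _)).
rewrite cReD cReN cImD cImN [r]splitr; apply: ltrD.
  by near: y; exact: H1.
by near: y; exact: H2.
Unshelve. all: by end_near. Qed.

Lemma within_cplx (A : set R) (x : R -> cplx R) :
  {within A, continuous x} <->
  {within A, continuous (fun t => Re (x t))} /\ {within A, continuous (fun t => Im (x t))}.
Proof.
split=> [H|[H1 H2] p]; last by apply/cvg_cplx; split; [exact: H1|exact: H2].
by split=> p; have /cvg_cplx[] := H p.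
Qed.

Lemma within_itvco (f : R -> R) (s : R) :
  (forall r, 0 <= r -> r < s -> {within `[0, r], continuous f}) ->
  {within `[0, s[, continuous f}.
Proof.
move=> H; apply/subspace_continuousP => t /=; rewrite in_itv/= => /andP[t0 ts].
pose r := (t + s) / 2.
have tr : t < r by rewrite /r; lra.
have rs : r < s by rewrite /r; lra.
have r0 : 0 <= r by rewrite ltW// (le_lt_trans t0).
have /subspace_continuousP/(_ t) := H r r0 rs.
rewrite /= in_itv/= t0 (ltW tr) => /(_ isT) /cvgrPdist_lt cf.
apply/cvgrPdist_lt => e e0; have := cf e e0; rewrite !near_withinE => nf.
near=> y => /=; rewrite in_itv/= => /andP[y0 ys]; apply: (near nf y) => //=.
rewrite in_itv/= y0/=; apply/ltW; near: y; exact: lt_nbhsl.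
Unshelve. all: by end_near. Qed.

End complex_continuity.

Lemma Re_cintegral (R : realType) t (f : R -> cplx R) :
  complex.Re (cintegral t f) = \int[lebesgue_measure]_(s in `[0, t]) complex.Re (f s).
Proof. by []. Qed.

Lemma Im_cintegral (R : realType) t (f : R -> cplx R) :
  complex.Im (cintegral t f) = \int[lebesgue_measure]_(s in `[0, t]) complex.Im (f s).
Proof. by []. Qed.

Section trajectories.
Context (R : realType) (T : R) (lam theta n : R -> R).
Context (hlam : weight_function T lam).
Context (hlam_inv : has_ubound (inv_weight_values T lam)).
Context (T0 : 0 < T).
Context (HD : driven T (clock lam) theta n).
Local Notation L := (clock lam).
Local Notation Re := complex.Re.
Local Notation Im := complex.Im.
Implicit Types (x : R -> cplx R) (z : cplx R).

Lemma trajectory_flow J z x r : radial_trajectory lam theta J z x ->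
  `[0, r] `<=` J -> 0 <= r -> r <= T -> `|z| < 1 ->
  disc_flow L theta r (fun s => Re (x s)) (fun s => Im (x s)) /\ x 0 = z.
Proof.
move=> [cx gx ix] sub r0 rT z1.
have J0 : J 0 by apply: sub; rewrite /= in_itv/= lexx.
have x0 : x 0 = z.
  rewrite ix// /cintegral set_itv1 !Rintegral_set1.
  by apply: cplx_eq; rewrite !cxE /= addr0.
split=> //.
have [c1 c2] := (within_cplx _ _).1 (continuous_subspaceW sub cx).
apply: (integral_flow hlam hlam_inv T0 HD rT c1 c2).
- by move=> s sr; rewrite /fgap gap_neq0 gx//; apply: sub; rewrite /= in_itv.
- by rewrite /fsqmod x0 -normc_lt1.
move=> s sr; have Js : J s by apply: sub; rewrite /= in_itv.
rewrite x0 [in X in X /\ _](ix s Js) [in X in _ /\ X](ix s Js) cReD cImD /cintegral /=.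
rewrite /wint; split; congr (_ + _); apply: eq_Rintegral => y _.
  by rewrite (velocityE _ _ _ _).1.
by rewrite (velocityE _ _ _ _).2.
Qed.

Lemma flow_trajectory_at r a b s : r <= T -> disc_flow L theta r a b -> 0 <= s -> s <= r ->
  let x t := (a t +i* b t) : cplx R in
  x s != driving theta s /\
  x s = x 0 + cintegral s (fun s => (lam s)%:C * x s *
          ((driving theta s + x s) / (driving theta s - x s))).
Proof.
move=> rT Hf s0 sr x; have [xr xi] : (forall t, Re (x t) = a t) /\ (forall t, Im (x t) = b t) by [].
clearbody x; split.
  by rewrite -gap_neq0 xr xi; apply: (flow_gap Hf); rewrite s0.
have [ha hb] := flow_integral hlam hlam_inv T0 HD rT Hf s0 sr.
apply: cplx_eq; rewrite ?cReD ?cImD ?xr ?xi ?ha ?hb; congr (_ + _); rewrite /cintegral /=.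
  by apply: eq_Rintegral => y _; rewrite (velocityE _ _ _ _).1 xr xi.
by apply: eq_Rintegral => y _; rewrite (velocityE _ _ _ _).2 xr xi.
Qed.

Lemma swallowed_radial_hull t s a b : s <= t -> swallowed T L theta s a b ->
  radial_hull lam theta t (a 0 +i* b 0).
Proof.
move=> st Hs; have [s0 sT Hf Hi] := Hs.
have start : fsqmod a b 0 < 1 by exact: flow_start (Hf 0 (lexx 0) s0).
split; first by rewrite normc_le1; exact: ltW.
right; exists s, (fun t => a t +i* b t); split.
- by rewrite s0.
- split.
  + apply/within_cplx; split; apply: within_itvco => r r0 rs.
      exact: flow_re_continuous (Hf r r0 rs).
    exact: flow_im_continuous (Hf r r0 rs).
  + move=> r /=; rewrite in_itv/= => /andP[r0 rs].
    by have [] := flow_trajectory_at (le_trans (ltW rs) sT) (Hf r r0 rs) r0 (lexx r).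
  + move=> r /=; rewrite in_itv/= => /andP[r0 rs].
    by have [] := flow_trajectory_at (le_trans (ltW rs) sT) (Hf r r0 rs) r0 (lexx r).
set S := [set _ | _ in _].
have S0 : S !=set0 by exists (Re `|a 0 +i* b 0 - driving theta 0|), 0; rewrite //= in_itv/= lexx.
have Slb : lbound S 0 by move=> _ [r _ <-]; rewrite normcE /= cmod_ge0.
apply/le_anti/andP; split; last exact: lb_le_inf.
apply/ler_addgt0Pl => e e0; rewrite addr0.
have [r [r0 rs hr]] := Hi _ (exprn_gt0 2 e0).
apply: (@le_trans _ _ (Re `|(a r +i* b r : cplx R) - driving theta r|)).
  by apply: ge_inf; [exists 0|exists r; rewrite //= in_itv/= r0].
rewrite -(@ler_pXn2r _ 2%N) ?nnegrE ?(ltW e0)//; last by rewrite normcE /= cmod_ge0.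
by rewrite Re_norm_gap /=; exact: ltW.
Qed.

Lemma cmod_driving t : cmod (driving theta t) = 1.
Proof. by rewrite /cmod Re_driving Im_driving /sqmod cos2Dsin2 sqrtr1. Qed.

Lemma driving_norm t : `|driving theta t| = 1.
Proof. by rewrite normcE cmod_driving. Qed.

Lemma radial_hull_swallowed t z : t <= T -> `|z| < 1 -> radial_hull lam theta t z ->
  exists s a b, [/\ s <= t, swallowed T L theta s a b & z = a 0 +i* b 0].
Proof.
move=> tT z1 [_ [zd|[s [x [/andP[s0 st] tr hinf]]]]].
  by move: z1; rewrite zd driving_norm ltxx.
have sT := le_trans st tT.
have flow r : 0 <= r -> r < s -> disc_flow L theta r (fun s => Re (x s)) (fun s => Im (x s)) /\ x 0 = z.
  move=> r0 rs; apply: (trajectory_flow tr) => //; last exact: le_trans (ltW rs) sT.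
  by move=> y /=; rewrite !in_itv/= => /andP[-> yr]; exact: le_lt_trans rs.
exists s, (fun s => Re (x s)), (fun s => Im (x s)); split => //; last first.
  by have [_ <-] := flow 0 (lexx 0) s0; case: (x 0).
split => //; first by move=> r r0 rs; have [] := flow r r0 rs.
move=> e e0; move: hinf; set S := [set _ | _ in _] => hinf.
have hasS : has_inf S.
  split; first by exists (Re `|x 0 - driving theta 0|), 0; rewrite //= in_itv/= lexx.
  by exists 0 => _ [r _ <-]; rewrite normcE /= cmod_ge0.
have m0 : 0 < Num.min 1 e by rewrite lt_min ltr01.
have [_ [r /= hr <-]] := inf_adherent m0 hasS.
rewrite hinf add0r lt_min => /andP[h1 h2].
move: hr; rewrite in_itv/= => /andP[r0 rs]; exists r; split => //.
rewrite /fgap -Re_norm_gap; apply: le_lt_trans h2.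
by rewrite expr2 ler_piMl ?(ltW h1)// normcE /= cmod_ge0.
Qed.

End trajectories.

Section logarithm.
Context (R : realType).
Local Notation Re := complex.Re.
Local Notation Im := complex.Im.
Implicit Types z : cplx R.

Lemma unit_circle_angle (x y : R) : sqmod x y = 1 -> exists v, cos v = x /\ sin v = y.
Proof.
rewrite /sqmod => h.
have x1 : -1 <= x <= 1.
  by rewrite -ler_norml -(@ler_pXn2r _ 2%N) ?nnegrE// expr1n real_normK ?num_real//; have := sqr_ge0 y; lra.
have cx : cos (acos x) = x by rewrite acosK// in_itv.
have sx : sin (acos x) = `|y|.
  by rewrite sin_acos// -sqrtr_sqr; congr Num.sqrt; lra.
have [y0|y0] := leP 0 y.
  by exists (acos x); rewrite cx sx ger0_norm.
by exists (- acos x); rewrite cosN sinN cx sx ltr0_norm// opprK.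
Qed.

Lemma cexp_surjective z : z != 0 -> `|z| < 1 -> exists2 u : cplx R, 0 < Im u & cexp ('i * u) = z.
Proof.
move=> z0 z1; have m0 : 0 < cmod z by rewrite lt_neqAle cmod_ge0 andbT eq_sym cmod_eq0.
have m1 : cmod z < 1 by move: z1; rewrite normcE -[1]/((1 : R)%:C) ltcR.
have [v [cv sv]] : exists v, cos v = Re z / cmod z /\ sin v = Im z / cmod z.
  apply: unit_circle_angle; rewrite /sqmod !expr_div_n -mulrDl -/(sqmod _ _) -cmod_sqr.
  by rewrite divff// expf_neq0 ?gt_eqF.
exists (v +i* - ln (cmod z)); first by rewrite /= oppr_gt0 ln_lt0// m0.
apply: cplx_eq; rewrite !cxE /= opprK lnK ?posrE// ?cv ?sv mulrC divfK ?gt_eqF//.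
Qed.

End logarithm.

(** * Trajectories in the covering coordinate *)

Section covering.
Context (R : realType) (T : R) (lam theta n : R -> R).
Context (hlam : weight_function T lam).
Context (hlam_inv : has_ubound (inv_weight_values T lam)).
Context (T0 : 0 < T).
Context (HD : driven T (clock lam) theta n).
Local Notation L := (clock lam).
Local Notation Re := complex.Re.
Local Notation Im := complex.Im.
Local Notation disc_flow := (disc_flow L theta).
Local Notation rate := (rate L theta).
Implicit Types (x : R -> cplx R) (z u : cplx R).

(** A swallowed trajectory from the same point would coincide with this flow by uniqueness, yet the
    gap of a flow on the compact interval [0, t] is bounded below. *)
Lemma flow_not_hull t a b : 0 <= t -> t <= T -> disc_flow t a b ->
  ~ radial_hull lam theta t (a 0 +i* b 0).
Proof.
move=> t0 tT Hf hull.
have z1 : `|(a 0 +i* b 0 : cplx R)| < 1 by rewrite normc_lt1; exact: flow_start Hf.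
have [s [a' [b' [st [s0 sT Hs Hi] [ea eb]]]]] := radial_hull_swallowed hlam hlam_inv T0 HD tT z1 hull.
have [e e0 He] := flow_gap_bound HD tT Hf t0.
have [r [r0 rs]] := Hi e e0.
apply/negP; rewrite -leNgt; have rt := ltW (lt_le_trans rs st).
have := sqdist_eq0 HD (le_trans rt tT) (disc_flowS rt Hf) (Hs r r0 rs) (lexx 0) r0 (lexx r).
rewrite {1}/sqdist ea eb !subrr /sqmod expr0n addr0 eqxx => /esym.
rewrite paddr_eq0 ?sqr_ge0// !sqrf_eq0 !subr_eq0 => /andP[/eqP har /eqP hbr].
by rewrite /fgap -har -hbr; apply: He; rewrite r0.
Qed.

Lemma lift_flow r (X Y a b : R -> R) : r <= T ->
  {within `[0, r], continuous X} -> {within `[0, r], continuous Y} -> 0 < Y 0 ->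
  (forall s, a s = expR (- Y s) * cos (X s)) -> (forall s, b s = expR (- Y s) * sin (X s)) ->
  (forall s, 0 <= s <= r -> 0 < fgap theta a b s) ->
  (forall s, 0 < s < r -> rate X s (fconj theta a b s) 0 /\ rate Y s (- fpoisson theta a b s) 0) ->
  disc_flow r a b.
Proof.
move=> rT cX cY Y0 ea eb E0 H.
have cE : {within `[0, r], continuous (fun s => expR (- Y s))} by apply: within_expR; exact: withinN.
have [fa fb] : a = (fun s => expR (- Y s) * cos (X s)) /\ b = (fun s => expR (- Y s) * sin (X s)).
  by split; apply/funext.
split => //.
- rewrite fa; apply: withinM => //; apply: (within_comp _ cX) => y _; exact: continuous_cos.
- rewrite fb; apply: withinM => //; apply: (within_comp _ cX) => y _; exact: continuous_sin.
- move=> s sr; have [rX rY] := H s sr.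
  have sT : 0 < s < T by case/andP: sr => -> /lt_le_trans ->.
  rewrite {1}fa; apply: rate_eq (rateM HD sT (rate_expR HD sT (rateN rY)) (rate_cos_comp HD sT rX));
    rewrite /= ?ea ?eb; ring.
- move=> s sr; have [rX rY] := H s sr.
  have sT : 0 < s < T by case/andP: sr => -> /lt_le_trans ->.
  rewrite {1}fb; apply: rate_eq (rateM HD sT (rate_expR HD sT (rateN rY)) (rate_sin_comp HD sT rX));
    rewrite /= ?ea ?eb; ring.
rewrite /fsqmod /sqmod ea eb !exprMn -mulrDr cos2Dsin2 mulr1 expr_lte1 ?expR_ge0//.
by rewrite expR_lt1 oppr_lt0.
Qed.

Lemma covering_gap (v : cplx R) s :
  (csin ((v - (theta s)%:C) / 2) != 0) = (cexp ('i * v) != driving theta s).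
Proof.
set w := v - _; rewrite /csin.
have i0 : 'i%R != 0 :> cplx R by exact: neq0Ci.
have e0 := cexp_neq0 ('i * (w / 2)).
rewrite mulf_eq0 invr_eq0 mulf_eq0 (negPf i0) pnatr_eq0 !orbF subr_eq0.
rewrite -(inj_eq (mulfI e0)) cexpN -cexpD -mulrDr -splitr /driving.
have -> : 'i * v = 'i * w + 'i * (theta s)%:C by rewrite -mulrDr /w subrK.
rewrite cexpD; set d := cexp ('i * (theta s)%:C).
have d0 : d != 0 by exact: cexp_neq0.
by rewrite -(inj_eq (mulIf d0)) mul1r.
Qed.

Lemma covering_velocity (v : cplx R) s : cexp ('i * v) != driving theta s ->
  let g := cexp ('i * v) in
  Re (ccot ((v - (theta s)%:C) / 2)) = conjugate_poisson (Re g) (Im g) (theta s) /\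
  Im (ccot ((v - (theta s)%:C) / 2)) = - poisson (Re g) (Im g) (theta s).
Proof.
rewrite -covering_gap => s0 g; rewrite (cot_half s0).
have [<- <-] := poissonE g theta s.
set d := driving theta s; have d0 : d != 0 by exact: cexp_neq0.
have -> : (d + g) / (d - g) = (1 + cexp ('i * (v - (theta s)%:C))) / (1 - cexp ('i * (v - (theta s)%:C))).
  have -> : g = d * cexp ('i * (v - (theta s)%:C)).
    by rewrite -cexpD -mulrDr addrC subrK.
  by rewrite -{1 3}[d]mulr1 -mulrDr -mulrBr -mulf_div divff// mul1r.
by move: (_ / _) => q; rewrite mulNr cReN cImN Re_muli Im_muli opprK.
Qed.

(** The rates of the two coordinates of the lift are returned because lifts are later compared
    through them, with no choice of an argument. *)
Lemma covering_trajectory_flow r u x : 0 <= r -> r <= T -> 0 < Im u ->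
  covering_trajectory lam theta `[0, r] u x ->
  let a s := Re (cexp ('i * x s)) in let b s := Im (cexp ('i * x s)) in
  [/\ disc_flow r a b, x 0 = u,
      {within `[0, r], continuous (fun s => Re (x s))} /\
      {within `[0, r], continuous (fun s => Im (x s))} &
      forall s, 0 < s < r -> rate (fun s => Re (x s)) s (fconj theta a b s) 0 /\
                             rate (fun s => Im (x s)) s (- fpoisson theta a b s) 0].
Proof.
move=> r0 rT u0 [cx gx ix] a b.
have [c1 c2] := (within_cplx _ _).1 cx.
have J0 : (`[0, r]%classic : set R) 0 by rewrite /= in_itv/= lexx.
have x0 : x 0 = u.
  rewrite ix// /cintegral set_itv1 !Rintegral_set1.
  by apply: cplx_eq; rewrite !cxE /= addr0.
have ea s : a s = expR (- Im (x s)) * cos (Re (x s)) by rewrite /a !cxE.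
have eb s : b s = expR (- Im (x s)) * sin (Re (x s)) by rewrite /b !cxE.
have E0 s : 0 <= s <= r -> 0 < fgap theta a b s.
  by move=> sr; rewrite /fgap gap_neq0 -covering_gap gx// /= in_itv.
have cE : {within `[0, r], continuous (fun s => expR (- Im (x s)))} by apply: within_expR; exact: withinN.
have ca : {within `[0, r], continuous a}.
  rewrite (_ : a = fun s => expR (- Im (x s)) * cos (Re (x s))); last exact/funext.
  apply: withinM => //; apply: (within_comp _ c1) => y _; exact: continuous_cos.
have cb : {within `[0, r], continuous b}.
  rewrite (_ : b = fun s => expR (- Im (x s)) * sin (Re (x s))); last exact/funext.
  apply: withinM => //; apply: (within_comp _ c1) => y _; exact: continuous_sin.
have [cU cV] := poisson_within HD rT ca cb E0.
have near_eq s (F G : R -> R) : 0 < s < r -> (forall y, 0 <= y <= r -> F y = G y) ->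
    \forall y \near s, F y = G y.
  move=> sr FG; near=> y; apply: FG.
  have /andP[y0 yr] : 0 < y < r by near: y; exact: near_itv.
  by rewrite !ltW.
have [eX eY] : (forall s, 0 <= s <= r -> Re u + wint lam (fconj theta a b) s = Re (x s)) /\
    (forall s, 0 <= s <= r -> Im u + wint lam (fun y => - fpoisson theta a b y) s = Im (x s)).
  have v s : 0 <= s -> s <= r -> Re (ccot ((x s - (theta s)%:C) / 2)) = fconj theta a b s /\
      Im (ccot ((x s - (theta s)%:C) / 2)) = - fpoisson theta a b s.
    by move=> s0 sr; apply: covering_velocity; rewrite -covering_gap gx//= in_itv/= s0.
  have J s : 0 <= s <= r -> (`[0, r]%classic : set R) s by rewrite /= in_itv.
  split=> s sr; rewrite [in RHS](ix s (J s sr)).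
    rewrite cReD Re_cintegral; congr (_ + _).
    apply: eq_Rintegral => y yI; have /andP[y0 ys] : 0 <= y <= s by move: yI; rewrite inE /= in_itv.
    have yr : y <= r by apply: le_trans ys _; case/andP: sr.
    by rewrite cReM (v y y0 yr).1 /= mul0r subr0.
  rewrite cImD Im_cintegral; congr (_ + _).
  apply: eq_Rintegral => y yI; have /andP[y0 ys] : 0 <= y <= s by move: yI; rewrite inE /= in_itv.
  have yr : y <= r by apply: le_trans ys _; case/andP: sr.
  by rewrite cImM (v y y0 yr).2 /= mul0r addr0.
have H s : 0 < s < r -> rate (fun s => Re (x s)) s (fconj theta a b s) 0 /\
                         rate (fun s => Im (x s)) s (- fpoisson theta a b s) 0.
  move=> sr; split.
    apply: (rate_near_eq (near_eq s _ _ sr eX)).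
    by apply: rate_eq (rateD (rate_cst L theta _ s) (wint_rate hlam hlam_inv T0 theta sr rT cV)); ring.
  apply: (rate_near_eq (near_eq s _ _ sr eY)).
  by apply: rate_eq (rateD (rate_cst L theta _ s) (wint_rate hlam hlam_inv T0 theta sr rT (withinN cU))); ring.
split=> //.
by apply: (lift_flow rT c1 c2 _ ea eb E0) => //; rewrite x0.
Unshelve. all: by end_near. Qed.

End covering.

(** * The hull and the chord *)

Section chord.
Context (R : realType) (T : R) (lam theta n : R -> R).
Context (hlam : weight_function T lam).
Context (hlam_inv : has_ubound (inv_weight_values T lam)).
Context (T0 : 0 < T).
Context (HD : driven T (clock lam) theta n).
Context (h : R -> cplx R -> cplx R) (hh : covering_flow T lam theta h).
Local Notation L := (clock lam).
Local Notation Re := complex.Re.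
Local Notation Im := complex.Im.
Local Notation disc_flow := (disc_flow L theta).
Implicit Types (x : R -> cplx R) (z u : cplx R).

(** The trajectory of an unswallowed point up to time t is supplied by [hh] through a logarithm of
    the point, in place of a continuation argument for maximal solutions. The point 0 has no
    logarithm, but it rests. *)
Lemma not_hull_flow t z : 0 <= t -> t <= T -> `|z| < 1 -> ~ radial_hull lam theta t z ->
  exists a b, disc_flow t a b /\ z = a 0 +i* b 0.
Proof.
move=> t0 tT z1 Hz; have [->|z0] := eqVneq z 0.
  by exists (fun=> 0), (fun=> 0); split; [exact: (zero_flow L theta t)|].
have [u u0 eu] := cexp_surjective z0 z1.
have domu : covering_domain lam theta t u by split => //; rewrite eu.
have := hh _ domu; rewrite t0 tT => /(_ isT) Htr.
have [Hf x0 _ _] := covering_trajectory_flow hlam hlam_inv T0 HD t0 tT u0 Htr.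
exists (fun s => Re (cexp ('i * h s u))), (fun s => Im (cexp ('i * h s u))).
by split => //; rewrite -{1}eu -{1}x0; apply: cplx_eq.
Qed.

Lemma within_of_sqr_bound (A : set R) (f : R -> cplx R) :
  (forall t, A t -> exists m : R -> R, [/\ {within A, continuous m}, m t = 0 &
     forall s, A s -> cmod (f t - f s) ^+ 2 <= m s]) ->
  {within A, continuous f}.
Proof.
move=> H; apply/subspace_continuousP => t At; have [m [cm mt Hm]] := H t At.
apply/cvgrPdist_lt => e' e0'; have [e e0 ->] := cplx_pos_real e0'.
move/subspace_continuousP : cm => /(_ t At) /cvgrPdist_lt/(_ _ (exprn_gt0 2 e0)).
rewrite !near_withinE => nm; near=> s => As.
rewrite normcE ltcR cmod_lt ?(ltW e0)// -cmod_sqr; apply: le_lt_trans (Hm s As) _.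
have : `|m t - m s| < e ^+ 2 by apply: (near nm s).
by rewrite mt sub0r normrN; exact: le_lt_trans (ler_norm _).
Unshelve. all: by end_near. Qed.

Lemma disc_minus_hull_connected t z : 0 <= t -> t <= T -> `|z| < 1 ->
  ~ radial_hull lam theta t z ->
  exists C : set (cplx R), [/\ C 0, C z, connected C &
    C `<=` unit_disc (R:=R) `\` radial_hull lam theta t].
Proof.
move=> t0 tT z1 Hz; have [a [b [Hf ez]]] := not_hull_flow t0 tT z1 Hz.
have N1 : fsqmod a b t < 1 := flow_sqmod_lt1 HD tT Hf t0 (lexx t).
have c0 : 0 <= fsqmod a b t by exact: sqmod_ge0.
have sc s : 0 <= s <= 1 -> sqmod (s * a t) (s * b t) <= fsqmod a b t.
  move=> /andP[s0 s1]; rewrite /sqmod !exprMn -mulrDr ler_piMl//.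
  by rewrite expr_le1.
have /choice[P HP] : forall s, exists p : (R -> R) * (R -> R), 0 <= s <= 1 ->
    [/\ disc_flow t p.1 p.2, p.1 t = s * a t & p.2 t = s * b t].
  move=> s; have [s01|_] := boolP (0 <= s <= 1); last by exists (fun=> 0, fun=> 0).
  have [A [B [Q [V [HAB [eA eB _ _] _ _ _]]]]] :=
    terminal_flow hlam hlam_inv T0 HD t0 tT (le_lt_trans (sc s s01) N1).
  by exists (A, B).
pose F s : cplx R := (P s).1 0 +i* (P s).2 0.
(* By uniqueness the starting point depends on the endpoint only, so [F 0] and [F 1] can be computed
   from the resting line and from the given flow instead of the chosen lines. *)
have start s A B : 0 <= s <= 1 -> disc_flow t A B -> A t = s * a t -> B t = s * b t ->
    F s = A 0 +i* B 0.
  move=> s01 HAB eA eB; have [H e1 e2] := HP s s01.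
  have := sqdist_eq0 HD tT H HAB (lexx 0) t0 (lexx t).
  rewrite {2}/sqdist e1 e2 eA eB !subrr /sqmod expr0n addr0 eqxx.
  rewrite paddr_eq0 ?sqr_ge0// !sqrf_eq0 !subr_eq0 => /andP[/eqP h1 /eqP h2].
  by rewrite /F h1 h2.
exists (F @` `[0, 1]); split.
- exists 0; first by rewrite /= in_itv/= lexx ler01.
  by rewrite (start 0 (fun=> 0) (fun=> 0)) ?lexx ?ler01 ?mul0r//; exact: (zero_flow L theta t).
- exists 1; first by rewrite /= in_itv/= lexx ler01.
  by rewrite (start 1 a b) ?lexx ?ler01 ?mul1r.
- apply: connected_continuous_connected; first exact: segment_connected.
  apply: within_of_sqr_bound => s; rewrite /= in_itv/= => s01.
  exists (fun r => (s - r) ^+ 2 * (fsqmod a b t * expR (lipschitz_rate (fsqmod a b t) * (L t - L 0)))); split.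
  + apply: withinM; last exact: within_cst.
    under [X in continuous X]eq_fun do rewrite expr2.
    have cid : {within `[0, 1], continuous (@id R)} by apply: continuous_subspaceT => x; exact: cvg_id.
    by apply: withinM; apply: withinB => //; exact: within_cst.
  + by rewrite subrr expr0n mul0r.
  move=> r; rewrite /= in_itv/= => r01.
  have [H e1 e2] := HP s s01; have [H' e1' e2'] := HP r r01.
  have := sqdist_backward HD tT H H' N1 (lexx 0) t0 (lexx t).
  rewrite /fsqmod e1 e2 e1' e2' => /(_ (sc s s01) (sc r r01)).
  rewrite {2}/sqdist e1 e2 e1' e2' cmod_sqr cReD cImD cReN cImN /= mulrA => hle.
  apply: le_trans hle _; rewrite ler_wpM2r ?expR_ge0//.
  by rewrite -!mulrBl /sqmod !exprMn -mulrDr.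
move=> _ [s /= s01 <-]; rewrite in_itv/= in s01; have [H _ _] := HP s s01; split.
  by rewrite /unit_disc /= normc_lt1; exact: flow_start H.
exact: (flow_not_hull hlam hlam_inv T0 HD t0 tT H).
Qed.

(** Time 0 is prescribed separately because [swallowed] requires a positive time. *)
Definition tip_curve (gamma : R -> cplx R) := gamma 0 = driving theta 0 /\
  forall t, 0 < t -> t <= T -> exists a b, swallowed T L theta t a b /\ gamma t = a 0 +i* b 0.

Lemma tip_curve_exists : exists gamma, tip_curve gamma.
Proof.
have /choice[P HP] : forall t, exists p : (R -> R) * (R -> R), 0 < t <= T ->
    swallowed T L theta t p.1 p.2.
  move=> t; have [/andP[t0 tT]|_] := boolP (0 < t <= T); last by exists (fun=> 0, fun=> 0).
  by have [a [b Hs]] := tip_exists hlam hlam_inv T0 HD t0 tT; exists (a, b).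
exists (fun t => if t == 0 then driving theta 0 else (P t).1 0 +i* (P t).2 0); split.
  by rewrite eqxx.
move=> t t0 tT; exists (P t).1, (P t).2; rewrite gt_eqF//; split => //.
by apply: HP; rewrite t0.
Qed.

Context (gamma : R -> cplx R) (Hg : tip_curve gamma).

Lemma tip_in_disc t : 0 < t -> t <= T -> `|gamma t| < 1.
Proof.
move=> t0 tT; have [a [b [[_ _ Hf _] ->]]] := Hg.2 t t0 tT.
by rewrite normc_lt1; exact: flow_start (Hf 0 (lexx 0) t0).
Qed.

Lemma tip_in_hull t : 0 <= t -> t <= T -> radial_hull lam theta t (gamma t).
Proof.
rewrite le_eqVlt => /predU1P[<- _|t0 tT].
  by rewrite Hg.1; split; [rewrite driving_norm|left].
have [a [b [Hs ->]]] := Hg.2 t t0 tT.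
exact: (swallowed_radial_hull hlam hlam_inv T0 HD (lexx t) Hs).
Qed.

Lemma tip_not_in_hull s t : 0 <= s -> s < t -> t <= T -> ~ radial_hull lam theta s (gamma t).
Proof.
move=> s0 st tT; have [a [b [[_ _ Hf _] ->]]] := Hg.2 t (le_lt_trans s0 st) tT.
exact: (flow_not_hull hlam hlam_inv T0 HD s0 (le_trans (ltW st) tT) (Hf s s0 st)).
Qed.

Lemma radial_hullS s t : s <= t -> radial_hull lam theta s `<=` radial_hull lam theta t.
Proof.
move=> st z [z1 [zd|[r [x [/andP[r0 rs] tr hinf]]]]]; split => //; first by left.
by right; exists r, x; split => //; rewrite r0 (le_trans rs).
Qed.

Lemma tip_modulus0 : tip_modulus T n 0 = 0.
Proof. by rewrite /tip_modulus mulr0 expR0 subrr mulr0. Qed.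

(** Two trajectories swallowed at the same time s start at the same point, by [swallowed_dist] with
    clock increment 0. So inside the disc the hull is the trace itself, and the component of 0 has
    only to be shown to be the whole complement. *)
Lemma hull_eq_curve t : 0 <= t -> t <= T ->
  unit_disc (R:=R) `\` radial_hull lam theta t = unit_disc (R:=R) `\` (gamma @` `[0, t]).
Proof.
move=> t0 tT; apply/seteqP; split=> z [z1 Hz]; split => //; apply: contra_not Hz.
  move=> [s /=]; rewrite in_itv/= => /andP[s0 st] <-.
  exact: (radial_hullS st (tip_in_hull s0 (le_trans st tT))).
move=> hull; have [s [a [b [st Hs ez]]]] := radial_hull_swallowed hlam hlam_inv T0 HD tT z1 hull.
have s0 := swallowed_gt0 Hs; have sT := swallowed_leT Hs.
exists s; first by rewrite /= in_itv/= (ltW s0).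
have [a' [b' [Hs' ->]]] := Hg.2 s s0 sT.
have := swallowed_dist HD Hs' Hs (lexx s).
rewrite subrr tip_modulus0 !mulr0 /sqdist => le0.
have : sqmod (a' 0 - a 0) (b' 0 - b 0) == 0 by rewrite eq_le le0 sqmod_ge0.
rewrite paddr_eq0 ?sqr_ge0// !sqrf_eq0 !subr_eq0 => /andP[/eqP -> /eqP ->].
by rewrite ez.
Qed.

Lemma tip_continuous : {within `[0, T], continuous gamma}.
Proof.
(* The summand 1 makes K >= 1, which covers the comparison with time 0: there [swallowed_gap] bounds
   the squared distance by [tip_modulus] itself. *)
pose K := expR (comparison_exponent T n (start_size T L)) * 2 + 1.
have K0 : 0 <= K by rewrite addr_ge0// mulr_ge0// expR_ge0.
have tm_ge0 l : 0 <= l -> 0 <= tip_modulus T n l.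
  move=> l0; rewrite /tip_modulus !mulr_ge0 ?expR_ge0// subr_ge0 -expR0 ler_expR.
  by rewrite mulr_ge0.
have dist s s' : 0 <= s -> s <= s' -> s' <= T ->
    cmod (gamma s - gamma s') ^+ 2 <= K * tip_modulus T n (L s' - L s).
  move=> s0 ss' s'T; have tm0 : 0 <= tip_modulus T n (L s' - L s).
    by apply: tm_ge0; rewrite subr_ge0; apply: (clock_le HD).
  move: s0 ss' tm0; rewrite le_eqVlt => /predU1P[<- s'0 tm0|s0 ss' tm0].
    move: s'0; rewrite le_eqVlt => /predU1P[<-|s'0].
      by rewrite !subrr tip_modulus0 mulr0 /cmod /= /sqmod expr0n addr0 sqrtr0 expr0n.
    have [a [b [Hs ->]]] := Hg.2 s' s'0 s'T.
    have := swallowed_gap HD Hs (lexx 0) s'0; rewrite /fgap -[a 0]/(Re (a 0 +i* b 0 : cplx R)).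
    rewrite -[b 0]/(Im (a 0 +i* b 0 : cplx R)) gap_cmod Hg.1 -cmodN opprB => hle.
    by apply: le_trans hle _; rewrite ler_peMl// lerDr mulr_ge0// expR_ge0.
  have [a' [b' [Hs' ->]]] := Hg.2 s s0 (le_trans ss' s'T).
  have [a [b [Hs ->]]] := Hg.2 s' (lt_le_trans s0 ss') s'T.
  rewrite cmod_sqr cReD cImD cReN cImN /=; apply: le_trans (swallowed_dist HD Hs' Hs ss') _.
  by rewrite mulrA ler_wpM2r// lerDl.
apply: within_of_sqr_bound => t; rewrite /= in_itv/= => /andP[t0 tT].
exists (fun s => K * tip_modulus T n `|L s - L t|); split.
- apply: withinM; first exact: within_cst.
  apply: withinM; first exact: within_cst.
  apply: withinB; last exact: within_cst.
  apply: within_expR; apply: withinM; first exact: within_cst.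
  apply: (within_comp (phi := Num.norm)); first by move=> x _; exact: norm_continuous.
  by apply: withinB; [exact: driven_clock_continuous HD|exact: within_cst].
- by rewrite subrr normr0 tip_modulus0 mulr0.
move=> s; rewrite /= in_itv/= => /andP[s0 sT].
have [ts|/ltW st] := leP t s.
  by rewrite ger0_norm; [exact: dist|rewrite subr_ge0; apply: (clock_le HD)].
rewrite -cmodN opprB ler0_norm ?opprB; first exact: dist.
by rewrite subr_le0; apply: (clock_le HD).
Qed.

Lemma tip_generates : generates_radial_chord T lam theta gamma.
Proof.
split; first exact: tip_continuous.
- move=> t /andP[]; rewrite le_eqVlt => /predU1P[<- _|t0 tT].
    by rewrite Hg.1 driving_norm.
  exact/ltW/tip_in_disc.
- exact: Hg.1.
move=> t /andP[t0 tT]; rewrite -(hull_eq_curve t0 tT); apply/seteqP; split; last first.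
  exact: connected_component_sub.
move=> z [z1 Hz]; have [C [C0 Cz Cc Csub]] := disc_minus_hull_connected t0 tT z1 Hz.
exact: (connected_component_max C0 Csub Cc).
Qed.

Lemma tip_simple : simple_chord T gamma.
Proof.
split; last first.
  move=> _ [t t0T <-]; move: t0T; rewrite /= in_itv/= => /andP[t0 tT].
  exact: tip_in_disc.
have lt_neq s t : 0 <= s -> s < t -> t <= T -> gamma s <> gamma t.
  move=> s0 st tT e; apply: (tip_not_in_hull s0 st tT); rewrite -e.
  exact: (tip_in_hull s0 (le_trans (ltW st) tT)).
move=> s t; rewrite !inE /= !in_itv/= => /andP[s0 sT] /andP[t0 tT] e.
have [st|ts|//] := ltgtP s t; first by have := lt_neq s t s0 st tT; rewrite e.
by have := lt_neq t s t0 ts sT; rewrite e.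
Qed.

End chord.

(** * The inverse map and its derivative *)

Section inverse_flow.
Context (R : realType) (T : R) (lam theta n : R -> R).
Context (hlam : weight_function T lam).
Context (hlam_inv : has_ubound (inv_weight_values T lam)).
Context (T0 : 0 < T).
Context (HD : driven T (clock lam) theta n).
Context (h : R -> cplx R -> cplx R) (hh : covering_flow T lam theta h).
Local Notation L := (clock lam).
Local Notation Re := complex.Re.
Local Notation Im := complex.Im.
Local Notation disc_flow := (disc_flow L theta).
Local Notation rate := (rate L theta).
Implicit Types (x : R -> cplx R) (z u : cplx R).

(* The flow line ending at exp(i z) at time t; its lift is
   z - V s + i * Q s at time s. *)
Record ends_at t z (a b Q V : R -> R) : Prop := EndsAt {
  ends_flow : disc_flow t a b;
  ends_re : a t = Re (cexp ('i * z));
  ends_im : b t = Im (cexp ('i * z));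
  ends_Q : Q t = 0;
  ends_V : V t = 0;
  ends_Q_continuous : {within `[0, t], continuous Q};
  ends_V_continuous : {within `[0, t], continuous V};
  ends_Q_rate : forall s, 0 < s < t -> rate Q s (- fpoisson theta a b s) 0;
  ends_V_rate : forall s, 0 < s < t -> rate V s (- fconj theta a b s) 0;
  ends_start : a 0 +i* b 0 = cexp ('i * ((Re z - V 0) +i* (Im z + Q 0))) }.

Lemma cexp_upper_half_plane z : 0 < Im z -> sqmod (Re (cexp ('i * z))) (Im (cexp ('i * z))) < 1.
Proof.
move=> z0; rewrite !cxE /sqmod !exprMn -mulrDr cos2Dsin2 mulr1 expr_lte1 ?expR_ge0//.
by rewrite expR_lt1 oppr_lt0.
Qed.

Lemma ends_at_exists t z : 0 <= t -> t <= T -> 0 < Im z -> exists a b Q V, ends_at t z a b Q V.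
Proof.
move=> t0 tT z0.
have [a [b [Q [V [Hf [at_ bt Qt Vt] [cQ cV] ab r]]]]] :=
  terminal_flow hlam hlam_inv T0 HD t0 tT (cexp_upper_half_plane z0).
exists a, b, Q, V; split => //; try by move=> s /r[].
have [-> ->] := ab 0; apply: cplx_eq; rewrite !cxE /= /exp_re /exp_im opprD expRD ?cosB ?sinB; ring.
Qed.

Lemma disc_flow_unique t a b a' b' s s' : t <= T -> disc_flow t a b -> disc_flow t a' b' ->
  0 <= s <= t -> 0 <= s' <= t -> a s = a' s -> b s = b' s -> a s' = a' s' /\ b s' = b' s'.
Proof.
move=> tT Hf Hf' /andP[s0 st] /andP[s0' st'] ea eb.
have e0 : sqdist a b a' b' s == 0 by rewrite /sqdist ea eb !subrr /sqmod expr0n addr0.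
have : sqdist a b a' b' s' == 0.
  rewrite -(sqdist_eq0 HD tT Hf Hf' (lexx 0) s0' st').
  by rewrite (sqdist_eq0 HD tT Hf Hf' (lexx 0) s0 st).
by rewrite paddr_eq0 ?sqr_ge0// !sqrf_eq0 !subr_eq0 => /andP[/eqP -> /eqP ->].
Qed.

(** Agreement in the disc at either end of [0, t] propagates to all times by uniqueness; then Re x +
    V and Im x - Q have rate 0 and are constant. Agreement at time 0 serves to show that z is
    attained, agreement at time t that its preimage is unique. *)
Lemma covering_end t z a b Q V u x : 0 <= t -> t <= T -> ends_at t z a b Q V -> 0 < Im u ->
  covering_trajectory lam theta `[0, t] u x ->
  (x t = z \/ cexp ('i * u) = a 0 +i* b 0) ->
  Re (x t) = Re u + V 0 /\ Im (x t) = Im u - Q 0.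
Proof.
move=> t0 tT He u0 Htr Hend.
have [Hf x0 [c1 c2] r] := covering_trajectory_flow hlam hlam_inv T0 HD t0 tT u0 Htr.
have agree s : 0 <= s <= t -> a s = Re (cexp ('i * x s)) /\ b s = Im (cexp ('i * x s)).
  move=> st; case: Hend => [xt|start].
    apply: (disc_flow_unique tT (ends_flow He) Hf (s := t)) => //; rewrite ?t0 ?lexx// xt.
      exact: (ends_re He).
    exact: (ends_im He).
  by apply: (disc_flow_unique tT (ends_flow He) Hf (s := 0)) => //; rewrite ?t0 ?lexx// x0 start.
have rs s : 0 < s < t -> rate (fun s => Re (x s)) s (fconj theta a b s) 0 /\
                         rate (fun s => Im (x s)) s (- fpoisson theta a b s) 0.
  move=> st; have := r s st; rewrite /fpoisson /fconj.
  by have [|-> ->] := agree s; first by case/andP: st => /ltW -> /ltW.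
have HV := @rate_constant _ T L theta n HD (fun s => Re (x s) + V s) 0 t (lexx 0) t0 tT.
have HQ := @rate_constant _ T L theta n HD (fun s => Im (x s) - Q s) 0 t (lexx 0) t0 tT.
rewrite (ends_V He) addr0 x0 in HV; rewrite (ends_Q He) subr0 x0 in HQ; split.
  apply: HV; first by apply: withinD => //; exact: ends_V_continuous He.
  by move=> s st; apply: rate_eq (rateD (rs s st).1 (ends_V_rate He st)); rewrite ?subrr ?addr0.
apply: HQ; first by apply: withinB => //; exact: ends_Q_continuous He.
by move=> s st; apply: rate_eq (rateB (rs s st).2 (ends_Q_rate He st)); rewrite ?subrr.
Qed.

(** The lift at time 0 of the flow line ending at z is mapped to z by [h t], so the partial inverse
    returns some preimage of z; that preimage has the same lift at time 0. *)
Lemma inverse_flowE t z a b Q V : 0 <= t -> t <= T -> ends_at t z a b Q V ->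
  inverse_flow lam theta h t z = (Re z - V 0) +i* (Im z + Q 0).
Proof.
move=> t0 tT He; have tI : 0 <= t <= T by rewrite t0.
set u0 : cplx R := _ +i* _; have start := ends_start He; rewrite -/u0 in start.
have u0_gt0 : 0 < Im u0.
  have [ea eb] : a 0 = Re (cexp ('i * u0)) /\ b 0 = Im (cexp ('i * u0)) by rewrite -start.
  have := flow_start (ends_flow He); rewrite /fsqmod ea eb !cxE /sqmod !exprMn -mulrDr cos2Dsin2 mulr1 expr_lte1 ?expR_ge0//.
  by rewrite expR_lt1 oppr_lt0.
have dom : covering_domain lam theta t u0.
  split => //; rewrite -start; split.
    by rewrite /unit_disc /= normc_lt1; exact: flow_start (ends_flow He).
  exact: (flow_not_hull hlam hlam_inv T0 HD t0 tT (ends_flow He)).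
have hu0 : h t u0 = z.
  have [h1 h2] := covering_end t0 tT He u0_gt0 (hh tI dom) (or_intror (esym start)).
  by apply: cplx_eq; rewrite ?h1 ?h2 /u0 /=; ring.
have im : (h t @` covering_domain lam theta t) z by exists u0.
have fz : h t (inverse_flow lam theta h t z) = z.
  by apply: (pinvK (fun=> 0) (mem_set im)).
have fdom : covering_domain lam theta t (inverse_flow lam theta h t z).
  have surj : set_surj (covering_domain lam theta t) (h t @` covering_domain lam theta t) (h t) by [].
  by apply: (surjpinv_image_sub surj); exists z.
have [h1 h2] := covering_end t0 tT He fdom.1 (hh tI fdom) (or_introl fz).
by rewrite fz in h1 h2; apply: cplx_eq; rewrite /u0 /= ?h1 ?h2; ring.
Qed.

End inverse_flow.

(** * Complex differentiability from quadratic error bounds *)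

Section complex_derivative.
Context (R : realType).
Local Notation Re := complex.Re.
Local Notation Im := complex.Im.
Implicit Types (z w : cplx R).

Lemma cmod_i z : cmod ('i * z) = cmod z.
Proof. by rewrite /cmod Re_muli Im_muli /sqmod sqrrN addrC. Qed.

Lemma cmod1 : cmod (1 : cplx R) = 1.
Proof. by rewrite /cmod /sqmod /= expr1n expr0n addr0 sqrtr1. Qed.

Lemma cexp_taylor : exists2 C : R, 0 < C &
  forall w, cmod w <= 1 -> cmod (cexp w - 1 - w) <= C * cmod w ^+ 2.
Proof.
have r2 : 0 < 2 :> R by rewrite ltr0n.
pose K : R := expR 2.
have K1 : 1 <= K by rewrite /K -expR0 ler_expR.
exists (3 * K + 1); first by lra.
move=> w w1; have p1 : `|Re w| <= 1 := le_trans (Re_le_cmod w) w1.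
have q1 : `|Im w| <= 1 := le_trans (Im_le_cmod w) w1.
rewrite cmod_sqr; apply: (le_trans (cmod_le_sum _)).
rewrite !cxE /=; move: (Re w) (Im w) p1 q1 => p q p1 q1.
have lt2 (x : R) : `|x| <= 1 -> `|0 - x| < 2.
  by move=> x1; rewrite sub0r normrN; apply: le_lt_trans x1 _; rewrite ltr1n.
have hp : `|expR p - 1 - p| <= K * p ^+ 2.
  have : `|expR p - expR 0 - expR 0 * (p - 0)| <= K * (p - 0) ^+ 2.
    apply: (@taylor1_quadratic R (@expR R) (@expR R) (@expR R) 0 2) (lt2 _ p1) => // y.
    rewrite sub0r normrN => /ltW y2; rewrite ger0_norm ?expR_ge0// /K ler_expR.
    exact: le_trans (ler_norm _) y2.
  by rewrite expR0 !subr0 mul1r.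
have hc : `|cos q - 1| <= q ^+ 2.
  have : `|cos q - cos 0 - - sin 0 * (q - 0)| <= 1 * (q - 0) ^+ 2.
    apply: (@taylor1_quadratic R (@cos R) (fun y => - sin y) (fun y => - cos y) 0 2) (lt2 _ q1) => // y _.
    by rewrite normrN ler_norml cos_geN1 cos_le1.
  by rewrite cos0 sin0 oppr0 mul0r addr0 !subr0 mul1r.
have hs : `|sin q - q| <= q ^+ 2.
  have : `|sin q - sin 0 - cos 0 * (q - 0)| <= 1 * (q - 0) ^+ 2.
    apply: (@taylor1_quadratic R (@sin R) (@cos R) (fun y => - sin y) 0 2) (lt2 _ q1) => // y _.
    by rewrite normrN ler_norml sin_geN1 sin_le1.
  by rewrite cos0 sin0 !subr0 !mul1r.
have eK : `|expR p| <= K.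
  rewrite ger0_norm ?expR_ge0// /K ler_expR; apply: le_trans (ler_norm _) _.
  by apply: (le_trans p1); rewrite ler1n.
have ep : `|expR p - 1| <= (K + 1) * `|p|.
  rewrite (_ : expR p - 1 = (expR p - 1 - p) + p); last by ring.
  apply: le_trans (ler_normD _ _) _; rewrite mulrDl mul1r lerD2r; apply: le_trans hp _.
  rewrite -(real_normK (num_real p)) expr2 mulrA ler_piMr// mulr_ge0//; lra.
have e1 : expR p * cos q - 1 - p = (expR p - 1 - p) + expR p * (cos q - 1) by ring.
have e2 : expR p * sin q - 0 - q = expR p * (sin q - q) + (expR p - 1) * q by ring.
have pq : `|p| * `|q| <= p ^+ 2 + q ^+ 2.
  rewrite -(real_normK (num_real p)) -(real_normK (num_real q)).
  by have := sqr_ge0 (`|p| - `|q|); have := mulr_ge0 (normr_ge0 p) (normr_ge0 q); rewrite !expr2; lra.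
have b1 : `|expR p * (cos q - 1)| <= K * q ^+ 2 by rewrite normrM ler_pM.
have b2 : `|expR p * (sin q - q)| <= K * q ^+ 2 by rewrite normrM ler_pM.
have b3 : `|(expR p - 1) * q| <= (K + 1) * (p ^+ 2 + q ^+ 2).
  rewrite normrM; apply: le_trans (ler_wpM2r (normr_ge0 q) ep) _.
  by rewrite -mulrA ler_wpM2l//; lra.
have t1 := ler_normD (expR p - 1 - p) (expR p * (cos q - 1)).
have t2 := ler_normD (expR p * (sin q - q)) ((expR p - 1) * q).
rewrite e1 e2 /sqmod; have p2 := sqr_ge0 p; have q2 := sqr_ge0 q.
have : 0 <= K * p ^+ 2 by rewrite mulr_ge0//; lra.
have : 0 <= K * q ^+ 2 by rewrite mulr_ge0//; lra.
by lra.
Qed.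

Lemma cmod_cexp w : cmod (cexp w) = expR (Re w).
Proof.
apply: (@pexpIrn _ 2%N); rewrite ?nnegrE ?cmod_ge0 ?expR_ge0// cmod_sqr !cxE /sqmod.
by rewrite !exprMn -mulrDr cos2Dsin2 mulr1.
Qed.

Lemma derive_of_quadratic_error (f : cplx R -> cplx R) z (A : cplx R) K d : 0 <= K -> 0 < d ->
  (forall w, cmod w < d -> cmod (f (w + z) - f z - A * w) <= K * cmod w ^+ 2) ->
  derivable f z 1 /\ derive1 f z = A.
Proof.
move=> K0 d0 H.
have cv : w^-1 *: ((f \o shift z) (w *: 1) - f z) @[w --> 0^'] --> A.
  apply/cvgrPdist_lt => e' e0'; have [e e0 ->] := cplx_pos_real e0'.
  have m0 : 0 < Num.min d (e / (K + 1)).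
    by rewrite lt_min d0 divr_gt0// ltr_wpDl.
  have m0' : 0 < ((Num.min d (e / (K + 1)))%:C : cplx R) by rewrite -[0]/((0 : R)%:C) ltcR.
  near=> w.
  have w0 : w != 0 by near: w; exact: nbhs_dnbhs_neq.
  have : `|w| < (Num.min d (e / (K + 1)))%:C.
    by near: w; exact: dnbhs0_lt.
  rewrite !normcE !ltcR lt_min => /andP[wd we].
  have cw0 : 0 < cmod w by rewrite lt_neqAle cmod_ge0 andbT eq_sym cmod_eq0.
  have -> : A - w^-1 *: ((f \o shift z) (w *: 1) - f z) = w^-1 * - (f (w + z) - f z - A * w).
    by rewrite /= [w *: 1]mulr1 [w^-1 *: _]/(w^-1 * _) opprB mulrBr mulrCA mulVf// mulr1.
  have cV : cmod w^-1 = (cmod w)^-1.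
    by apply: (mulfI (lt0r_neq0 cw0)); rewrite -cmodM divff// divff ?cmod1// gt_eqF.
  rewrite cmodM cmodN cV mulrC ltr_pdivrMr//; apply: le_lt_trans (H w wd) _.
  rewrite expr2 mulrA ltr_pM2r//; rewrite ltr_pdivlMr ?ltr_wpDl// in we.
  by apply: le_lt_trans we; rewrite mulrC ler_wpM2l ?cmod_ge0//; lra.
split; first by apply/cvg_ex; exists A.
by rewrite derive1E; apply: cvg_lim.
Unshelve. all: by end_near. Qed.

End complex_derivative.

Section flow_difference.
Context (R : realType) (T : R) (lam theta n : R -> R).
Context (hlam : weight_function T lam).
Context (hlam_inv : has_ubound (inv_weight_values T lam)).
Context (T0 : 0 < T).
Context (HD : driven T (clock lam) theta n).
Local Notation L := (clock lam).
Local Notation Re := complex.Re.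
Local Notation Im := complex.Im.
Local Notation disc_flow := (disc_flow L theta).
Local Notation rate := (rate L theta).
Local Notation mult_re := (mult_re theta).
Local Notation mult_im := (mult_im theta).
Implicit Types (z u : cplx R) (a b : R -> R).

Definition log_mult t a b a' b' : cplx R :=
  wint lam (mult_re a b a' b') t +i* wint lam (mult_im a b a' b') t.

(** The difference d of the trajectories solves a linear equation with a complex multiplier m, so d
    exp (- int m dL) is constant; [H1] and [H2] concern its real and imaginary parts. The formula is
    exact for two distinct lines, and letting them merge yields the complex derivative. *)
Lemma flow_difference t a b a' b' : 0 <= t -> t <= T -> disc_flow t a b -> disc_flow t a' b' ->
  (a 0 +i* b 0 : cplx R) - (a' 0 +i* b' 0) =
  ((a t +i* b t) - (a' t +i* b' t)) * cexp (- log_mult t a b a' b').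
Proof.
move=> t0 tT Hf Hf'.
have cm := mult_re_within HD tT Hf Hf'; have cn := mult_im_within HD tT Hf Hf'.
set P := wint lam (mult_re a b a' b'); set Q := wint lam (mult_im a b a' b').
have cP : {within `[0, t], continuous P} := wint_within hlam t0 tT cm.
have cQ : {within `[0, t], continuous Q} := wint_within hlam t0 tT cn.
have cE : {within `[0, t], continuous (fun s => expR (- P s))} by apply: within_expR; exact: withinN.
have cC : {within `[0, t], continuous (fun s => cos (Q s))}.
  by apply: (within_comp _ cQ) => x _; exact: continuous_cos.
have cS : {within `[0, t], continuous (fun s => sin (Q s))}.
  by apply: (within_comp _ cQ) => x _; exact: continuous_sin.
have da : {within `[0, t], continuous (fun s => a s - a' s)}.
  by apply: withinB; [exact: flow_re_continuous Hf|exact: flow_re_continuous Hf'].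
have db : {within `[0, t], continuous (fun s => b s - b' s)}.
  by apply: withinB; [exact: flow_im_continuous Hf|exact: flow_im_continuous Hf'].
have H1 := @rate_constant _ T L theta n HD
  (fun s => expR (- P s) * ((a s - a' s) * cos (Q s) + (b s - b' s) * sin (Q s))) 0 t (lexx 0) t0 tT.
have H2 := @rate_constant _ T L theta n HD
  (fun s => expR (- P s) * ((b s - b' s) * cos (Q s) - (a s - a' s) * sin (Q s))) 0 t (lexx 0) t0 tT.
rewrite /P /Q !wint0 oppr0 expR0 cos0 sin0 -/P -/Q in H1 H2.
have rates s : 0 < s < t -> [/\ 0 < s < T,
    rate (fun s => expR (- P s)) s (- mult_re a b a' b' s * expR (- P s)) (- 0 * expR (- P s)),
    rate (fun s => cos (Q s)) s (- sin (Q s) * mult_im a b a' b' s) (- sin (Q s) * 0) &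
    rate (fun s => sin (Q s)) s (cos (Q s) * mult_im a b a' b' s) (cos (Q s) * 0)].
  move=> st; have sT : 0 < s < T by case/andP: st => -> /lt_le_trans ->.
  have rP : rate P s (mult_re a b a' b' s) 0 := wint_rate hlam hlam_inv T0 theta st tT cm.
  have rQ : rate Q s (mult_im a b a' b' s) 0 := wint_rate hlam hlam_inv T0 theta st tT cn.
  split => //; [exact: (rate_expR HD sT (rateN rP))|exact: (rate_cos_comp HD sT rQ)|
    exact: (rate_sin_comp HD sT rQ)].
rewrite /log_mult -/P -/Q; apply: cplx_eq; rewrite !cxE /= cosN sinN; [rewrite [LHS](_ : _ = 1 * ((a 0 - a' 0) * 1 + (b 0 - b' 0) * 0)); last by ring|
  rewrite [LHS](_ : _ = 1 * ((b 0 - b' 0) * 1 - (a 0 - a' 0) * 0)); last by ring].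
  rewrite -H1; first by rewrite -/P -/Q; ring.
    by apply: withinM => //; apply: withinD; apply: withinM.
  move=> s st; have [sT rE rC rS] := rates s st.
  have [d1 d2] := difference_rate Hf Hf' st.
  apply: rate_eq (rateM HD sT rE (rateD (rateM HD sT d1 rC) (rateM HD sT d2 rS))); ring.
rewrite -H2; first by rewrite -/P -/Q; ring.
  by apply: withinM => //; apply: withinB; apply: withinM.
move=> s st; have [sT rE rC rS] := rates s st.
have [d1 d2] := difference_rate Hf Hf' st.
apply: rate_eq (rateM HD sT rE (rateB (rateM HD sT d2 rC) (rateM HD sT d1 rS))); ring.
Qed.

Definition flow_distance_constant t (c : R) := expR (lipschitz_rate c * L t).

Lemma flow_distance t a b a' b' c : t <= T -> disc_flow t a b -> disc_flow t a' b' ->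
  c < 1 -> fsqmod a b t <= c -> fsqmod a' b' t <= c -> forall s, 0 <= s <= t ->
  `|a s - a' s| + `|b s - b' s| <=
    2 * flow_distance_constant t c * cmod ((a t +i* b t) - (a' t +i* b' t) : cplx R).
Proof.
move=> tT Hf Hf' c1 ca ca' s /andP[s0 st].
have Ls : 0 <= L s by rewrite -(clock0 lam); exact: (clock_le HD (lexx 0) s0 (le_trans st tT)).
have Lst : 0 <= L t - L s by rewrite subr_ge0; exact: (clock_le HD s0 st tT).
have k0 : 0 <= lipschitz_rate c.
  by rewrite /lipschitz_rate mulr_ge0// addr_ge0// sqr_ge0.
have e1 : 1 <= flow_distance_constant t c.
  rewrite /flow_distance_constant -expR0 ler_expR mulr_ge0//; lra.
have e0 : 0 <= flow_distance_constant t c by lra.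
have H : sqdist a b a' b' s <=
    (flow_distance_constant t c * cmod ((a t +i* b t) - (a' t +i* b' t) : cplx R)) ^+ 2.
  apply: le_trans (sqdist_backward HD tT Hf Hf' c1 s0 st (lexx t) ca ca') _.
  rewrite exprMn cmod_sqr !cxE /= mulrC ler_wpM2r ?sqmod_ge0//.
  apply: (@le_trans _ _ (flow_distance_constant t c)); last by rewrite expr2 ler_peMl.
  by rewrite ler_expR ler_wpM2l//; lra.
have D0 := mulr_ge0 e0 (cmod_ge0 ((a t +i* b t) - (a' t +i* b' t) : cplx R)).
rewrite -mulrA mulr_natl mulr2n; apply: lerD.
  rewrite -(@ler_pXn2r _ 2%N) ?nnegrE// real_normK ?num_real//; apply: le_trans H.
  by rewrite lerDl sqr_ge0.
rewrite -(@ler_pXn2r _ 2%N) ?nnegrE// real_normK ?num_real//; apply: le_trans H.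
by rewrite lerDr sqr_ge0.
Qed.

Lemma poisson_distance t a b a' b' c : t <= T -> disc_flow t a b -> disc_flow t a' b' ->
  c < 1 -> fsqmod a b t <= c -> fsqmod a' b' t <= c ->
  let e := 2 * poisson_lipschitz_constant c *
    (2 * flow_distance_constant t c * cmod ((a t +i* b t) - (a' t +i* b' t) : cplx R)) in
  forall s, 0 <= s <= t ->
  [/\ `|fpoisson theta a b s - fpoisson theta a' b' s| <= e,
      `|fconj theta a b s - fconj theta a' b' s| <= e,
      `|fpoisson theta a b s| <= 4 / (1 - c) & `|fconj theta a b s| <= 4 / (1 - c)].
Proof.
move=> tT Hf Hf' c1 ca ca' e s st; have d := flow_distance tT Hf Hf' c1 ca ca' st.
have [s0 st'] := andP st.
have cs : sqmod (a s) (b s) <= c by apply: le_trans ca; exact: (flow_sqmod_nondecreasing HD tT Hf s0 st').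
have cs' : sqmod (a' s) (b' s) <= c by apply: le_trans ca'; exact: (flow_sqmod_nondecreasing HD tT Hf' s0 st').
have [l1 l2] := poisson_lipschitz (theta s) c1 cs cs'.
have [n1 n2] := poisson_norm_bound (theta s) c1 cs.
have K0 : 0 <= 2 * poisson_lipschitz_constant c.
  by rewrite mulr_ge0// !addr_ge0// sqr_ge0.
split => //; [apply: le_trans l1 _|apply: le_trans l2 _]; exact: ler_wpM2l.
Qed.

Lemma mult_distance t a b a' b' c : t <= T -> disc_flow t a b -> disc_flow t a' b' ->
  c < 1 -> fsqmod a b t <= c -> fsqmod a' b' t <= c ->
  let e := (1 + 4 / (1 - c)) * (2 * poisson_lipschitz_constant c *
    (2 * flow_distance_constant t c * cmod ((a t +i* b t) - (a' t +i* b' t) : cplx R))) in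
  forall s, 0 <= s <= t ->
  `|mult_re a b a b s - mult_re a b a' b' s| <= e /\
  `|mult_im a b a b s - mult_im a b a' b' s| <= e.
Proof.
move=> tT Hf Hf' c1 ca ca' e s st.
have [u v n1 n2] := poisson_distance tT Hf Hf' c1 ca ca' st.
rewrite /mult_re /mult_im /e; move: u v n1 n2; set k := 2 * poisson_lipschitz_constant c * _.
set B := 4 / (1 - c).
move: (fpoisson theta a b s) (fconj theta a b s) (fpoisson theta a' b' s) (fconj theta a' b' s).
move=> u v u' v' hu hv hB hB'.
have B1 : `|1 + u| <= 1 + B by apply: le_trans (ler_normD _ _) _; rewrite normr1 lerD2l.
have B2 : `|v| <= 1 + B by lra.
have p1 (x y : R) : `|x| <= 1 + B -> `|y| <= k -> `|x * y| <= (1 + B) * k.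
  by move=> x1 y1; rewrite normrM ler_pM.
have q1 := p1 _ _ B1 hu; have q2 := p1 _ _ B2 hv; have q3 := p1 _ _ B1 hv; have q4 := p1 _ _ B2 hu.
split.
  rewrite (_ : _ - _ = ((1 + u) * (u - u') - v * (v - v')) / 2); last by field.
  rewrite normrM [`|2^-1|]ger0_norm//; apply: (@le_trans _ _ (((1 + B) * k + (1 + B) * k) / 2)); last by lra.
  by rewrite ler_wpM2r//; apply: le_trans (ler_normB _ _) _; exact: lerD.
rewrite (_ : _ - _ = ((1 + u) * (v - v') + v * (u - u')) / 2); last by field.
rewrite normrM [`|2^-1|]ger0_norm//; apply: (@le_trans _ _ (((1 + B) * k + (1 + B) * k) / 2)); last by lra.
by rewrite ler_wpM2r//; apply: le_trans (ler_normD _ _) _; exact: lerD.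
Qed.

End flow_difference.

Section exponential_relation.
Context (R : realType) (C : R) (C0 : 0 < C).
Context (taylor : forall w : cplx R, cmod w <= 1 -> cmod (cexp w - 1 - w) <= C * cmod w ^+ 2).
Implicit Types (A B D w : cplx R).

Lemma cexp_sub1_le w : cmod w <= 1 -> cmod (cexp w - 1) <= (1 + C) * cmod w.
Proof.
move=> w1; rewrite (_ : cexp w - 1 = (cexp w - 1 - w) + w); last by ring.
apply: le_trans (cmodD _ _) _; rewrite mulrDl mul1r [leRHS]addrC lerD2r.
apply: le_trans (taylor w1) _; rewrite ler_wpM2l ?(ltW C0)// expr2 ler_piMl ?cmod_ge0//.
Qed.

(** To be applied with w the increment of the argument and D that of the inverse map, which are
    related through their exponentials. Expanding both exponentials to first order with quadratic
    remainder replaces a local logarithm. *)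
Lemma exp_relation_error K A B D w : 0 <= K -> cmod w <= 1 -> cmod D <= 1 ->
  cmod D <= K * cmod w -> cmod (B - A) <= K * cmod w ->
  cexp ('i * D) - 1 = B * (cexp ('i * w) - 1) ->
  cmod (D - A * w) <= (C * K ^+ 2 + (cmod A + K) * C + K) * cmod w ^+ 2.
Proof.
move=> K0 w1 D1 hD hB rel.
have -> : cmod (D - A * w) = cmod (- (cexp ('i * D) - 1 - 'i * D) +
    (B * (cexp ('i * w) - 1 - 'i * w) + (B - A) * ('i * w))).
  by rewrite -cmod_i rel; congr cmod; ring.
have cw := cmod_ge0 w.
have t1 : cmod (cexp ('i * D) - 1 - 'i * D) <= C * K ^+ 2 * cmod w ^+ 2.
  have := @taylor ('i * D); rewrite cmod_i => /(_ D1) h; apply: le_trans h _.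
  by rewrite -mulrA -exprMn ler_wpM2l ?(ltW C0)// lerXn2r ?nnegrE ?cmod_ge0// mulr_ge0.
have Bb : cmod B <= cmod A + K.
  rewrite (_ : B = A + (B - A)); last by ring.
  apply: le_trans (cmodD _ _) _; rewrite lerD2l; apply: le_trans hB _.
  by rewrite ler_piMr.
have t2 : cmod (B * (cexp ('i * w) - 1 - 'i * w)) <= (cmod A + K) * C * cmod w ^+ 2.
  rewrite cmodM -mulrA; apply: ler_pM; rewrite ?cmod_ge0//.
  by have := @taylor ('i * w); rewrite cmod_i; apply.
have t3 : cmod ((B - A) * ('i * w)) <= K * cmod w ^+ 2.
  by rewrite cmodM cmod_i expr2 mulrA ler_wpM2r.
apply: le_trans (cmodD _ _) _; rewrite cmodN.
have t4 := cmodD (B * (cexp ('i * w) - 1 - 'i * w)) ((B - A) * ('i * w)).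
by lra.
Qed.

End exponential_relation.

Section inverse_derivative.
Context (R : realType) (T : R) (lam theta n : R -> R).
Context (hlam : weight_function T lam).
Context (hlam_inv : has_ubound (inv_weight_values T lam)).
Context (T0 : 0 < T).
Context (HD : driven T (clock lam) theta n).
Context (h : R -> cplx R -> cplx R) (hh : covering_flow T lam theta h).
Local Notation L := (clock lam).
Local Notation Re := complex.Re.
Local Notation Im := complex.Im.
Local Notation disc_flow := (disc_flow L theta).
Local Notation ends_at := (ends_at lam theta).
Implicit Types (z u w : cplx R).

Lemma ends_wint t z a b Q V : 0 <= t -> t <= T -> ends_at t z a b Q V ->
  Q 0 = wint lam (fpoisson theta a b) t /\ V 0 = wint lam (fconj theta a b) t.
Proof.
move=> t0 tT He; have Hf := ends_flow He.
have cU := flow_poisson_within HD tT Hf; have cV := flow_conj_within HD tT Hf.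
have H1 := @rate_constant _ T L theta n HD (fun s => Q s + wint lam (fpoisson theta a b) s) 0 t (lexx 0) t0 tT.
have H2 := @rate_constant _ T L theta n HD (fun s => V s + wint lam (fconj theta a b) s) 0 t (lexx 0) t0 tT.
rewrite !wint0 !addr0 (ends_Q He) (ends_V He) !add0r in H1 H2; split; symmetry.
  apply: H1.
    by apply: withinD; [exact: ends_Q_continuous He|exact: (wint_within hlam t0 tT cU)].
  move=> s st; apply: rate_eq (rateD (ends_Q_rate He st) (wint_rate hlam hlam_inv T0 theta st tT cU)).
    by rewrite addNr.
  by rewrite addr0.
apply: H2.
  by apply: withinD; [exact: ends_V_continuous He|exact: (wint_within hlam t0 tT cV)].
move=> s st; apply: rate_eq (rateD (ends_V_rate He st) (wint_rate hlam hlam_inv T0 theta st tT cV)).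
  by rewrite addNr.
by rewrite addr0.
Qed.

(** Divided by the starting point, [flow_difference] for the lines ending at z and w + z reads exp
    (i D) - 1 = B (exp (i w) - 1), where B differs from the claimed derivative A by O(|w|). The
    quotient in A comes from taking logarithms at both ends of the line. *)
Lemma inverse_flow_derivable t z a b Q V : 0 <= t -> t <= T -> 0 < Im z ->
  ends_at t z a b Q V ->
  derivable (inverse_flow lam theta h t) z 1 /\
  derive1 (inverse_flow lam theta h t) z =
    cexp ('i * z) / (a 0 +i* b 0) * cexp (- log_mult lam theta t a b a b).
Proof.
move=> t0 tT z0 He; have Hf := ends_flow He.
set f := inverse_flow lam theta h t; set A := _ * cexp _.
have [C C0 taylor] := cexp_taylor R.
have Lt : 0 <= L t by rewrite -(clock0 lam); exact: (clock_le HD (lexx 0) t0 tT).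
(* Endpoints of height at least Im z / 2 lie in one disc of squared radius c < 1, which provides
   Lipschitz constants uniform near z. *)
pose c := expR (- (Im z / 2)) ^+ 2.
have c1 : c < 1 by rewrite expr_lt1 ?expR_ge0// expR_lt1 oppr_lt0 divr_gt0.
have end_le z' a' b' Q' V' : ends_at t z' a' b' Q' V' -> Im z / 2 <= Im z' -> fsqmod a' b' t <= c.
  move=> He' h2; rewrite /fsqmod (ends_re He') (ends_im He') -cmod_sqr cmod_cexp Re_muli.
  by rewrite lerXn2r ?nnegrE ?expR_ge0// ler_expR lerN2.
have ca : fsqmod a b t <= c by apply: (end_le _ _ _ _ _ He); rewrite ler_pdivrMr// ler_peMr ?ltW// ltr1n.
pose k := 2 * poisson_lipschitz_constant c * (2 * flow_distance_constant lam t c).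
have k0 : 0 <= k.
  by rewrite /k !mulr_ge0 ?expR_ge0// /poisson_lipschitz_constant !addr_ge0// sqr_ge0.
have B0 : 0 <= 1 + 4 / (1 - c) by rewrite addr_ge0// divr_ge0// subr_ge0 ltW.
(* Relative to |w|, [KD] bounds the increment D, [Kl] the change of the exponent [log_mult], and
   [KB] the difference B - A. *)
pose KD := 1 + 2 * (k * (1 + C) * L t).
pose Kl := 2 * ((1 + 4 / (1 - c)) * (k * (1 + C)) * L t).
pose KB := cmod A * ((1 + C) * Kl).
have C1 : 0 <= 1 + C by rewrite addr_ge0// ltW.
have kC : 0 <= k * (1 + C) by exact: mulr_ge0.
have KD0 : 0 <= KD by rewrite addr_ge0// mulr_ge0// mulr_ge0.
have Kl0 : 0 <= Kl by rewrite mulr_ge0// mulr_ge0// mulr_ge0.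
have KB0 : 0 <= KB by rewrite mulr_ge0 ?cmod_ge0// mulr_ge0.
pose K := KD + Kl + KB.
have K0 : 0 <= K by rewrite addr_ge0// addr_ge0.
(* The bound 1 serves the Taylor estimate, Im z / 2 keeps w + z at the required height, and 1 / (K +
   1) gives K |w| <= 1, so that D and the change of the exponent are also in the Taylor range. *)
pose d := Num.min 1 (Num.min (Im z / 2) (K + 1)^-1).
have d0 : 0 < d by rewrite !lt_min ltr01 divr_gt0// invr_gt0 ltr_wpDl.
have Ktot : 0 <= C * K ^+ 2 + (cmod A + K) * C + K.
  have := mulr_ge0 (ltW C0) (sqr_ge0 K).
  have := mulr_ge0 (addr_ge0 (cmod_ge0 A) K0) (ltW C0); lra.
apply: (derive_of_quadratic_error Ktot d0) => w.
rewrite !lt_min => /and3P[/ltW w1 /ltW w2 /ltW w3].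
have cw := cmod_ge0 w.
have Kw : K * cmod w <= 1.
  have := ler_wpM2l K0 w3; move=> /le_trans; apply.
  by rewrite ler_pdivrMr ?ltr_wpDl// mul1r lerDl.
have wz : Im z / 2 <= Im (w + z).
  by have := Im_le_cmod w; rewrite cImD ler_norml => /andP[]; lra.
have wz0 : 0 < Im (w + z) by apply: lt_le_trans wz; rewrite divr_gt0.
have [a' [b' [Q' [V' He']]]] := ends_at_exists hlam hlam_inv T0 HD t0 tT wz0.
have Hf' := ends_flow He'; have ca' := end_le _ _ _ _ _ He' wz.
have Ez : (a t +i* b t : cplx R) = cexp ('i * z).
  by apply: cplx_eq; rewrite /= ?(ends_re He) ?(ends_im He).
have Ez' : (a' t +i* b' t : cplx R) = cexp ('i * (w + z)).
  by apply: cplx_eq; rewrite /= ?(ends_re He') ?(ends_im He').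
have fz := inverse_flowE hlam hlam_inv T0 HD hh t0 tT He.
have fz' := inverse_flowE hlam hlam_inv T0 HD hh t0 tT He'.
have Fz : (a 0 +i* b 0 : cplx R) = cexp ('i * f z) by rewrite (ends_start He) -fz.
have Fz' : (a' 0 +i* b' 0 : cplx R) = cexp ('i * f (w + z)) by rewrite (ends_start He') -fz'.
have zeta1 : cmod (cexp ('i * z)) <= 1.
  by rewrite cmod_cexp Re_muli -expR0 ler_expR oppr_le0 ltW.
have split_end : cexp ('i * (w + z)) = cexp ('i * z) * cexp ('i * w).
  by rewrite -cexpD -mulrDr addrC.
have dist : cmod ((a t +i* b t) - (a' t +i* b' t) : cplx R) <= (1 + C) * cmod w.
  rewrite Ez Ez' split_end -cmodN opprB -{2}[cexp ('i * z)]mulr1 -mulrBr cmodM.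
  rewrite -[leRHS]mul1r; apply: ler_pM; rewrite ?cmod_ge0//.
  by have := @cexp_sub1_le R C C0 taylor ('i * w); rewrite cmod_i; apply.
have kdist : k * cmod ((a t +i* b t) - (a' t +i* b' t) : cplx R) <= k * (1 + C) * cmod w.
  by rewrite -mulrA ler_wpM2l.
have hp s : 0 <= s <= t -> `|fpoisson theta a b s - fpoisson theta a' b' s| <= k * (1 + C) * cmod w /\
    `|fconj theta a b s - fconj theta a' b' s| <= k * (1 + C) * cmod w.
  move=> st; have [u1 u2 _ _] := poisson_distance HD tT Hf Hf' c1 ca ca' st.
  by split; apply: le_trans kdist; rewrite /k -[leRHS]mulrA.
have hm s : 0 <= s <= t ->
    `|mult_re theta a b a b s - mult_re theta a b a' b' s| <= (1 + 4 / (1 - c)) * (k * (1 + C) * cmod w) /\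
    `|mult_im theta a b a b s - mult_im theta a b a' b' s| <= (1 + 4 / (1 - c)) * (k * (1 + C) * cmod w).
  move=> st; have [u1 u2] := mult_distance HD tT Hf Hf' c1 ca ca' st.
  by split; [apply: le_trans u1 _|apply: le_trans u2 _]; rewrite ler_wpM2l//;
    apply: le_trans kdist; rewrite /k -[leRHS]mulrA.
have cU := flow_poisson_within HD tT Hf; have cV := flow_conj_within HD tT Hf.
have cU' := flow_poisson_within HD tT Hf'; have cV' := flow_conj_within HD tT Hf'.
have [Q0 V0] := ends_wint t0 tT He; have [Q0' V0'] := ends_wint t0 tT He'.
have dQ : `|Q 0 - Q' 0| <= k * (1 + C) * cmod w * L t.
  rewrite Q0 Q0'; exact: (wint_dist hlam hlam_inv T0 HD t0 tT cU cU' (fun s st => (hp s st).1) t0 (lexx t)).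
have dV : `|V 0 - V' 0| <= k * (1 + C) * cmod w * L t.
  rewrite V0 V0'; exact: (wint_dist hlam hlam_inv T0 HD t0 tT cV cV' (fun s st => (hp s st).2) t0 (lexx t)).
set D := f (w + z) - f z.
have hD : cmod D <= KD * cmod w.
  have -> : D = w + ((V 0 - V' 0) +i* (Q' 0 - Q 0)).
    by rewrite /D /f fz fz'; apply: cplx_eq; rewrite !cxE /=; ring.
  apply: le_trans (cmodD _ _) _; rewrite mulrDl mul1r lerD2l.
  apply: le_trans (cmod_le_sum _) _; rewrite /= [`|Q' 0 - Q 0|]distrC; lra.
have cm := mult_re_within HD tT Hf Hf; have cn := mult_im_within HD tT Hf Hf.
have cm' := mult_re_within HD tT Hf Hf'; have cn' := mult_im_within HD tT Hf Hf'.
set l := log_mult lam theta t a b a b; set l' := log_mult lam theta t a b a' b'.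
have hl : cmod (l - l') <= Kl * cmod w.
  apply: le_trans (cmod_le_sum _) _; rewrite cReD cImD cReN cImN /=.
  have := wint_dist hlam hlam_inv T0 HD t0 tT cm cm' (fun s st => (hm s st).1) t0 (lexx t).
  have := wint_dist hlam hlam_inv T0 HD t0 tT cn cn' (fun s st => (hm s st).2) t0 (lexx t).
  by rewrite /Kl; lra.
pose B := cexp ('i * z) / (a 0 +i* b 0) * cexp (- l').
have hB : cmod (B - A) <= KB * cmod w.
  have -> : B - A = A * (cexp (l - l') - 1).
    have el : cexp (- l') = cexp (- l) * cexp (l - l') by rewrite -cexpD addrA addNr add0r.
    by rewrite /B el /A -/l; ring.
  have l1 : cmod (l - l') <= 1.
    by apply: le_trans hl _; apply: le_trans Kw; rewrite ler_wpM2r// /K; lra.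
  rewrite cmodM /KB -mulrA ler_wpM2l ?cmod_ge0//.
  apply: le_trans (cexp_sub1_le C0 taylor l1) _.
  by rewrite -mulrA ler_wpM2l.
have rel : cexp ('i * D) - 1 = B * (cexp ('i * w) - 1).
  have F0 : cexp ('i * f z) != 0 by exact: cexp_neq0.
  have := flow_difference hlam hlam_inv T0 HD t0 tT Hf Hf'.
  rewrite Fz Fz' Ez Ez' -/l' split_end.
  have -> : cexp ('i * f (w + z)) = cexp ('i * f z) * cexp ('i * D).
    by rewrite -cexpD -mulrDr /D [f z + _]addrC subrK.
  move=> E; apply: (mulfI F0); rewrite /B Fz.
  transitivity (- (cexp ('i * f z) - cexp ('i * f z) * cexp ('i * D))); first by ring.
  by rewrite E; field; rewrite F0.
have K1 : KD <= K by rewrite /K; lra.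
have K2 : KB <= K by rewrite /K; lra.
apply: (exp_relation_error C0 taylor K0 w1 _ _ _ rel).
- by apply: le_trans hD _; apply: le_trans Kw; exact: ler_wpM2r.
- by apply: le_trans hD _; exact: ler_wpM2r.
- by apply: le_trans hB _; exact: ler_wpM2r.
Qed.

End inverse_derivative.

(** * The bound on the derivative above the driving point *)

Section derivative_bound.
Context (R : realType) (T : R) (lam theta n : R -> R).
Context (hlam : weight_function T lam).
Context (hlam_inv : has_ubound (inv_weight_values T lam)).
Context (T0 : 0 < T).
Context (HD : driven T (clock lam) theta n).
Local Notation L := (clock lam).
Local Notation Re := complex.Re.
Local Notation Im := complex.Im.
Local Notation ends_at := (ends_at lam theta).
Implicit Types (z u w : cplx R).

Lemma ends_at_derivative_cmod t z a b Q V : ends_at t z a b Q V ->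
  cmod (cexp ('i * z) / (a 0 +i* b 0) * cexp (- log_mult lam theta t a b a b)) =
  expR (Q 0 - wint lam (mult_re theta a b a b) t).
Proof.
move=> He; rewrite (ends_start He); set u : cplx R := _ +i* _.
have -> : cexp ('i * z) = cexp ('i * (z - u)) * cexp ('i * u).
  by rewrite -cexpD -mulrDr subrK.
rewrite mulfK ?cexp_neq0// -cexpD cmod_cexp; congr expR.
by rewrite !cxE /=; ring.
Qed.

(** Harnack's inequality: at modulus r the Poisson kernel (1 - N) / E is at most (1 + r) / (1 - r),
    with equality on the ray through w, and this bound increases with r. The left side is taken on
    the ray at modulus exp (- y), the right side at a modulus no larger. *)
Lemma log_size_tip_le x (t s y : R) : 0 < y -> cmod x <= expR (- y) ->
  ln (gap (expR (- y) * cos (theta t)) (expR (- y) * sin (theta t)) (theta t)) -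
    ln (1 - sqmod (expR (- y) * cos (theta t)) (expR (- y) * sin (theta t))) <=
  ln (gap (Re x) (Im x) (theta s)) - ln (1 - sqmod (Re x) (Im x)).
Proof.
move=> y0; have p1 : expR (- y) < 1 by rewrite expR_lt1 oppr_lt0.
have p0 : 0 <= expR (- y) by exact: expR_ge0.
have -> : gap (expR (- y) * cos (theta t)) (expR (- y) * sin (theta t)) (theta t) =
    (1 - expR (- y)) ^+ 2.
  have := cos2Dsin2 (theta t); rewrite /gap => h.
  transitivity ((1 - expR (- y)) ^+ 2 * (cos (theta t) ^+ 2 + sin (theta t) ^+ 2)); first by ring.
  by rewrite h mulr1.
have -> : sqmod (expR (- y) * cos (theta t)) (expR (- y) * sin (theta t)) = expR (- y) ^+ 2.
  by rewrite /sqmod !exprMn -mulrDr cos2Dsin2 mulr1.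
move: (expR (- y)) p0 p1 => p p0 p1 xp; rewrite gap_cmod -cmod_sqr.
have tri : 1 <= cmod x + cmod (x - driving theta s).
  have := cmodD x (- (x - driving theta s)); rewrite cmodN.
  by rewrite opprB addrCA subrr addr0 cmod_driving.
have x0 := cmod_ge0 x; move: (cmod (x - _)) (cmod x) tri x0 xp => e r er r0 rp.
have e1 : 1 - r <= e by lra.
have r1 : r < 1 by exact: le_lt_trans p1.
have q1 : 0 < 1 - p ^+ 2 by rewrite subr_gt0 expr_lt1.
have q2 : 0 < 1 - r ^+ 2 by rewrite subr_gt0 expr_lt1.
have e0 : 0 < e by apply: lt_le_trans e1; rewrite subr_gt0.
have p2 : 0 < 1 - p by rewrite subr_gt0.
rewrite lerBlDr -addrAC lerBrDr -!lnM ?posrE ?exprn_gt0// ler_ln ?posrE ?mulr_gt0 ?exprn_gt0//.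
apply: (@le_trans _ _ ((1 - r) ^+ 2 * (1 - p ^+ 2))).
  have : 0 <= (1 - r) * (1 - p) * (2 * (p - r)).
    by rewrite !mulr_ge0// subr_ge0// ltW.
  by rewrite !expr2; lra.
by rewrite ler_wpM2r ?(ltW q1)// lerXn2r ?nnegrE ?(ltW e0)// subr_ge0 ltW.
Qed.

Lemma derivative_exponent_le t y a b Q V : 0 <= t -> t <= T -> 0 < y ->
  ends_at t (theta t +i* y) a b Q V ->
  Q 0 - wint lam (mult_re theta a b a b) t <= 4^-1 * (n t - n 0).
Proof.
move=> t0 tT y0 He; have Hf := ends_flow He.
have cm := mult_re_within HD tT Hf Hf.
set M := wint lam (mult_re theta a b a b).
(* Minus the logarithm of the Poisson kernel U; by [log_size_tip_le] its value at t is at most that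
   at 0, so it drops out of the final estimate. *)
pose Psi s := ln (fgap theta a b s) - ln (1 - fsqmod a b s).
have := @rate_energy_le _ T L theta n HD (fun s => Psi s + (Q s - (M t - M s))) 0 t 1 (lexx 0) t0 tT ler01.
have c1 := log_gap_within HD tT Hf; have c2 := log_one_sub_within HD tT Hf.
have cM : {within `[0, t], continuous M} := wint_within hlam t0 tT cm.
have cf : {within `[0, t], continuous (fun s => Psi s + (Q s - (M t - M s)))}.
  apply: withinD; first exact: withinB.
  apply: withinB; first exact: ends_Q_continuous He.
  by apply: withinB => //; exact: within_cst.
move=> /(_ cf) H.
have rates s : 0 < s < t -> exists rho v,
    [/\ rate L theta (fun s => Psi s + (Q s - (M t - M s))) s rho v, 0 <= rho & v ^+ 2 <= 1 * rho].
  (* With 2 N / E = |P - 1|^2 / 2 all terms in U cancel and V^2 remains, so the energy estimate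
     applies with kappa = 1. *)
  move=> st; exists (fconj theta a b s ^+ 2), (- fconj theta a b s); split.
  - have r1 := flow_log_gap_rate HD tT Hf st; have r2 := flow_one_sub_rate HD tT Hf st.
    have r3 := ends_Q_rate He st.
    have r4 := rateB (rate_cst L theta (M t) s) (wint_rate hlam hlam_inv T0 theta st tT cm).
    have size := flow_sizeE Hf st.
    apply: rate_eq (rateD (rateB r1 r2) (rateB r3 r4)).
      rewrite /mult_re; have : 2 * fsqmod a b s / fgap theta a b s =
        (4 * fsqmod a b s / fgap theta a b s) / 2 by field; rewrite gt_eqF // (flow_gap_pos Hf st).
      by rewrite size mulNr => ->; field.
    by ring.
  - exact: sqr_ge0.
  - by rewrite mul1r sqrrN.
have := H rates.
rewrite {2}/Psi /Psi (ends_Q He) /M wint0 subrr subr0 subr0 addr0 -/M.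
have [ra rb] : a t = expR (- y) * cos (theta t) /\ b t = expR (- y) * sin (theta t).
  by rewrite (ends_re He) (ends_im He) !cxE.
have Nm : cmod (a 0 +i* b 0 : cplx R) <= expR (- y).
  rewrite cmod_le ?expR_ge0//=; apply: le_trans (flow_sqmod_nondecreasing HD tT Hf (lexx 0) t0 (lexx t)) _.
  by rewrite /fsqmod ra rb /sqmod !exprMn -mulrDr cos2Dsin2 mulr1.
have := @log_size_tip_le (a 0 +i* b 0) t 0 y y0 Nm.
rewrite /= /fgap /fsqmod -ra -rb div1r; lra.
Qed.

End derivative_bound.

Theorem theorem3p9 (R : realType) (T : R) (hT : 0 < T)
    (lam : R -> R) (hlam : weight_function T lam)
    (hlam_inv : has_ubound (inv_weight_values T lam))
    (theta : R -> R) (htheta : absolutely_continuous T theta)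
    (htheta0 : theta 0 = 0) (hE : (energy T theta < +oo)%E)
    (h : R -> cplx R -> cplx R) (hh : covering_flow T lam theta h) :
  (forall t : R, 0 <= t <= T -> forall y : R, 0 < y ->
     derivable (inverse_flow lam theta h t) (theta t +i* y : cplx R) 1 /\
     `|derive1 (inverse_flow lam theta h t) (theta t +i* y : cplx R)| <=
       (expR (2^-1 * inv_weight_norm T lam * fine (energy T theta)))%:C) /\
  (exists gamma : R -> cplx R,
     generates_radial_chord T lam theta gamma /\ simple_chord T gamma).
Proof.
have [n HD nT] := weight_driven hlam hlam_inv hT htheta hE.
split; last first.
  have [gamma Hg] := tip_curve_exists hlam hlam_inv hT HD; exists gamma; split.
    exact: (tip_generates hlam hlam_inv hT HD hh Hg).
  exact: (tip_simple hlam hlam_inv hT HD Hg).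
move=> t /andP[t0 tT] y y0; set z : cplx R := theta t +i* y.
have z0 : 0 < complex.Im z by [].
have [a [b [Q [V He]]]] := ends_at_exists hlam hlam_inv hT HD t0 tT z0.
have [df ->] := inverse_flow_derivable hlam hlam_inv hT HD hh t0 tT z0 He.
split=> //; rewrite normcE lecR (ends_at_derivative_cmod He) ler_expR.
apply: le_trans (derivative_exponent_le hlam hlam_inv hT HD t0 tT y0 He) _.
(* A quarter of n t - n 0 is at most a quarter of n T - n 0, which by [nT] is at most the exponent
   of the statement. *)
by have := driven_energy_nondecreasing HD t0 tT (lexx T); lra.
Qed.
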